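(* Let $-A$ be the generator of a bounded $C_0$-group on a Banach space $X$. Then $A$ admits the $\mathcal B$-calculus if and only if $A$ admits the $C_0(i\mathbb R)$-calculus.
   Context: $\mathbb C_+=\{z:\Re z>0\}$. $\mathcal B$ is the Banach algebra of holomorphic $f$ on $\mathbb C_+$ with $\|f\|_{\mathcal B_0}:=\int_0^\infty\sup_{\beta\in\mathbb R}|f'(\alpha+i\beta)|\,d\alpha<\infty$, with norm $\|f\|_{\mathcal B}=\sup_{\mathbb C_+}|f|+\|f\|_{\mathcal B_0}$. $r_z(\lambda)=(z+\lambda)^{-1}$. An operator $A$ on $X$ admits the $\mathcal B$-calculus if $A$ is densely defined, $\sigma(A)\subset\overline{\mathbb C}_+$, and there is a bounded algebra homomorphism $\Phi:\mathcal B\to L(X)$ with $\Phi(r_z)=(z+A)^{-1}$ for all $z\in\mathbb C_+$. A closed densely defined operator $A$ admits the $C_0(i\mathbb R)$-calculus if $\sigma(A)\subset i\mathbb R$ and there is a bounded algebra homomorphism $H:C_0(i\mathbb R)\to L(X)$ with $H(r_z)=(z+A)^{-1}$ for all $z\in\mathbb C\setminus i\mathbb R$ (here $r_z$ is restricted to $i\mathbb R$, and $C_0(i\mathbb R)$ is the algebra of continuous functions on $i\mathbb R$ vanishing at infinity with the sup norm). *)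

(* Defs.v *)
From HB Require Import structures.
From mathcomp Require Import all_boot all_order all_algebra.
From mathcomp Require Import all_classical all_reals all_analysis.
From mathcomp Require Import complex.
Import Order.TTheory GRing.Theory Num.Theory.
Import numFieldNormedType.Exports.

Set Implicit Arguments.
Unset Strict Implicit.
Unset Printing Implicit Defensive.

Local Open Scope classical_set_scope.
Local Open Scope ring_scope.

Section Defs.
Variable R : realType.
Variable X : completeNormedModType R[i].

Definition bounded_linear (S : X -> X) : Prop :=
  (forall x y, S (x + y) = S x + S y) /\
  (forall (c : R[i]) x, S (c *: x) = c *: S x) /\
  (exists M : R, forall x, `|S x| <= (M%:C)%C * `|x|).

Definition linear_operator (D : set X) (A : X -> X) : Prop :=
  D 0 /\
  (forall x y, D x -> D y -> D (x + y) /\ A (x + y) = A x + A y) /\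
  (forall (c : R[i]) x, D x -> D (c *: x) /\ A (c *: x) = c *: A x).

Definition densely_defined (D : set X) : Prop := closure D = setT.

Definition closed_operator (D : set X) (A : X -> X) : Prop :=
  closed [set p : X * X | D p.1 /\ p.2 = A p.1].

Definition inv_plus (D : set X) (A : X -> X) (z : R[i]) (S : X -> X) : Prop :=
  bounded_linear S /\
  (forall x, D (S x) /\ z *: S x + A (S x) = x) /\
  (forall y, D y -> S (z *: y + A y) = y).

(* lambda is in the spectrum of A iff lambda - A = -((-lambda) + A) has no
   bounded inverse *)
Definition spectrum (D : set X) (A : X -> X) : set R[i] :=
  [set l | ~ exists S, inv_plus D A (- l) S].

Definition C0_group (T : R -> X -> X) : Prop :=
  (forall t, bounded_linear (T t)) /\
  (forall x, T 0 x = x) /\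
  (forall s t x, T (s + t) x = T s (T t x)) /\
  (forall x, continuous (fun t => T t x)).

Definition bounded_group (T : R -> X -> X) : Prop :=
  exists M : R, forall t x, `|T t x| <= (M%:C)%C * `|x|.

Definition diff_quot (T : R -> X -> X) (x : X) : R -> X :=
  fun h => ((h^-1)%:C)%C *: (T h x - x).

Definition generator (T : R -> X -> X) (D : set X) (G : X -> X) : Prop :=
  (forall x, D x <-> cvg (diff_quot T x @ 0^')) /\
  (forall x, D x -> G x = lim (diff_quot T x @ 0^')).

Definition bounded_alg_hom (U : Type) (S : set (U -> R[i]))
  (nrm : (U -> R[i]) -> R) (Phi : (U -> R[i]) -> X -> X) : Prop :=
  (forall f, S f -> bounded_linear (Phi f)) /\
  (forall f g, S f -> S g -> forall x,
      Phi (fun u => f u + g u) x = Phi f x + Phi g x) /\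
  (forall (c : R[i]) f, S f -> forall x,
      Phi (fun u => c * f u) x = c *: Phi f x) /\
  (forall f g, S f -> S g -> forall x,
      Phi (fun u => f u * g u) x = Phi f (Phi g x)) /\
  (exists M : R, forall f, S f -> forall x,
      `|Phi f x| <= ((M * nrm f)%:C)%C * `|x|).

(* modulus of a complex number, as a real number: |z| = complex.Re `|z|`
   (the norm of R[i] is real-valued, embedded in R[i]) *)
Definition cabs (z : R[i]) : R := complex.Re `|z|.

Definition Cplus : set R[i] := [set z | 0 < complex.Re z].

Definition holomorphic_on (O : set R[i]) (f : R[i] -> R[i]) : Prop :=
  forall z, O z -> derivable (f : R[i]^o -> R[i]^o) z 1.

Definition sup_deriv (f : R[i] -> R[i]) (a : R) : \bar R :=
  ereal_sup [set ((cabs (derive1 (f : R[i]^o -> R[i]^o) (a +i* b)%C))%:E) | b in [set: R]].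

Definition B0_integral (f : R[i] -> R[i]) : \bar R :=
  (\int[lebesgue_measure]_(a in `]0%R, +oo[) sup_deriv f a)%E.

Definition Balg : set (R[i] -> R[i]) :=
  [set f | holomorphic_on Cplus f /\
           (exists M : R, forall z, Cplus z -> cabs (f z) <= M) /\
           (B0_integral f < +oo)%E].

Definition normB (f : R[i] -> R[i]) : R :=
  sup [set cabs (f z) | z in Cplus] + fine (B0_integral f).

Definition rz (z : R[i]) : R[i] -> R[i] := fun l => (z + l)^-1.

Definition B_calculus (D : set X) (A : X -> X) : Prop :=
  linear_operator D A /\ densely_defined D /\
  (forall l, spectrum D A l -> 0 <= complex.Re l) /\
  exists Phi : (R[i] -> R[i]) -> X -> X,
    bounded_alg_hom Balg normB Phi /\
    forall z, Cplus z -> inv_plus D A z (Phi (rz z)).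

(* ---------- C_0(iR): f(i beta) is represented by g beta, g : R -> C ---------- *)
(* R[i]^o carries the norm topology of C (norm = complex modulus) *)
Definition C0iR : set (R -> R[i]) :=
  [set g : R -> R[i] | continuous (g : R -> R[i]^o) /\
     ((g : R -> R[i]^o) x @[x --> +oo] --> (0 : R[i]^o)) /\
     ((g : R -> R[i]^o) x @[x --> -oo] --> (0 : R[i]^o))].

Definition normsup (g : R -> R[i]) : R := sup [set cabs (g t) | t in [set: R]].

Definition rz_iR (z : R[i]) : R -> R[i] := fun b => (z + (0 +i* b)%C)^-1.

Definition C0iR_calculus (D : set X) (A : X -> X) : Prop :=
  linear_operator D A /\ closed_operator D A /\ densely_defined D /\
  (forall l, spectrum D A l -> complex.Re l = 0) /\
  exists H : (R -> R[i]) -> X -> X,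
    bounded_alg_hom C0iR normsup H /\
    forall z, complex.Re z != 0 -> inv_plus D A z (H (rz_iR z)).

End Defs.

(* Main.v *)
Require Import Defs.
From HB Require Import structures.
From mathcomp Require Import all_boot all_order all_algebra.
From mathcomp Require Import all_classical all_reals all_analysis.
From mathcomp Require Import complex.
From mathcomp Require Import measurable_realfun ring lra.
Import Order.TTheory GRing.Theory Num.Theory.
Import numFieldNormedType.Exports.
Local Open Scope classical_set_scope.
Local Open Scope ring_scope.

(** From the B-calculus to the C0(iR)-calculus: a step-by-step comparison on the
    range of [(1 + A)^-4] identifies [Phi (e^{-t z})] with [T t] for [t >= 0].
    If [F] lies in the algebra generated by the exponentials [e^{-t z}] ([t] real)
    and [r_1], then [e^{-L z} F] is in B for large [L], with a B-norm that, as [L]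
    grows, becomes at most a constant times the sup norm of [F] on the imaginary
    axis: the factor [e^{-L z}] confines all of the mass to [Re z ~ 1 / L].
    As [T (-L)] is bounded uniformly in [L], the operator [F(A)] is bounded by the
    sup norm of [F] on [iR].  Functions [P r_1], with [P] a trigonometric
    polynomial, are dense in [C0(iR)], so the calculus extends by continuity.

    Conversely, [f] in B is uniformly Cauchy on the lines [Re z = 1 / n], because
    an increment along a horizontal segment is at most the integral of [|f'|] over
    it.  Hence [H] applied to these restrictions, damped by [n r_n], converges
    strongly, and the limit is a B-calculus. *)

(** * Real-valued norms and limits *)

(** Holomorphy means pointwise complex differentiability here, and the integrand of the B0-integral
    is a supremum over a vertical line whose measurability is not established. So the symbols fed to
    [Phi] lie in a class with [|f'| <= c / (1 + Re z)^2], whose integral is explicit; and,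
    conversely, increments of [f] are bounded by the integral of [|f'|] through open covers of level
    sets. The exponent 4 in [(1 + A)^-4] comes from [e^{-h z} - 1 + h z = O(h^2 |z|^2)]: two powers
    of [r_1] absorb [|z|^2], two more give the decay [(1 + Re z)^-2] of the derivative, so a step of
    length [h] costs [O(h^2)] in B-norm. [Phi] is not assumed unital, so [Phi (e^0)] is first seen
    to act as the identity on the range of the resolvent. Density uses a finite kernel sum instead
    of a convolution: over enough equispaced nodes the translates of the kernel add up to an exact
    constant, so the approximants are convex combinations of values and keep the sup bound on the
    whole line. *)

Section RealNorm.
Context {R : realType} {V : normedModType R[i]}.
Implicit Types (x y : V) (c : R[i]).

(** The norm of [V] takes values in [R[i]]; estimates are carried out on its real part, where the
    order is total. *)
Definition rn x : R := complex.Re `|x|.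

Lemma rnE x : `|x| = ((rn x)%:C)%C.
Proof.
rewrite /rn; have /complex_realP[k ->] // : `|x| \is Num.real.
exact: normr_real.
Qed.

Lemma rn_ge0 x : 0 <= rn x.
Proof. by have := normr_ge0 x; rewrite rnE lecE /= => /andP[]. Qed.

Lemma rn0 : rn 0 = 0 :> R.
Proof. by rewrite /rn normr0. Qed.

Lemma rnD x y : rn (x + y) <= rn x + rn y.
Proof. by have := ler_normD x y; rewrite !rnE -rmorphD lecR. Qed.

Lemma rnN x : rn (- x) = rn x.
Proof. by rewrite /rn normrN. Qed.

Lemma rnB x y : rn (x - y) = rn (y - x).
Proof. by rewrite -rnN opprB. Qed.

Lemma rn_sub_trans y x z : rn (x - z) <= rn (x - y) + rn (y - z).
Proof. by rewrite (le_trans _ (rnD _ _))// addrA subrK. Qed.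

Lemma rnZ c x : rn (c *: x) = cabs c * rn x.
Proof.
have -> : cabs c = @complex.Re R `|c| by [].
have -> : rn (c *: x) = complex.Re (`|c| * `|x|) by rewrite /rn normrZ.
by rewrite (rnE x); case: (`|c|) => a b /=; rewrite mulr0 subr0.
Qed.

Lemma rn_eq0 x : rn x = 0 -> x = 0.
Proof. by move=> h; apply: normr0_eq0; rewrite rnE h. Qed.

Lemma rn_le0 x : (forall e : R, 0 < e -> rn x <= e) -> x = 0.
Proof.
move=> h; apply: rn_eq0; apply/eqP; rewrite eq_le rn_ge0 andbT.
by apply/ler_addgt0Pr => e e0; rewrite add0r h.
Qed.

Lemma rn_lin (M : R) (x y : V) :
  (`|x| <= (M%:C)%C * `|y|) = (rn x <= M * rn y).
Proof. by rewrite !rnE -rmorphM /= lecR. Qed.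

End RealNorm.

Section Modulus.
Context {R : realType}.
Implicit Types z w : R[i].

Lemma cabsE z : `|z| = ((cabs z)%:C)%C.
Proof. exact: (@rnE R R[i]^o z). Qed.

Lemma cabs_ge0 z : 0 <= cabs z.
Proof. exact: (@rn_ge0 R R[i]^o z). Qed.

Lemma cabsD z w : cabs (z + w) <= cabs z + cabs w.
Proof. exact: (@rnD R R[i]^o). Qed.

Lemma cabsN z : cabs (- z) = cabs z.
Proof. exact: (@rnN R R[i]^o). Qed.

Lemma cabsB z w : cabs (z - w) = cabs (w - z).
Proof. exact: (@rnB R R[i]^o). Qed.

Lemma cabsM z w : cabs (z * w) = cabs z * cabs w.
Proof. exact: (@rnZ R R[i]^o). Qed.

Lemma cabs0 : cabs 0 = 0 :> R.
Proof. exact: (@rn0 R R[i]^o). Qed.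

Lemma cabs1 : cabs 1 = 1 :> R.
Proof. by rewrite /cabs normr1. Qed.

Lemma cabs_eq0 z : (cabs z == 0) = (z == 0).
Proof.
apply/eqP/eqP => [h|->]; last exact: cabs0.
by apply: normr0_eq0; rewrite cabsE h.
Qed.

Lemma cabs_gt0 z : (0 < cabs z) = (z != 0).
Proof. by rewrite lt_neqAle cabs_ge0 andbT eq_sym cabs_eq0. Qed.

Lemma cabsV z : cabs z^-1 = (cabs z)^-1.
Proof. by rewrite /cabs normfV cabsE -fmorphV. Qed.

Lemma cabsX z n : cabs (z ^+ n) = cabs z ^+ n.
Proof. by elim: n => [|n IH]; rewrite ?expr0 ?cabs1// !exprS cabsM IH. Qed.

Lemma cabs_real (r : R) : cabs (r%:C)%C = `|r|.
Proof. by rewrite /cabs normc_def /= expr0n /= addr0 sqrtr_sqr. Qed.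

Lemma cabs_sqr z : cabs z ^+ 2 = complex.Re z ^+ 2 + complex.Im z ^+ 2.
Proof.
case: z => a b; rewrite /cabs normc_def /= sqr_sqrtr//.
by rewrite addr_ge0 // sqr_ge0.
Qed.

Lemma Re_le_cabs z : `|complex.Re z| <= cabs z.
Proof.
rewrite -(ler_pXn2r (ltn0Sn 1)) ?nnegrE ?cabs_ge0//.
by rewrite cabs_sqr real_normK ?num_real// lerDl sqr_ge0.
Qed.

Lemma Im_le_cabs z : `|complex.Im z| <= cabs z.
Proof.
rewrite -(ler_pXn2r (ltn0Sn 1)) ?nnegrE ?cabs_ge0//.
by rewrite cabs_sqr real_normK ?num_real// lerDr sqr_ge0.
Qed.

Lemma cabs_le_ReIm z : cabs z <= `|complex.Re z| + `|complex.Im z|.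
Proof.
rewrite -(ler_pXn2r (ltn0Sn 1)) ?nnegrE ?cabs_ge0 ?addr_ge0//.
rewrite cabs_sqr sqrrD !real_normK ?num_real// -addrA [X in _ <= _ + X]addrC.
by rewrite addrA lerDl mulrn_wge0 // mulr_ge0.
Qed.

Lemma cabs_i (b : R) : cabs (0 +i* b)%C = `|b|.
Proof. by rewrite /cabs normc_def /= expr0n /= add0r sqrtr_sqr. Qed.

Lemma cabs_sub_ge z w : cabs z - cabs w <= cabs (z - w).
Proof. by rewrite lerBlDr (le_trans _ (cabsD _ _))// subrK. Qed.

End Modulus.

Section Limits.
Context {R : realType} {X : completeNormedModType R[i]}.
Implicit Types (u v : nat -> X) (l : X).

Definition tends u l : Prop :=
  forall e : R, 0 < e -> exists N, forall n, (N <= n)%N -> rn (u n - l) <= e.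

Lemma tends_unique u l l' : tends u l -> tends u l' -> l = l'.
Proof.
move=> h h'; apply/eqP; rewrite -subr_eq0; apply/eqP; apply: rn_le0 => e e0.
have e2 : 0 < e / 2 by rewrite divr_gt0.
have [N hN] := h _ e2; have [N' hN'] := h' _ e2.
apply: le_trans (rn_sub_trans (u (maxn N N')) _ _) _.
rewrite [X in _ <= X]splitr lerD//; last by rewrite hN'// leq_maxr.
by rewrite rnB hN// leq_maxl.
Qed.

Lemma tendsD u v l l' : tends u l -> tends v l' ->
  tends (fun n => u n + v n) (l + l').
Proof.
move=> h h' e e0; have e2 : 0 < e / 2 by rewrite divr_gt0.
have [N hN] := h _ e2; have [N' hN'] := h' _ e2.
exists (maxn N N') => n; rewrite geq_max => /andP[n1 n2].
rewrite opprD addrACA (le_trans (rnD _ _))// [X in _ <= X]splitr lerD//.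
  exact: hN.
exact: hN'.
Qed.

Lemma tendsZ u l (c : R[i]) : tends u l -> tends (fun n => c *: u n) (c *: l).
Proof.
move=> h e e0; have c0 : 0 < cabs c + 1 by rewrite ltr_wpDl ?cabs_ge0.
have [N hN] := h (e / (cabs c + 1)) (divr_gt0 e0 c0).
exists N => n /hN; rewrite -scalerBr rnZ ler_pdivlMr// => hn.
apply: le_trans hn; rewrite mulrC ler_wpM2l ?rn_ge0//.
by rewrite lerDl ler01.
Qed.

Lemma tends_rn_le u l (M : R) : tends u l -> (forall n, rn (u n) <= M) ->
  rn l <= M.
Proof.
move=> h hM; apply/ler_addgt0Pr => e e0; have [N hN] := h _ e0.
have := rnD (u N) (l - u N); rewrite addrC subrK => /le_trans -> //.
by rewrite lerD// rnB hN.
Qed.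

Lemma tends_cauchy u :
  (forall e : R, 0 < e -> exists N, forall m n, (N <= m)%N -> (N <= n)%N ->
     rn (u m - u n) <= e) -> exists l, tends u l.
Proof.
move=> h; have : cvg (u @ \oo).
  apply/cauchy_cvgP; apply/cauchy_ballP => eps eps0.
  have /complex_realP[e E] : eps \is Num.real by exact: gtr0_real.
  have e0 : 0 < e by move: eps0; rewrite E ltcR.
  have [N hN] := h (e / 2) (divr_gt0 e0 (ltr0Sn _ _)).
  exists (u @` [set n | (N <= n)%N], u @` [set n | (N <= n)%N]).
    by split; exists N => // n hn; exists n.
  move=> [_ _] [/= [m hm <-] [n hn <-]]; rewrite -ball_normE /= rnE E ltcR.
  by rewrite (le_lt_trans (hN _ _ hm hn))// ltr_pdivrMr// ltr_pMr ?ltr1n.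
move=> /cvg_ex[l hl]; exists l => e e0.
have /cvgrPdist_le/(_ (e%:C)%C) := hl.
rewrite ltcR => /(_ e0)[N _ hN]; exists N => n /hN /=.
by rewrite rnE lecR rnB.
Qed.

End Limits.

(** * Bounded operators and generators *)

Section BoundedOperators.
Context {R : realType} {X : completeNormedModType R[i]}.
Implicit Types (S : X -> X) (D : set X) (A : X -> X) (x y : X).

Lemma blinD S (h : bounded_linear S) x y : S (x + y) = S x + S y.
Proof. by have [H _] := h; exact: H. Qed.

Lemma blinZ S (h : bounded_linear S) (c : R[i]) x : S (c *: x) = c *: S x.
Proof. by have [_ [H _]] := h; exact: H. Qed.

Lemma blinN S (h : bounded_linear S) x : S (- x) = - S x.
Proof. by rewrite -scaleN1r (blinZ _ h) scaleN1r. Qed.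

Lemma blinB S (h : bounded_linear S) x y : S (x - y) = S x - S y.
Proof. by rewrite (blinD _ h) (blinN _ h). Qed.

Lemma blin_bound S : bounded_linear S ->
  exists2 M : R, 0 <= M & forall x, rn (S x) <= M * rn x.
Proof.
move=> [_ [_ [M hM]]]; exists `|M| => // x.
have := hM x; rewrite rn_lin => /le_trans; apply.
by rewrite ler_wpM2r ?rn_ge0// ler_norm.
Qed.

Lemma blin_intro S (M : R) : (forall x y, S (x + y) = S x + S y) ->
  (forall (c : R[i]) x, S (c *: x) = c *: S x) ->
  (forall x, rn (S x) <= M * rn x) -> bounded_linear S.
Proof. by move=> h1 h2 h3; split=> //; split=> //; exists M => x; rewrite rn_lin. Qed.

Lemma blin_comp S S' : bounded_linear S -> bounded_linear S' ->
  bounded_linear (fun x => S (S' x)).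
Proof.
move=> h h'; have [M M0 hM] := blin_bound _ h; have [M' M0' hM'] := blin_bound _ h'.
apply: (@blin_intro _ (M * M')) => [x y|c x|x]; first by rewrite (blinD _ h') (blinD _ h).
  by rewrite (blinZ _ h') (blinZ _ h).
by rewrite (le_trans (hM _))// -mulrA ler_wpM2l.
Qed.

Lemma blin_add S S' : bounded_linear S -> bounded_linear S' ->
  bounded_linear (fun x => S x + S' x).
Proof.
move=> h h'; have [M M0 hM] := blin_bound _ h; have [M' M0' hM'] := blin_bound _ h'.
apply: (@blin_intro _ (M + M')) => [x y|c x|x]; first by rewrite (blinD _ h') (blinD _ h) addrACA.
  by rewrite (blinZ _ h') (blinZ _ h) scalerDr.
by rewrite (le_trans (rnD _ _))// mulrDl lerD.
Qed.

Lemma blin_scale S (c : R[i]) : bounded_linear S ->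
  bounded_linear (fun x => c *: S x).
Proof.
move=> h; have [M M0 hM] := blin_bound _ h.
apply: (@blin_intro _ (cabs c * M)) => [x y|d x|x]; first by rewrite (blinD _ h) scalerDr.
  by rewrite (blinZ _ h) !scalerA mulrC.
by rewrite rnZ -mulrA ler_wpM2l ?cabs_ge0.
Qed.

Lemma denseP D : densely_defined D <->
  forall x (e : R), 0 < e -> exists2 y, D y & rn (x - y) <= e.
Proof.
split=> [h x e e0|h].
  have hx : closure D x by rewrite h.
  have eC : (0 < (e%:C)%C :> R[i]) by rewrite ltcR.
  have [y [Dy]] := hx _ (nbhsx_ballx x _ eC).
  by rewrite -ball_normE /= rnE ltcR => /ltW hy; exists y.
apply/seteqP; split=> // x _ B /nbhs_ballP[eps /= eps0 hB].
have /complex_realP[e E] : eps \is Num.real by exact: gtr0_real.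
have e0 : 0 < e by move: eps0; rewrite E ltcR.
have [y Dy hy] := h x (e / 2) (divr_gt0 e0 (ltr0Sn _ _)).
exists y; split=> //; apply: hB; rewrite -ball_normE /= rnE E ltcR.
by rewrite (le_lt_trans hy)// ltr_pdivrMr// ltr_pMr ?ltr1n.
Qed.

Lemma blin_ext_dense D S S' : densely_defined D -> bounded_linear S ->
  bounded_linear S' -> (forall x, D x -> S x = S' x) -> forall x, S x = S' x.
Proof.
move=> /denseP hD h h' hS x; apply/eqP; rewrite -subr_eq0; apply/eqP.
have [M M0 hM] := blin_bound _ h; have [M' M0' hM'] := blin_bound _ h'.
apply: rn_le0 => e e0; have M1 : 0 < M + M' + 1 by rewrite ltr_wpDl// addr_ge0.
have [y Dy] := hD x (e / (M + M' + 1)) (divr_gt0 e0 M1).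
rewrite ler_pdivlMr// => hy.
have -> : S x - S' x = S (x - y) - S' (x - y).
  by rewrite (blinB _ h) (blinB _ h') (hS y)// opprB addrA subrK.
rewrite (le_trans (rnD _ _))// rnN (le_trans (lerD (hM _) (hM' _)))//.
by rewrite -mulrDl (le_trans _ hy)// mulrC ler_wpM2l ?rn_ge0// lerDl.
Qed.

Lemma blin_continuous S : bounded_linear S -> continuous S.
Proof.
move=> h x; have [M M0 hM] := blin_bound _ h.
apply/cvgrPdist_le => eps eps0.
have /complex_realP[e E] : eps \is Num.real by exact: gtr0_real.
have e0 : 0 < e by move: eps0; rewrite E ltcR.
have M1 : 0 < M + 1 by rewrite ltr_wpDl.
have d0 : (0 < ((e / (M + 1))%:C)%C :> R[i]) by rewrite ltcR divr_gt0.
near=> y; rewrite -(blinB _ h) rnE E lecR (le_trans (hM _))//.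
have : rn (x - y) <= e / (M + 1).
  near: y; apply: filterS (nbhsx_ballx x _ d0) => y.
  by rewrite -ball_normE /= rnE ltcR => /ltW.
rewrite ler_pdivlMr// => hn.
by rewrite (le_trans _ hn)// mulrC ler_wpM2l ?rn_ge0// lerDl.
Unshelve. all: by end_near. Qed.

(** The graph is the zero set of the continuous map [(x, y) -> x - S (z *: x + y)]. *)
Lemma inv_plus_closed D A (z : R[i]) S :
  inv_plus D A z S -> closed_operator D A.
Proof.
move=> [hS [h1 h2]]; rewrite /closed_operator.
have -> : [set p : X * X | D p.1 /\ p.2 = A p.1] =
    (fun p => p.1 - S (z *: p.1 + p.2)) @^-1` [set 0].
  apply/seteqP; split=> -[x y] /=.
    by move=> [Dx ->]; rewrite h2// subrr.
  move=> /eqP; rewrite subr_eq0 => /eqP E.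
  have [hd he] := h1 (z *: x + y); rewrite -E in hd he; split=> //.
  by apply: (addrI (z *: x)).
apply: closed_comp => [p _|]; last first.
  have := @accessible_closed_set1 X; apply.
  apply: hausdorff_accessible; exact: norm_hausdorff.
apply: continuousB; first exact: cvg_fst.
apply: (@continuous_comp _ _ _ (fun p : X * X => z *: p.1 + p.2) S).
  apply: continuousD; last exact: cvg_snd.
  by apply: cvgZ; [exact: cvg_cst|exact: cvg_fst].
exact: blin_continuous.
Qed.

End BoundedOperators.

(** * Generators, in epsilon form, and what commutes with the group *)

Section Generator.
Context {R : realType} {X : completeNormedModType R[i]}.
Variables (T : R -> X -> X) (D : set X) (A : X -> X).
Hypothesis HT : C0_group T.
Hypothesis HG : generator T D (fun x => - A x).

Lemma diff_quot_cvgP x l : (diff_quot T x @ 0^' --> l) <->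
  (forall e : R, 0 < e -> exists2 d : R, 0 < d &
    forall h : R, h != 0 -> `|h| < d -> rn (T h x - x - (h%:C)%C *: l) <= e * `|h|).
Proof.
have key h : h != 0 -> rn (T h x - x - (h%:C)%C *: l) = `|h| * rn (l - diff_quot T x h).
  move=> h0; rewrite -cabs_real -rnZ rnB /diff_quot scalerBr scalerA -rmorphM /=.
  by rewrite divff// scale1r.
split=> [/cvgrPdist_le hl e e0|hl].
  have eC : (0 < (e%:C)%C :> R[i]) by rewrite ltcR.
  have := hl _ eC => /nbhs_ballP[d /= d0 hd].
  exists d => // h h0 hh; rewrite key// mulrC ler_wpM2r//.
  have := hd h; rewrite /= -ball_normE /= sub0r normrN => /(_ hh h0).
  by rewrite rnE lecR.
apply/cvgrPdist_le => eps eps0.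
have /complex_realP[e E] : eps \is Num.real by exact: gtr0_real.
have e0 : 0 < e by move: eps0; rewrite E ltcR.
have [d d0 hd] := hl e e0.
apply/nbhs_ballP; exists d => // h; rewrite -ball_normE /= sub0r normrN => hh h0.
have := hd _ h0 hh; rewrite key// mulrC ler_pM2r ?normr_gt0// => ?.
by rewrite E rnE lecR.
Qed.

Lemma generatorP x l : (D x /\ - A x = l) <->
  (forall e : R, 0 < e -> exists2 d : R, 0 < d &
    forall h : R, h != 0 -> `|h| < d -> rn (T h x - x - (h%:C)%C *: l) <= e * `|h|).
Proof.
rewrite -diff_quot_cvgP; have [h1 h2] := HG; split=> [[Dx <-]|hl].
  by rewrite h2//; exact/h1.
have Dx : D x by apply/h1; apply/cvg_ex; exists l.
split=> //; rewrite h2//; apply: cvg_lim => //; exact: norm_hausdorff.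
Qed.

(** [T s] is bounded and commutes with [T h], so it carries the first-order defect of [x] to that of
    [T s x]. *)
Lemma group_domain s x : D x -> D (T s x) /\ A (T s x) = T s (A x).
Proof.
move=> Dx; have [hb [h0 [hadd _]]] := HT.
have [M M0 hM] := blin_bound _ (hb s).
have : D (T s x) /\ - A (T s x) = - T s (A x).
  apply/generatorP => e e0; have M1 : 0 < M + 1 by rewrite ltr_wpDl.
  have [/(_ (conj Dx erefl)) hx _] := generatorP x (- A x).
  have [d d0 hd] := hx _ (divr_gt0 e0 M1); exists d => // h hn hh.
  have -> : T h (T s x) - T s x - (h%:C)%C *: - T s (A x) =
      T s (T h x - x - (h%:C)%C *: - A x).
    rewrite !(blinB _ (hb s)) (blinZ _ (hb s)) (blinN _ (hb s)).
    by rewrite -!hadd [h + s]addrC.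
  rewrite (le_trans (hM _))//.
  have := hd _ hn hh; rewrite mulrAC ler_pdivlMr// => hle.
  by rewrite (le_trans _ hle)// mulrC ler_wpM2l ?rn_ge0// lerDl.
by move=> [? /oppr_inj].
Qed.

(** From [x = (z + A) (S x)] follows [T s x = (z + A) (T s (S x))], and [S] undoes [z + A] on
    [D]. *)
Lemma group_resolvent_comm z S s x : inv_plus D A z S ->
  T s (S x) = S (T s x).
Proof.
move=> [hS [h1 h2]]; have [hb _] := HT.
have [Dx E] := h1 x; have [Ds Es] := group_domain s _ Dx.
by rewrite -(h2 _ Ds) Es -(blinZ _ (hb s)) -(blinD _ (hb s)) E.
Qed.

End Generator.

(** * Complex derivatives and the exponential *)

Section ComplexDerivative.
Context {R : realType}.
Implicit Types (f g : R[i] -> R[i]) (z w d : R[i]).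

Definition cder f z d : Prop :=
  is_derive (z : R[i]^o) (1 : R[i]^o) (f : R[i]^o -> R[i]^o) d.

Lemma quot_cvgP f z d :
  ((fun h : R[i]^o => h^-1 *: ((f (h + z) : R[i]^o) - f z)) @ 0^' --> (d : R[i]^o)) <->
  (forall e : R, 0 < e -> exists2 del : R, 0 < del &
    forall h : R[i], h != 0 -> cabs h < del ->
      cabs (f (h + z) - f z - h * d) <= e * cabs h).
Proof.
have key (h : R[i]) : h != 0 -> cabs (f (h + z) - f z - h * d) =
    cabs h * cabs (d - h^-1 * (f (h + z) - f z)).
  by move=> h0; rewrite -cabsM cabsB mulrBr mulVKf.
split=> [/cvgrPdist_le hl e e0|hl].
  have eC : (0 < (e%:C)%C :> R[i]) by rewrite ltcR.
  have := hl _ eC => /nbhs_ballP[d' /= d0 hd].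
  have /complex_realP[del E] : d' \is Num.real by exact: gtr0_real.
  have del0 : 0 < del by move: d0; rewrite E ltcR.
  exists del => // h h0 hh; rewrite key// mulrC ler_wpM2r ?cabs_ge0//.
  have := hd h; rewrite /= -ball_normE /= sub0r normrN cabsE E ltcR => /(_ hh h0).
  by rewrite cabsE lecR.
apply/cvgrPdist_le => eps eps0.
have /complex_realP[e E] : eps \is Num.real by exact: gtr0_real.
have e0 : 0 < e by move: eps0; rewrite E ltcR.
have [del d0 hd] := hl e e0.
apply/nbhs_ballP; exists (del%:C)%C; first by rewrite /= ltcR.
move=> h; rewrite -ball_normE /= sub0r normrN cabsE ltcR => hh h0.
have := hd _ h0 hh; rewrite key// mulrC ler_pM2r ?cabs_gt0// => ?.
by rewrite E cabsE lecR.
Qed.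

Lemma quotE f z : (fun h : R[i]^o => h^-1 *: (((f : R[i]^o -> R[i]^o) \o shift (z : R[i]^o)) (h *: (1 : R[i]^o)) - f z)) =
  (fun h : R[i]^o => h^-1 *: ((f (h + z) : R[i]^o) - f z)).
Proof. by apply: funext => h /=; rewrite [h%:A]mulr1. Qed.

Lemma cderP f z d : cder f z d <->
  (forall e : R, 0 < e -> exists2 del : R, 0 < del &
    forall h : R[i], h != 0 -> cabs h < del ->
      cabs (f (h + z) - f z - h * d) <= e * cabs h).
Proof.
rewrite -quot_cvgP; split=> [[]|hl].
  rewrite /derivable quotE => hc; rewrite /derive quotE => <-; exact: hc.
split; first by rewrite /derivable quotE; apply/cvg_ex; exists d.
rewrite /derive quotE; apply: cvg_lim => //; exact: norm_hausdorff.
Qed.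

Lemma cder_derive1 f z d : cder f z d -> derive1 (f : R[i]^o -> R[i]^o) z = d.
Proof. by move=> [_ <-]; rewrite derive1E. Qed.

Lemma cder_derivable f z d : cder f z d -> derivable (f : R[i]^o -> R[i]^o) z 1.
Proof. by case. Qed.

Lemma derivable_cder f z : derivable (f : R[i]^o -> R[i]^o) z 1 ->
  cder f z (derive1 (f : R[i]^o -> R[i]^o) z).
Proof. by move=> h; apply: (DeriveDef h); exact/esym/derive1E. Qed.

Lemma cder_quad f z d (C del : R) : 0 < del ->
  (forall h, cabs h < del -> cabs (f (h + z) - f z - h * d) <= C * cabs h ^+ 2) ->
  cder f z d.
Proof.
move=> del0 H; apply/cderP => e e0.
have C1 : 0 < `|C| + 1 by rewrite ltr_wpDl.
exists (Num.min del (e / (`|C| + 1))); first by rewrite lt_min del0 divr_gt0.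
move=> h h0; rewrite lt_min => /andP[/H hle]; rewrite ltr_pdivlMr// => he.
rewrite (le_trans hle)// expr2 mulrA ler_wpM2r ?cabs_ge0//.
rewrite (le_trans _ (ltW he))// mulrC ler_wpM2l ?cabs_ge0//.
by rewrite (le_trans (ler_norm C))// lerDl.
Qed.

Lemma cder_eq f z d d' : cder f z d -> d = d' -> cder f z d'.
Proof. by move=> ? <-. Qed.

Lemma cderD f g z d d' : cder f z d -> cder g z d' ->
  cder (fun u => f u + g u) z (d + d').
Proof. by move=> h h'; exact: is_deriveD. Qed.

Lemma cderM f g z d d' : cder f z d -> cder g z d' ->
  cder (fun u => f u * g u) z (d * g z + f z * d').
Proof.
move=> h h'; have := @is_deriveM _ _ _ _ _ _ _ _ h h'.
by move/cder_eq; apply; rewrite addrC; congr (_ + _); exact: mulrC.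
Qed.

Lemma cder_cst c z : cder (fun=> c) z 0.
Proof. exact: is_derive_cst. Qed.

Lemma cder_id z : cder id z 1.
Proof. exact: is_derive_id. Qed.

Lemma cderZ f z d c : cder f z d -> cder (fun u => c * f u) z (c * d).
Proof.
move=> h; have := cderM _ _ _ _ _ (cder_cst c z) h.
by move/cder_eq; apply; rewrite mul0r add0r.
Qed.

Lemma cderV f z d : f z != 0 -> cder f z d -> cder (fun u => (f u)^-1) z (- d / f z ^+ 2).
Proof.
move=> f0 [h1 h2]; split; first exact: (@derivableV R[i] R[i]^o f).
rewrite (@deriveV R[i] R[i]^o f)// h2.
by rewrite [_ *: _]mulrC mulrN mulNr.
Qed.

End ComplexDerivative.

(** * The complex exponential and its Taylor estimates *)

Section ComplexExponential.
Context {R : realType}.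
Implicit Types (a b t : R) (z w : R[i]).

Lemma sin_norm_le b : `|sin b| <= `|b|.
Proof.
wlog b0 : b / 0 <= b.
  move=> H; have [/H//|b0] := leP 0 b.
  by have := H (- b); rewrite sinN !normrN; apply; rewrite oppr_ge0 ltW.
have [x _] := @MVT_segment R sin cos 0 b b0 (fun x _ => is_derive_sin x)
  (@continuous_subspaceT _ _ _ _ (@continuous_sin R)).
rewrite sin0 !subr0 => ->.
by rewrite normrM ler_piMl// cos_max.
Qed.

Lemma cos_sub1 b : 1 - cos b = sin (b / 2) ^+ 2 *+ 2.
Proof.
have -> : cos b = cos (b / 2 *+ 2) by congr cos; rewrite -mulr_natr mulfVK.
rewrite cos_mulr2n cos2sin2 mulrnBl; ring.
Qed.

Lemma cos_sub1_le b : `|cos b - 1| <= b ^+ 2.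
Proof.
rewrite distrC cos_sub1 ger0_norm ?mulrn_wge0 ?sqr_ge0//.
have := sin_norm_le (b / 2).
rewrite -(ler_pXn2r (ltn0Sn 1)) ?nnegrE// !real_normK ?num_real// expr_div_n.
by have := sqr_ge0 b; lra.
Qed.

Lemma cos_sub1_le1 b : `|cos b - 1| <= `|b|.
Proof.
rewrite distrC cos_sub1 ger0_norm ?mulrn_wge0 ?sqr_ge0//.
have := sin_norm_le (b / 2); rewrite normrM (ger0_norm (_ : 0 <= 2^-1))//.
have := sin_max (b / 2); rewrite -(real_normK (num_real (sin _))) expr2.
have := normr_ge0 (sin (b / 2)); set s := `|sin _|; nra.
Qed.

Lemma sin_sub_le b : `|sin b - b| <= b ^+ 2.
Proof.
wlog b0 : b / 0 <= b.
  move=> H; have [/H//|b0] := leP 0 b.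
  have := H (- b); rewrite oppr_ge0 (ltW b0) => /(_ isT).
  by rewrite sinN -opprD normrN sqrrN.
have D (x : R) : x \in `]0, b[ -> is_derive x 1 (fun y : R => sin y - y) (cos x - 1).
  by move=> _; apply: is_deriveB.
have [|x] := @MVT_segment R (fun y => sin y - y) (fun y => cos y - 1) 0 b b0 D.
  apply: continuous_subspaceT => x; apply: cvgB; first exact: continuous_sin.
  exact: cvg_id.
rewrite in_itv /= => /andP[x0 xb].
rewrite sin0 !subr0 => ->; rewrite normrM (ger0_norm b0) expr2 ler_wpM2r//.
by rewrite (le_trans (cos_sub1_le1 _))// ger0_norm.
Qed.

Lemma expR_sub1_le a : a <= 0 -> `|expR a - 1| <= `|a|.
Proof.
move=> a0; rewrite ler0_norm; last by rewrite subr_le0 expR_le1.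
by rewrite (ler0_norm a0); have := expR_ge1Dx a; lra.
Qed.

Lemma expR_sub1_le2 a : a <= 0 -> `|expR a - 1 - a| <= a ^+ 2.
Proof.
move=> a0; have h1 := expR_ge1Dx a; have h2 := expR_ge1Dx (- a).
rewrite ger0_norm; last by lra.
have h3 := expRxMexpNx_1 a; have e0 := expR_gt0 a.
have : expR a * (1 - a) <= expR a * expR (- a) by rewrite ler_wpM2l// ltW.
rewrite h3.
nra.
Qed.

Definition cexp z : R[i] :=
  (expR (complex.Re z) * cos (complex.Im z) +i*
   (expR (complex.Re z) * sin (complex.Im z)))%C.

Lemma cexpD z w : cexp (z + w) = cexp z * cexp w.
Proof.
case: z w => a b [c d]; rewrite /cexp /= expRD cosD sinD.
by simpc; congr (_ +i* _)%C; ring.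
Qed.

Lemma cexp0 : cexp 0 = 1.
Proof. by rewrite /cexp /= expR0 cos0 sin0 mul1r mulr0. Qed.

Lemma cabs_cexp z : cabs (cexp z) = expR (complex.Re z).
Proof.
rewrite /cexp /cabs normc_def /= !exprMn -mulrDr cos2Dsin2 mulr1.
by rewrite sqrtr_sqr ger0_norm// expR_ge0.
Qed.

Lemma cexp_sub1_neg z : complex.Re z <= 0 -> cabs (cexp z - 1) <= 3 * cabs z.
Proof.
case: z => a b /= a0.
apply: le_trans (cabs_le_ReIm _) _; rewrite /cexp; simpc => /=.
have ha := Re_le_cabs (a +i* b)%C; have hb := Im_le_cabs (a +i* b)%C.
rewrite /= in ha hb; set r := cabs _ in ha hb *.
have e1 : expR a <= 1 by rewrite expR_le1.
have e0 := expR_ge0 a.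
have h1 : `|expR a * cos b - 1| <= `|b| + `|a|.
  have -> : expR a * cos b - 1 = expR a * (cos b - 1) + (expR a - 1) by ring.
  rewrite (le_trans (ler_normD _ _))// lerD ?expR_sub1_le//.
  by rewrite normrM ger0_norm// (le_trans (ler_piMl _ e1))// cos_sub1_le1.
have h2 : `|expR a * sin b| <= `|b|.
  by rewrite normrM ger0_norm// (le_trans (ler_piMl _ e1))// sin_norm_le.
lra.
Qed.

(** There is no restriction on [|z|]: the bound is applied to [- h z] with [z] unbounded in the
    right half-plane, where the exponential has modulus at most 1. *)
Lemma cexp_sub1_neg2 z : complex.Re z <= 0 ->
  cabs (cexp z - 1 - z) <= 4 * cabs z ^+ 2.
Proof.
case: z => a b /= a0.
apply: le_trans (cabs_le_ReIm _) _; rewrite /cexp; simpc => /=.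
rewrite cabs_sqr /=.
have e1 : expR a <= 1 by rewrite expR_le1.
have e0 := expR_ge0 a.
have h1 : `|expR a * cos b - 1 - a| <= b ^+ 2 + a ^+ 2.
  have -> : expR a * cos b - 1 - a = expR a * (cos b - 1) + (expR a - 1 - a) by ring.
  rewrite (le_trans (ler_normD _ _))// lerD ?expR_sub1_le2//.
  by rewrite normrM ger0_norm// (le_trans (ler_piMl _ e1))// cos_sub1_le.
have h2 : `|expR a * sin b - b| <= `|a| * `|b| + b ^+ 2.
  have -> : expR a * sin b - b = (expR a - 1) * sin b + (sin b - b) by ring.
  rewrite (le_trans (ler_normD _ _))// lerD ?sin_sub_le//.
  by rewrite normrM ler_pM ?expR_sub1_le ?sin_norm_le.
have h3 : `|a| * `|b| <= a ^+ 2 + b ^+ 2.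
  rewrite -(real_normK (num_real a)) -(real_normK (num_real b)).
  have := normr_ge0 a; have := normr_ge0 b; move: `|a| `|b| => p q; nra.
have := sqr_ge0 a; have := sqr_ge0 b; lra.
Qed.

(** For [Re z > 0] the estimate is reflected from [- z]: the remainder is rewritten through
    [e^{-z} - 1] and [e^{-z} - 1 + z], whose constants add up to [3 + 4 = 7], and [expR 1] bounds
    [|e^z|]. *)
Lemma cexp_sub1_loc z : cabs z <= 1 ->
  cabs (cexp z - 1 - z) <= 7 * expR 1 * cabs z ^+ 2.
Proof.
move=> z1; have e1 : 1 <= expR 1 :> R by rewrite (le_trans _ (expR_ge1Dx 1))// lerDl.
have [h|h] := leP (complex.Re z) 0.
  rewrite (le_trans (cexp_sub1_neg2 _ h))// ler_wpM2r ?sqr_ge0//; lra.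
have hN : complex.Re (- z) <= 0 by case: (z) h => a b /=; rewrite oppr_le0 => /ltW.
have E : cexp z - 1 - z = - z * (cexp z * (cexp (- z) - 1)) -
    cexp z * (cexp (- z) - 1 - - z).
  have := cexpD z (- z); rewrite subrr cexp0 => e.
  by rewrite !mulrBr -e; ring.
have hb1 := cexp_sub1_neg _ hN; have hb2 := cexp_sub1_neg2 _ hN.
rewrite cabsN in hb1 hb2.
have ee : expR (complex.Re z) <= expR 1.
  by rewrite ler_expR (le_trans (ler_norm _))// (le_trans (Re_le_cabs _)).
rewrite E (le_trans (cabsD _ _))// cabsN !cabsM cabsN cabs_cexp.
have p0 := expR_ge0 (complex.Re z); have r0 := cabs_ge0 z.
have q0 := cabs_ge0 (cexp (- z) - 1); have s0 := cabs_ge0 (cexp (- z) - 1 - - z).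
have k1 : expR (complex.Re z) * cabs (cexp (- z) - 1) <= expR 1 * (3 * cabs z).
  by rewrite ler_pM.
have k2 : expR (complex.Re z) * cabs (cexp (- z) - 1 - - z) <= expR 1 * (4 * cabs z ^+ 2).
  by rewrite ler_pM.
apply: le_trans (lerD (ler_wpM2l r0 k1) k2) _.
by rewrite le_eqVlt; apply/orP; left; apply/eqP; ring.
Qed.

(** As the generator of [T] is [- A], this is the symbol whose value at [A] should be [T t]. *)
Definition cexpt t z : R[i] := cexp (- ((t%:C)%C * z)).

Lemma cexptD s t z : cexpt (s + t) z = cexpt s z * cexpt t z.
Proof. by rewrite /cexpt -cexpD -opprD -mulrDl rmorphD. Qed.

Lemma cexpt0 z : cexpt 0 z = 1.
Proof. by rewrite /cexpt mul0r oppr0 cexp0. Qed.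

Lemma cexpt_add t z w : cexpt t (z + w) = cexpt t z * cexpt t w.
Proof. by rewrite /cexpt -cexpD -opprD -mulrDr. Qed.

Lemma cabs_cexpt t z : cabs (cexpt t z) = expR (- (t * complex.Re z)).
Proof.
by rewrite cabs_cexp; case: z => a b; congr expR => /=; rewrite mul0r subr0.
Qed.

Lemma cder_cexpt t z : cder (cexpt t) z (- ((t%:C)%C * cexpt t z)).
Proof.
have t1 : 0 < `|t| + 1 by rewrite ltr_wpDl.
apply: (@cder_quad _ _ _ _ (cabs (cexpt t z) * (7 * expR 1 * `|t| ^+ 2)) (`|t| + 1)^-1).
  by rewrite invr_gt0.
move=> h hh; rewrite cexpt_add.
have -> : cexpt t h * cexpt t z - cexpt t z - h * - ((t%:C)%C * cexpt t z) =
   cexpt t z * (cexpt t h - 1 - - ((t%:C)%C * h)) by ring.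
rewrite cabsM -mulrA ler_wpM2l ?cabs_ge0//.
have ht : cabs (- ((t%:C)%C * h)) = `|t| * cabs h by rewrite cabsN cabsM cabs_real.
apply: (le_trans (cexp_sub1_loc _ _)).
  rewrite ht; have := ltW hh; rewrite -[_^-1]mul1r ler_pdivlMr// mulrC.
  by apply: le_trans; rewrite ler_wpM2r ?cabs_ge0// lerDl.
by rewrite ht exprMn mulrA.
Qed.

End ComplexExponential.

(** * Membership in B *)

(* The integral of a nonnegative function is a supremum over simple functions,
   hence monotone even for functions that are not known to be measurable. *)
Lemma ge0_le_integral_gen d (T : measurableType d) (R : realType)
    (mu : {measure set T -> \bar R}) (D : set T) (f g : T -> \bar R) :
  (forall x, D x -> (0 <= f x)%E) -> (forall x, D x -> (f x <= g x)%E) ->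
  (\int[mu]_(x in D) f x <= \int[mu]_(x in D) g x)%E.
Proof.
move=> f0 fg; rewrite !ge0_integralE//; last first.
  by move=> x Dx; exact: le_trans (f0 _ Dx) (fg _ Dx).
apply: le_ereal_sup => _ [h /= hf <-]; exists h => // x.
apply: (le_trans (hf x)); rewrite /patch; case: ifPn => //.
by rewrite inE; exact: fg.
Qed.

Section BNorm.
Context {R : realType}.
Implicit Types (f df : R[i] -> R[i]) (c K M : R).
Local Notation mu := (@lebesgue_measure R).

Lemma integral_invsq c K : 0 < K -> 0 <= c ->
  (\int[mu]_(a in `]0%R, +oo[) (c / (1 + K * a) ^+ 2)%:E = (c / K)%:E)%E.
Proof.
move=> K0 c0; pose F (x : R) := - (c / K) * (1 + K * x)^-1.
have pos (x : R) : 0 <= x -> 0 < 1 + K * x by move=> x0; rewrite ltr_wpDr// mulr_ge0// ltW.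
have D1 (x : R) : is_derive x 1 (fun y => 1 + K * y) K.
  have := is_deriveD (is_derive_cst (1 : R) x 1) (is_deriveZ K (is_derive_id x (1 : R))).
  by rewrite add0r [_ *: _]mulr1.
have DF (x : R) : 0 <= x -> is_derive x 1 F (c / (1 + K * x) ^+ 2).
  move=> x0; have h := lt0r_neq0 (pos _ x0).
  have dV : is_derive x 1 (fun y => (1 + K * y)^-1) (- (1 + K * x) ^- 2 *: K).
    apply: DeriveDef; first by apply: derivableV => //; case: (D1 x).
    by rewrite deriveV//; case: (D1 x) => _ ->.
  apply: is_derive_eq (is_deriveZ (- (c / K)) dV) _.
  rewrite /GRing.scale /=; field.
  by rewrite h gt_eqF.
have cnt (x : R) : 0 <= x ->
    {for x, continuous (fun a : R => c / (1 + K * a) ^+ 2)}.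
  move=> x0; have cl : (1 + K * a) @[a --> x] --> 1 + K * x.
    by apply: cvgD; [exact: cvg_cst|apply: cvgMl_tmp; exact: cvg_id].
  apply: cvgMl_tmp; apply: cvgV; first by rewrite expf_neq0// lt0r_neq0// pos.
  exact: (cvgM cl cl).
rewrite integral_itv_obnd_cbnd; last first.
  apply/measurable_EFinP; apply: open_continuous_measurable_fun => // x.
  by rewrite inE /= in_itv /= andbT => /ltW; exact: cnt.
rewrite (@ge0_continuous_FTC2y R _ F 0 0).
- by rewrite sub0e /F mulr0 addr0 invr1 mulr1 EFinN oppeK.
- by move=> x x0; rewrite divr_ge0// sqr_ge0.
- apply: continuous_in_subspaceT => x.
  by rewrite inE /= in_itv /= andbT; exact: cnt.
- rewrite -(mulr0 (- (c / K))); apply: cvgMl_tmp.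
  apply/cvgrPdist_le => e e0; near=> x.
  have x0 : 0 < x by near: x; exact: nbhs_pinfty_gt.
  have p0 := pos _ (ltW x0).
  rewrite sub0r normrN ger0_norm; last by rewrite invr_ge0 ltW.
  rewrite -[leRHS]invrK lef_pV2 ?posrE ?invr_gt0//.
  apply: ltW; rewrite ltr_wpDl// -ltr_pdivrMl//.
  by near: x; apply: nbhs_pinfty_gt; exact: num_real.
- by move=> x /ltW/DF[].
- have : {for 0, continuous F} by apply: differentiable_continuous; apply/derivable1_diffP; case: (DF 0 (lexx _)).
  by move/cvg_at_right_filter.
- move=> x; rewrite in_itv /= andbT => /ltW/DF[_ <-]; exact: derive1E.
Unshelve. all: by end_near. Qed.

(** The majorant of the derivative depends on [Re z] only, so it bounds the supremum over each
    vertical line; its integral over the half-line is [c / K]. *)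
Lemma Balg_intro f df M c K : 0 < K -> 0 <= c ->
  (forall z, Cplus z -> cder f z (df z)) ->
  (forall z, Cplus z -> cabs (f z) <= M) ->
  (forall z, Cplus z -> cabs (df z) <= c / (1 + K * complex.Re z) ^+ 2) ->
  Balg f /\ normB f <= M + c / K.
Proof.
move=> K0 c0 hd hM hc.
have I : (B0_integral f <= (c / K)%:E)%E.
  rewrite -integral_invsq//; apply: ge0_le_integral_gen => a /=.
    rewrite in_itv /= andbT => a0; apply: le_trans (ereal_sup_ubound _); last first.
      by exists 0.
    by rewrite lee_fin cabs_ge0.
  rewrite in_itv /= andbT => a0; apply: ge_ereal_sup => _ [b _ <-].
  have hz : Cplus (a +i* b)%C by [].
  by rewrite lee_fin (cder_derive1 _ _ _ (hd _ hz)) hc.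
have I0 : (0 <= B0_integral f)%E.
  apply: integral_ge0 => a _; apply: le_trans (ereal_sup_ubound _); last by exists 0.
  by rewrite lee_fin cabs_ge0.
have fI : B0_integral f \is a fin_num.
  by rewrite ge0_fin_numE// (le_lt_trans I)// ltry.
split.
  split; first by move=> z /hd/cder_derivable.
  split; first by exists M.
  by rewrite (le_lt_trans I)// ltry.
rewrite /normB lerD//; last by rewrite -lee_fin fineK.
apply: ge_sup; last by move=> _ [z hz <-]; exact: hM.
by exists (cabs (f (1 +i* 0)%C)), (1 +i* 0)%C => //=; exact: ltr01.
Qed.

Lemma normB_ge f z : Balg f -> Cplus z -> cabs (f z) <= normB f.
Proof.
move=> [_ [[M hM] hI]] hz; rewrite /normB.
have : cabs (f z) <= sup [set cabs (f z) | z in Cplus (R := R)].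
  apply: ub_le_sup; last by exists z.
  by exists M => _ [w hw <-]; exact: hM.
move/le_trans; apply; rewrite lerDl fine_ge0//.
apply: integral_ge0 => a _; apply: le_trans (ereal_sup_ubound _); last by exists 0.
by rewrite lee_fin cabs_ge0.
Qed.

End BNorm.

Section Nice.
Context {R : realType}.
Implicit Types (f g df : R[i] -> R[i]) (z : R[i]) (t : R).

(* An explicit subalgebra of B: unlike for [Balg], whose integrand is not known
   to be measurable, closure under the algebra operations is immediate. *)
Definition nice f : Prop := exists df, exists2 c : R, 0 <= c &
  forall z, Cplus z -> [/\ cder f z (df z), cabs (f z) <= c &
    cabs (df z) <= c / (1 + complex.Re z) ^+ 2].

Lemma nice_Balg f : nice f -> Balg f.
Proof.
move=> [df [c c0 H]].
have [] // := @Balg_intro R f df c c 1 ltr01 c0; move=> z /H[] //.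
by rewrite mul1r.
Qed.

Lemma niceD f g : nice f -> nice g -> nice (fun u => f u + g u).
Proof.
move=> [df [c c0 H]] [dg [c' c0' H']]; exists (fun z => df z + dg z).
exists (c + c'); first exact: addr_ge0.
move=> z hz; have [h1 h2 h3] := H z hz; have [h1' h2' h3'] := H' z hz.
split; first exact: cderD.
  by rewrite (le_trans (cabsD _ _))// lerD.
by rewrite (le_trans (cabsD _ _))// mulrDl lerD.
Qed.

Lemma niceM f g : nice f -> nice g -> nice (fun u => f u * g u).
Proof.
move=> [df [c c0 H]] [dg [c' c0' H']]; exists (fun z => df z * g z + f z * dg z).
exists (2 * (c * c')); first by rewrite !mulr_ge0.
move=> z hz; have [h1 h2 h3] := H z hz; have [h1' h2' h3'] := H' z hz.
split; first exact: cderM.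
  rewrite cabsM (le_trans (ler_pM (cabs_ge0 _) (cabs_ge0 _) h2 h2'))//.
  by rewrite ler_peMl ?mulr_ge0// ler1n.
rewrite (le_trans (cabsD _ _))// !cabsM.
apply: le_trans (lerD (ler_pM (cabs_ge0 _) (cabs_ge0 _) h3 h2')
  (ler_pM (cabs_ge0 _) (cabs_ge0 _) h2 h3')) _.
by rewrite le_eqVlt; apply/orP; left; apply/eqP; ring.
Qed.

Lemma nice_cst c : nice (fun=> c).
Proof.
exists (fun=> 0); exists (cabs c); first exact: cabs_ge0.
move=> z _; split=> //; first exact: cder_cst.
by rewrite cabs0 divr_ge0 ?cabs_ge0// sqr_ge0.
Qed.

Lemma niceZ f c : nice f -> nice (fun u => c * f u).
Proof. by move=> h; apply: niceM => //; exact: nice_cst. Qed.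

(** Square [1 + x / 2 <= expR (x / 2)]. This converts exponential decay into the quadratic decay
    required by [Balg_intro]. *)
Lemma expRN_le (x : R) : 0 <= x -> expR (- x) <= (1 + x / 2) ^- 2.
Proof.
move=> x0; have h : 0 < 1 + x / 2 by rewrite ltr_wpDr// divr_ge0.
rewrite expRN lef_pV2 ?posrE ?expR_gt0 ?exprn_gt0//.
have -> : expR x = expR (x / 2) ^+ 2.
  by rewrite -expRM_natl; congr expR; rewrite mulrC divfK.
by rewrite ler_pXn2r ?nnegrE ?expR_ge0 ?(ltW h)// expR_ge1Dx.
Qed.

Lemma cexpt_bound t z : 0 <= t -> Cplus z -> cabs (cexpt t z) <= 1.
Proof.
by move=> t0 hz; rewrite cabs_cexpt expR_le1 oppr_le0 mulr_ge0// ltW.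
Qed.

Lemma cexpt_dbound t z : 0 <= t -> Cplus z ->
  cabs (- ((t%:C)%C * cexpt t z)) <= t / (1 + t / 2 * complex.Re z) ^+ 2.
Proof.
move=> t0 hz; rewrite cabsN cabsM cabs_real ger0_norm// ler_wpM2l//.
by rewrite cabs_cexpt mulrAC expRN_le// mulr_ge0// ltW.
Qed.

Lemma nice_cexpt t : 0 <= t -> nice (cexpt t).
Proof.
rewrite le_eqVlt => /predU1P[<-|t0].
  have -> : cexpt 0 = (fun=> 1) :> (R[i] -> R[i]) by apply: funext => z; rewrite cexpt0.
  exact: nice_cst.
have p0 : 0 < 1 + 2 / t by rewrite ltr_wpDr// divr_ge0// ltW.
have c0 : 0 <= t * (1 + 2 / t) ^+ 2 by rewrite mulr_ge0 ?sqr_ge0// ltW.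
(* The factor [(1 + 2 / t) ^+ 2] trades the weight [1 + t / 2 * Re z] of [cexpt_dbound] for the
   weight [1 + Re z] of [nice]; the summand 1 covers the bound on the function itself. *)
exists (fun z => - ((t%:C)%C * cexpt t z)), (1 + t * (1 + 2 / t) ^+ 2).
  by rewrite addr_ge0.
move=> z hz; split; first exact: cder_cexpt.
  by rewrite (le_trans (cexpt_bound _ _ (ltW t0) hz))// lerDl.
apply: le_trans (cexpt_dbound _ _ (ltW t0) hz) _.
have z0 : 0 < complex.Re z := hz.
have q0 : 0 < 1 + t / 2 * complex.Re z.
  by rewrite ltr_wpDr// mulr_ge0 ?(ltW z0)// divr_ge0// ltW.
have r0 : 0 < 1 + complex.Re z by rewrite ltr_wpDl.
have le1 : 1 + complex.Re z <= (1 + 2 / t) * (1 + t / 2 * complex.Re z).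
  have -> : (1 + 2 / t) * (1 + t / 2 * complex.Re z) =
      1 + complex.Re z + (2 / t + t / 2 * complex.Re z).
    by field; rewrite gt_eqF.
  rewrite lerDl addr_ge0//; first by rewrite divr_ge0// ltW.
  by rewrite mulr_ge0 ?(ltW z0)// divr_ge0// ltW.
rewrite ler_pdivrMr ?exprn_gt0// mulrAC ler_pdivlMr ?exprn_gt0//.
apply: (@le_trans _ _ (t * (1 + 2 / t) ^+ 2 * (1 + t / 2 * complex.Re z) ^+ 2)).
  rewrite -mulrA ler_wpM2l ?(ltW t0)// -exprMn ler_pXn2r ?nnegrE ?(ltW r0)//.
  by rewrite mulr_ge0 ?ltW.
by rewrite ler_wpM2r ?sqr_ge0// lerDr ler01.
Qed.

(** The sup norm gives 1 and the integral gives [t / (t / 2) = 2]. Uniformity in [t] is what makes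
    the telescoping sum work. *)
Lemma normB_cexpt t : 0 <= t -> normB (cexpt t) <= 3.
Proof.
move=> t0; have [t1|] := ltP 0 t.
  have [] // := @Balg_intro R (cexpt t) (fun z => - ((t%:C)%C * cexpt t z)) 1 t (t / 2).
  - by rewrite divr_gt0.
  - by move=> z _; exact: cder_cexpt.
  - by move=> z; exact: cexpt_bound.
  - by move=> z; exact: cexpt_dbound.
  by move=> _; rewrite invf_div mulrCA divff ?gt_eqF// mulr1 => /le_trans; apply; lra.
move=> t1; have -> : t = 0 by apply/eqP; rewrite eq_le t0 t1.
have [] // := @Balg_intro R (cexpt 0) (fun=> 0) 1 0 1 ltr01 (lexx _).
- move=> z _; apply: cder_eq (cder_cexpt _ _) _; by rewrite mul0r oppr0.
- by move=> z; exact: cexpt_bound.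
- by move=> z _; rewrite cabs0 mul0r.
by move=> _; rewrite mul0r addr0 => /le_trans; apply; lra.
Qed.

Lemma add1_cabs_ge z : Cplus z -> 1 + complex.Re z <= cabs (1 + z).
Proof.
move=> hz; apply: le_trans (Re_le_cabs _); rewrite raddfD /=.
exact: ler_norm.
Qed.

Lemma add1_neq0 z : Cplus z -> 1 + z != 0.
Proof.
move=> hz; rewrite -cabs_gt0 (lt_le_trans _ (add1_cabs_ge _ hz))//.
by rewrite ltr_wpDl.
Qed.

Lemma cder_rz1 z : Cplus z -> cder (rz 1) z (- (rz 1 z ^+ 2)).
Proof.
move=> hz; have := cderV (fun u => 1 + u) z _ (add1_neq0 _ hz)
  (cderD _ _ _ _ _ (cder_cst 1 z) (cder_id z)).
by move/cder_eq; apply; rewrite /rz add0r mulNr mul1r exprVn.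
Qed.

Lemma cabs_rz1 z : Cplus z -> cabs (rz 1 z) <= (1 + complex.Re z)^-1.
Proof.
move=> hz; have h : 0 < 1 + complex.Re z by rewrite ltr_wpDl.
rewrite /rz cabsV lef_pV2 ?posrE//; first exact: add1_cabs_ge.
by rewrite cabs_gt0 add1_neq0.
Qed.

Lemma cabs_rz1_le1 z : Cplus z -> cabs (rz 1 z) <= 1.
Proof.
move=> hz; apply: le_trans (cabs_rz1 _ hz) _; rewrite invf_le1.
  by rewrite lerDl ltW.
by rewrite ltr_wpDl.
Qed.

Lemma nice_rz1 : nice (rz 1).
Proof.
exists (fun z => - (rz 1 z ^+ 2)), 1 => // z hz; split; first exact: cder_rz1.
  exact: cabs_rz1_le1.
rewrite cabsN cabsX mul1r -exprVn ler_pXn2r ?nnegrE ?cabs_ge0//; first exact: cabs_rz1.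
by rewrite invr_ge0 addr_ge0// ltW.
Qed.

(** Each factor [r_1] absorbs one factor [z] on the right half-plane. *)
Lemma cabs_mul_rz1 z : Cplus z -> cabs z * cabs (rz 1 z) <= 1.
Proof.
move=> hz; rewrite /rz cabsV ler_pdivrMr ?cabs_gt0 ?add1_neq0// mul1r.
rewrite -(ler_pXn2r (ltn0Sn 1)) ?nnegrE ?cabs_ge0// !cabs_sqr !raddfD /=.
rewrite add0r lerD2r (ler_pXn2r (ltn0Sn 1)) ?nnegrE; [by rewrite lerDr| |].
  exact: ltW.
by rewrite addr_ge0// ltW.
Qed.

Local Notation r := (@rz R 1).
Local Notation r3 := (fun u => r u * (r u * r u)).
Local Notation r4 := (fun u => r u * (r u * (r u * r u))).

(** This is [(e^{-h z} - 1 + h z) r_1^4], with [z r_1^4] written as [r_1^3 - r_1^4] so that every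
    term is [nice] and [Phi] can be evaluated term by term. *)
Definition taylor_rem (h : R) : R[i] -> R[i] := fun u =>
  cexpt h u * r4 u + ((-1) * r4 u + (h%:C)%C * (r3 u + (-1) * r4 u)).

Lemma taylor_remE h z :
  taylor_rem h z = (cexpt h z - 1 + (h%:C)%C * z) * r z ^+ 4.
Proof.
(* At [z = -1] both sides vanish, because [0^-1 = 0]. *)
rewrite /taylor_rem; have [z0|z0] := eqVneq (1 + z) 0.
  by rewrite /rz z0 invr0; ring.
have : r z * (1 + z) = 1 by rewrite /rz mulVf.
move: (r z) (cexpt h z) => p e E.
have pz : p * z = 1 - p by rewrite -E; ring.
have -> : (e - 1 + (h%:C)%C * z) * p ^+ 4 = (e - 1) * p ^+ 4 + (h%:C)%C * p ^+ 3 * (p * z) by ring.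
by rewrite pz; ring.
Qed.

(** With [E = e^{-h z} - 1 + h z], the bound [|E| <= 4 h^2 |z|^2] gives sup norm [4 h^2]. The
    derivative contributes [(4 + 1 + 16) h^2]: 4 from [h E] (as [h <= 1]), 1 from [h^2 z], 16 from
    differentiating [r_1^4]. The total is [25 h^2]. *)
Lemma normB_taylor_rem (h : R) : 0 <= h <= 1 ->
  Balg (taylor_rem h) /\ normB (taylor_rem h) <= 25 * h ^+ 2.
Proof.
move=> /andP[h0 h1].
pose E z := cexpt h z - 1 + (h%:C)%C * z.
pose dE z := - (h%:C)%C * E z + (h%:C)%C ^+ 2 * z.
pose df z := dE z * r z ^+ 4 + E z * (- 4%:R * r z ^+ 5).
have -> : taylor_rem h = (fun z => E z * r z ^+ 4) by apply: funext => z; rewrite taylor_remE.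
have cE : cabs (h%:C)%C = h by rewrite cabs_real ger0_norm.
have hE z : Cplus z -> cabs (E z) <= 4 * h ^+ 2 * cabs z ^+ 2.
  move=> hz; have := @cexp_sub1_neg2 R (- ((h%:C)%C * z)).
  rewrite opprK cabsN cabsM cE; rewrite exprMn mulrA; apply.
  by case: (z) hz => a b /= a0; rewrite mul0r subr0 oppr_le0 mulr_ge0// ltW.
have [] := @Balg_intro R (fun z => E z * r z ^+ 4) df (4 * h ^+ 2) (21 * h ^+ 2) 1 ltr01.
- by rewrite mulr_ge0// sqr_ge0.
- move=> z hz.
  have d1 : cder E z (dE z).
    have := cderD _ _ _ _ _ (cderD _ _ _ _ _ (cder_cexpt h z) (cder_cst (-1) z))
      (cderZ _ _ _ ((h%:C)%C) (cder_id z)).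
    by move/cder_eq; apply; rewrite /dE /E; ring.
  have d2 : cder (fun u => r u ^+ 4) z (- 4%:R * r z ^+ 5).
    have hr := cder_rz1 _ hz.
    have hr2 := cderM _ _ _ _ _ hr hr; have hr4 := cderM _ _ _ _ _ hr2 hr2.
    have -> : (fun u => r u ^+ 4) = (fun u => r u * r u * (r u * r u)).
      by apply: funext => u; ring.
    by move/cder_eq: hr4; apply; ring.
  exact: cderM.
- move=> z hz; rewrite cabsM cabsX.
  apply: le_trans (ler_wpM2r _ (hE z hz)) _; first by rewrite exprn_ge0// cabs_ge0.
  have := cabs_mul_rz1 _ hz; have := cabs_rz1_le1 _ hz.
  move: (cabs_ge0 (r z)) (cabs_ge0 z); move: (cabs (r z)) (cabs z) => p q p0 q0 p1 pq.
  have -> : 4 * h ^+ 2 * q ^+ 2 * p ^+ 4 = 4 * h ^+ 2 * ((q * p) ^+ 2 * p ^+ 2) by ring.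
  rewrite -[leRHS]mulr1 ler_wpM2l ?mulr_ge0 ?sqr_ge0//.
  by rewrite mulr_ile1 ?sqr_ge0 ?exprn_ile1// mulr_ge0.
- move=> z hz; rewrite mul1r.
  have hr2 : cabs (r z) ^+ 2 <= ((1 + complex.Re z) ^+ 2)^-1.
    rewrite -exprVn ler_pXn2r ?nnegrE ?cabs_ge0 ?cabs_rz1//.
    by rewrite invr_ge0 addr_ge0// ltW.
  apply: (@le_trans _ _ (21 * h ^+ 2 * cabs (r z) ^+ 2)); last first.
    by rewrite ler_wpM2l// mulr_ge0// sqr_ge0.
  have hdE : cabs (dE z) <= 4 * h ^+ 2 * cabs z ^+ 2 + h ^+ 2 * cabs z.
    rewrite (le_trans (cabsD _ _))// !cabsM cabsN cE lerD// ?cabsX ?cabs_real ?ger0_norm//.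
    by rewrite (le_trans _ (hE z hz))// ler_piMl ?cabs_ge0.
  apply: le_trans (cabsD (dE z * r z ^+ 4) (E z * (- 4%:R * r z ^+ 5))) _.
  rewrite (cabsM (dE z)) (cabsM (E z)) (cabsM (- 4%:R)) !cabsX cabsN.
  have -> : cabs (4%:R : R[i]) = 4 by rewrite -(rmorph_nat (@real_complex R)) cabs_real ger0_norm.
  have p4 : 0 <= cabs (r z) ^+ 4 by rewrite exprn_ge0// cabs_ge0.
  have p5 : 0 <= 4 * cabs (r z) ^+ 5 by rewrite mulr_ge0// exprn_ge0// cabs_ge0.
  apply: le_trans (lerD (ler_wpM2r p4 hdE) (ler_wpM2r p5 (hE z hz))) _.
  have := cabs_mul_rz1 _ hz; have := cabs_rz1_le1 _ hz.
  move: (cabs_ge0 (r z)) (cabs_ge0 z); move: (cabs (r z)) (cabs z) => p q p0 q0 p1 pq.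
  have -> : (4 * h ^+ 2 * q ^+ 2 + h ^+ 2 * q) * p ^+ 4 +
      4 * h ^+ 2 * q ^+ 2 * (4 * p ^+ 5) =
      (h ^+ 2 * p ^+ 2) * (4 * (q * p) ^+ 2 + (q * p) * p + 16 * ((q * p) ^+ 2 * p)) by ring.
  have -> : 21 * h ^+ 2 * p ^+ 2 = (h ^+ 2 * p ^+ 2) * 21 by ring.
  rewrite ler_wpM2l ?mulr_ge0 ?sqr_ge0//.
  have q1 : 0 <= q * p by rewrite mulr_ge0.
  have a1 : (q * p) ^+ 2 <= 1 by rewrite exprn_ile1.
  have a2 : (q * p) * p <= 1 by rewrite mulr_ile1.
  have a3 : (q * p) ^+ 2 * p <= 1 by rewrite mulr_ile1// sqr_ge0.
  lra.
by move=> ? /le_trans le; split=> //; apply: le; rewrite divr1; lra.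
Qed.

End Nice.

(** * The group inside the B-calculus *)

Lemma telescope_rn {R : realType} {V : normedModType R[i]} (d : nat -> V) (B : R) n :
  (forall k, (k < n)%N -> rn (d k - d k.+1) <= B) -> rn (d 0%N - d n) <= n%:R * B.
Proof.
elim: n => [|n IH] H; first by rewrite subrr rn0 mul0r.
apply: le_trans (rn_sub_trans (d n) _ _) _.
by rewrite -natr1 mulrDl mul1r lerD ?H// IH// => k /ltnW; exact: H.
Qed.

Section GroupInCalculus.
Context {R : realType} {X : completeNormedModType R[i]}.
Variables (T : R -> X -> X) (D : set X) (A : X -> X).
Hypothesis HT : C0_group T.
Hypothesis HB : bounded_group T.
Hypothesis HG : generator T D (fun x => - A x).
Hypothesis HD : densely_defined D.
Variable Phi : (R[i] -> R[i]) -> X -> X.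
Hypothesis HPhi : bounded_alg_hom (@Balg R) (@normB R) Phi.
Hypothesis Hres : inv_plus D A 1 (Phi (rz 1)).

Local Notation R1 := (Phi (rz 1)).

Lemma Phi_blin f : Balg f -> bounded_linear (Phi f).
Proof. by have [h _] := HPhi; exact: h. Qed.

Lemma PhiD f g x : nice f -> nice g ->
  Phi (fun u => f u + g u) x = Phi f x + Phi g x.
Proof.
by have [_ [h _]] := HPhi; move=> /nice_Balg hf /nice_Balg hg; exact: h.
Qed.

Lemma PhiZ c f x : nice f -> Phi (fun u => c * f u) x = c *: Phi f x.
Proof. by have [_ [_ [h _]]] := HPhi; move=> /nice_Balg hf; exact: h. Qed.

Lemma PhiM f g x : nice f -> nice g -> Phi (fun u => f u * g u) x = Phi f (Phi g x).
Proof.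
by have [_ [_ [_ [h _]]]] := HPhi; move=> /nice_Balg hf /nice_Balg hg; exact: h.
Qed.

Lemma normB_ge0 (f : R[i] -> R[i]) : Balg f -> 0 <= normB f.
Proof.
by move=> hf; apply: le_trans (normB_ge _ (1 +i* 0)%C hf _); [exact: cabs_ge0|exact: ltr01].
Qed.

Lemma Phi_bound : exists2 C : R, 0 <= C &
  forall f, Balg f -> forall x, rn (Phi f x) <= C * normB f * rn x.
Proof.
have [_ [_ [_ [_ [M hM]]]]] := HPhi; exists `|M| => // f hf x.
have := hM f hf x; rewrite rn_lin => /le_trans; apply.
by rewrite ler_wpM2r ?rn_ge0// ler_wpM2r ?normB_ge0// ler_norm.
Qed.

Lemma group_bound : exists2 K : R, 0 <= K & forall t x, rn (T t x) <= K * rn x.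
Proof.
have [M hM] := HB; exists `|M| => // t x.
have := hM t x; rewrite rn_lin => /le_trans; apply.
by rewrite ler_wpM2r ?rn_ge0// ler_norm.
Qed.

Lemma blin_R1 : bounded_linear R1. Proof. by case: Hres. Qed.

Lemma A_R1 x : D (R1 x) /\ A (R1 x) = x - R1 x.
Proof.
have [_ [h _]] := Hres; have [Dx E] := h x; split=> //.
by rewrite -[X in X - _]E scale1r addrC addKr.
Qed.

(** [R1] inverts [1 + A] on [D], so its range contains the dense set [D]. *)
Lemma blin_vanish_R1 S S' : bounded_linear S -> bounded_linear S' ->
  (forall x, S (R1 x) = S' (R1 x)) -> forall x, S x = S' x.
Proof.
move=> h h' H; apply: (blin_ext_dense _ _ _ HD h h') => y Dy.
have [_ [_ h2]] := Hres; by rewrite -(h2 y Dy) H.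
Qed.

(** The identity [A R1 = 1 - R1] turns [r_1^3 - r_1^4] into [A R1^4]. *)
Lemma Phi_taylor_rem (h : R) x : 0 <= h ->
  Phi (taylor_rem h) x = Phi (cexpt h) (R1 (R1 (R1 (R1 x)))) - R1 (R1 (R1 (R1 x)))
     + (h%:C)%C *: A (R1 (R1 (R1 (R1 x)))).
Proof.
move=> h0; have n1 := @nice_rz1 R.
have n2 := niceM _ _ n1 n1; have n3 := niceM _ _ n1 n2; have n4 := niceM _ _ n1 n3.
have ne := nice_cexpt _ h0; have n5 := niceM _ _ ne n4.
have n6 := niceZ _ (-1) n4; have n7 := niceD _ _ n3 n6; have n8 := niceZ _ ((h%:C)%C) n7.
rewrite /taylor_rem (PhiD _ _ _ n5 (niceD _ _ n6 n8)) (PhiM _ _ _ ne n4).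
rewrite (PhiD _ _ _ n6 n8) (PhiZ _ _ _ n4) (PhiZ _ _ _ n7) (PhiD _ _ _ n3 n6) (PhiZ _ _ _ n4).
rewrite !(PhiM _ _ _ n1 n3) (PhiM _ _ _ n1 n2) (PhiM _ _ _ n1 n1).
by rewrite !scaleN1r addrA (A_R1 (R1 (R1 (R1 x)))).2.
Qed.

(* Telescoping [Phi(e_t) - T(t)] over [n] steps of length [h = t / n]: on the
   range of [R1^4] each step costs [o(h)], uniformly. *)
Lemma Phi_cexpt_R4 t x : 0 <= t ->
  Phi (cexpt t) (R1 (R1 (R1 (R1 x)))) = T t (R1 (R1 (R1 (R1 x)))).
Proof.
(* At [t = 0] the symbol is the constant 1, but [Phi] need not send it to the identity; on the range
   of [R1] it acts as such because [1 * r_1 = r_1]. *)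
rewrite le_eqVlt => /predU1P[<-|t0].
  have -> : cexpt 0 = (fun u => cexpt 0 u * cexpt 0 u) :> (R[i] -> R[i]).
    by apply: funext => u; rewrite !cexpt0 mulr1.
  have n0 := nice_cexpt 0 (lexx (0 : R)).
  have [_ [hT0 _]] := HT; rewrite hT0.
  have E y : Phi (cexpt 0) (R1 y) = R1 y.
    rewrite -(PhiM _ _ _ n0 nice_rz1); congr (Phi _ y).
    by apply: funext => u; rewrite cexpt0 mul1r.
  by rewrite (PhiM _ _ _ n0 n0) !E.
set y := R1 (R1 (R1 (R1 x))).
have Dy : D y := (A_R1 _).1.
have [C C0 hC] := Phi_bound; have [K K0 hK] := group_bound.
have [hTl [hT0 [hTadd _]]] := HT.
have hP (s : R) w : 0 <= s -> rn (Phi (cexpt s) w) <= C * 3 * rn w.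
  move=> s0; apply: le_trans (hC _ (nice_Balg _ (nice_cexpt _ s0)) w) _.
  by rewrite ler_wpM2r ?rn_ge0// ler_wpM2l// normB_cexpt.
have comm s w : T s (R1 w) = R1 (T s w) by exact: (group_resolvent_comm _ _ _ HT HG _ _ _ _ Hres).
apply/eqP; rewrite -subr_eq0; apply/eqP; apply: rn_le0 => e e0.
(* Over all steps, the Taylor errors will sum to [K1 * h] and the generator defects to
   [K2 / (K2 + 1) * (e / 2)]. *)
pose K1 := C * 3 * (C * 25 * (K * rn x)) * t; pose K2 := C * 3 * K * t.
have K10 : 0 <= K1 by rewrite /K1 !mulr_ge0 ?rn_ge0// ltW.
have K20 : 0 <= K2 by rewrite /K2 !mulr_ge0// ltW.
have K21 : 0 < K2 + 1 by rewrite ltr_wpDl.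
have K11 : 0 < K1 + 1 by rewrite ltr_wpDl.
have [/(_ (conj Dy erefl)) hx _] := generatorP _ _ _ HG y (- A y).
have [d d0 hd] := hx (e / 2 / (K2 + 1)) (divr_gt0 (divr_gt0 e0 (ltr0Sn _ _)) K21).
pose m := Num.min 1 (Num.min d (e / 2 / (K1 + 1))).
have m0 : 0 < m by rewrite /m !lt_min ltr01 d0 !divr_gt0.
(* The successor gives [n > t / m], hence a step [h = t / n] strictly below [m]. *)
pose n := (Num.truncn (t / m)).+1.
pose h := t / n%:R.
have n0 : 0 < n%:R :> R by rewrite ltr0n.
have h0 : 0 < h by rewrite divr_gt0.
have hm : h < m.
  rewrite /h ltr_pdivrMr// mulrC -ltr_pdivrMr//.
  by rewrite /n truncnS_gt.
have [h1 hdd hK1] : [/\ h <= 1, `|h| < d & h * (K1 + 1) <= e / 2].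
  rewrite (gtr0_norm h0); move: hm; rewrite /m !lt_min => /and3P[a1 a2].
  by rewrite ltr_pdivlMr// => a3; split=> //; exact: ltW.
have nh : n%:R * h = t by rewrite /h mulrCA divff ?mulr1// gt_eqF.
pose B := C * 3 * (C * (25 * h ^+ 2) * (K * rn x) + K * (e / 2 / (K2 + 1) * h)).
(* Interpolates from [Phi (cexpt t) y] at [k = 0] to [T t y] at [k = n], trading one step of the
   calculus for one step of the group each time. *)
pose dd k := Phi (cexpt ((n - k)%N%:R * h)) (T (k%:R * h) y).
have step k : (k < n)%N -> rn (dd k - dd k.+1) <= B.
  move=> kn; rewrite /dd.
  pose s := (n - k.+1)%N%:R * h.
  have s0 : 0 <= s by rewrite mulr_ge0// ltW.
  have -> : (n - k)%N%:R * h = s + h.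
    by rewrite /s -[X in _ + X]mul1r -mulrDl natr1 subnSK.
  have -> : k.+1%:R * h = h + k%:R * h by rewrite -natr1 mulrDl mul1r addrC.
  have -> : cexpt (s + h) = (fun u => cexpt s u * cexpt h u).
    by apply: funext => u; rewrite cexptD.
  rewrite (PhiM _ _ _ (nice_cexpt _ s0) (nice_cexpt _ (ltW h0))) hTadd.
  rewrite -(blinB _ (Phi_blin _ (nice_Balg _ (nice_cexpt _ s0)))).
  apply: le_trans (hP _ _ s0) _; rewrite /B ler_wpM2l ?mulr_ge0//.
  set w := T (k%:R * h) y.
  have wE : w = R1 (R1 (R1 (R1 (T (k%:R * h) x)))) by rewrite /w /y !comm.
  have Aw : A w = T (k%:R * h) (A y) := (group_domain _ _ _ HT HG _ _ Dy).2.
  (* Inserting [w - h A w] separates the error of the calculus, a Taylor remainder of order [h^2],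
     from that of the group. The latter is the generator defect of the fixed vector [y] moved by
     [T (k h)], so one threshold [d] serves all [k]. *)
  have -> : Phi (cexpt h) w - T h w = Phi (taylor_rem h) (T (k%:R * h) x) -
       T (k%:R * h) (T h y - y - (h%:C)%C *: - A y).
    rewrite (Phi_taylor_rem _ _ (ltW h0)) -wE.
    rewrite !(blinB _ (hTl _)) (blinZ _ (hTl _)) (blinN _ (hTl _)) -Aw -/w.
    have -> : T (k%:R * h) (T h y) = T h w by rewrite /w -!hTadd addrC.
    rewrite scalerN opprK [in RHS]opprD addrACA subrr addr0.
    by rewrite opprB addrA subrK.
  rewrite (le_trans (rnD _ _))// rnN lerD//.
    have [hb1 hb2] := normB_taylor_rem h (introT andP (conj (ltW h0) h1)).
    apply: le_trans (hC _ hb1 _) _.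
    by rewrite ler_pM ?mulr_ge0 ?rn_ge0 ?normB_ge0// ler_wpM2l.
  apply: le_trans (hK _ _) _; rewrite ler_wpM2l//.
  by have := hd h (lt0r_neq0 h0) hdd; rewrite (gtr0_norm h0).
have := telescope_rn dd B n step.
rewrite /dd subn0 subnn mul0r hT0 nh.
have -> : Phi (cexpt 0) (T t y) = T t y.
  have -> : T t y = R1 (T t (R1 (R1 (R1 x)))) by rewrite -comm.
  rewrite -(PhiM _ _ _ (nice_cexpt _ (lexx _)) nice_rz1); congr (Phi _ _).
  by apply: funext => u; rewrite cexpt0 mul1r.
move/le_trans; apply.
have -> : n%:R * B = K1 * h + K2 / (K2 + 1) * (e / 2).
  by rewrite /B /K1 /K2 -nh; ring.
rewrite [leRHS]splitr lerD//.
  by rewrite (le_trans _ hK1)// mulrC ler_wpM2l ?(ltW h0)// lerDl.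
rewrite ler_piMl//; first by rewrite ltW// divr_gt0.
by rewrite ler_pdivrMr// mul1r lerDl.
Qed.

(** The two operators agree after composition with [R1^4]; density of the range of [R1] removes the
    four factors one at a time. *)
Lemma Phi_cexpt t x : 0 <= t -> Phi (cexpt t) x = T t x.
Proof.
move=> t0; have hl := Phi_blin _ (nice_Balg _ (nice_cexpt _ t0)).
have hR := blin_R1; have [hT _] := HT; have hTt := hT t.
have h1 := blin_comp _ _ hl hR; have h1' := blin_comp _ _ hTt hR.
have h2 := blin_comp _ _ h1 hR; have h2' := blin_comp _ _ h1' hR.
have h3 := blin_comp _ _ h2 hR; have h3' := blin_comp _ _ h2' hR.
apply: (blin_vanish_R1 _ _ hl hTt); apply: (blin_vanish_R1 _ _ h1 h1').
apply: (blin_vanish_R1 _ _ h2 h2'); apply: (blin_vanish_R1 _ _ h3 h3').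
by move=> y; exact: Phi_cexpt_R4.
Qed.

End GroupInCalculus.

(** * Sup-norm bounds on the imaginary axis *)

Section Tame.
Context {R : realType}.
Implicit Types (F G : R[i] -> R[i]) (z : R[i]) (t : R).

(** Exponential growth in [Re z] is allowed so that [e^{-t z}] with [t < 0] qualifies. The last
    bound makes [F] approach its values on the axis at a linear rate in [Re z], uniformly in [Im z];
    through it a sup bound on the axis controls [F] nearby. *)
Definition tame F : Prop := exists dF, exists C N : R, [/\ 0 <= C, 0 <= N,
  (forall b, cabs (F (0 +i* b)%C) <= C) &
  forall z, Cplus z -> [/\ cder F z (dF z),
    cabs (F z) <= C * expR (N * complex.Re z),
    cabs (dF z) <= C * expR (N * complex.Re z) &
    cabs (F z - F (0 +i* complex.Im z)%C) <= C * complex.Re z * expR (N * complex.Re z)]].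

Lemma tameD F G : tame F -> tame G -> tame (fun u => F u + G u).
Proof.
move=> [dF [C [N [C0 N0 hb H]]]] [dG [C' [N' [C0' N0' hb' H']]]].
exists (fun z => dF z + dG z), (C + C'), (N + N'); split; rewrite ?addr_ge0//.
  by move=> b; rewrite (le_trans (cabsD _ _))// lerD.
move=> z hz; have [h1 h2 h3 h4] := H z hz; have [h1' h2' h3' h4'] := H' z hz.
have z0 : 0 <= complex.Re z by exact: ltW.
have e1 : expR (N * complex.Re z) <= expR ((N + N') * complex.Re z).
  by rewrite ler_expR ler_wpM2r// lerDl.
have e2 : expR (N' * complex.Re z) <= expR ((N + N') * complex.Re z).
  by rewrite ler_expR ler_wpM2r// lerDr.
split; first exact: cderD.
- rewrite (le_trans (cabsD _ _))// mulrDl.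
  by rewrite lerD// ?(le_trans h2)// ?(le_trans h2')// ler_wpM2l.
- rewrite (le_trans (cabsD _ _))// mulrDl.
  by rewrite lerD// ?(le_trans h3)// ?(le_trans h3')// ler_wpM2l.
- rewrite opprD addrACA (le_trans (cabsD _ _))// -mulrA mulrDl !mulrA.
  rewrite lerD// ?(le_trans h4)// ?(le_trans h4')// ler_wpM2l//.
    by rewrite mulr_ge0.
  by rewrite mulr_ge0.
Qed.

Lemma tameM F G : tame F -> tame G -> tame (fun u => F u * G u).
Proof.
move=> [dF [C [N [C0 N0 hb H]]]] [dG [C' [N' [C0' N0' hb' H']]]].
exists (fun z => dF z * G z + F z * dG z), (2 * (C * C')), (N + N').
have CC : 0 <= C * C' by rewrite mulr_ge0.
split; rewrite ?addr_ge0 ?mulr_ge0//.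
  move=> b; rewrite cabsM (le_trans (ler_pM (cabs_ge0 _) (cabs_ge0 _) (hb b) (hb' b)))//.
  by rewrite ler_peMl// ler1n.
move=> z hz; have [h1 h2 h3 h4] := H z hz; have [h1' h2' h3' h4'] := H' z hz.
have z0 : 0 <= complex.Re z by exact: ltW.
have ee : expR ((N + N') * complex.Re z) = expR (N * complex.Re z) * expR (N' * complex.Re z).
  by rewrite mulrDl expRD.
have p0 := expR_ge0 (N * complex.Re z); have p0' := expR_ge0 (N' * complex.Re z).
have p1 : 1 <= expR (N * complex.Re z) by rewrite -expR0 ler_expR mulr_ge0.
have a0 := cabs_ge0; rewrite ee.
move: p0 p0' p1 h2 h3 h4 h2' h3' h4'.
set p := expR (N * _); set p' := expR (N' * _) => p0 p0' p1 h2 h3 h4 h2' h3' h4'.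
split; first exact: cderM.
- rewrite cabsM (le_trans (ler_pM (a0 _ _) (a0 _ _) h2 h2'))//.
  by rewrite mulrACA ler_wpM2r ?mulr_ge0// ler_peMl// ler1n.
- rewrite (le_trans (cabsD _ _))// !cabsM.
  apply: le_trans (lerD (ler_pM (a0 _ _) (a0 _ _) h3 h2') (ler_pM (a0 _ _) (a0 _ _) h2 h3')) _.
  by rewrite le_eqVlt; apply/orP; left; apply/eqP; ring.
- have -> : F z * G z - F (0 +i* complex.Im z)%C * G (0 +i* complex.Im z)%C =
     (F z - F (0 +i* complex.Im z)%C) * G z +
     F (0 +i* complex.Im z)%C * (G z - G (0 +i* complex.Im z)%C) by ring.
  rewrite (le_trans (cabsD _ _))// !cabsM.
  apply: le_trans (lerD (ler_pM (a0 _ _) (a0 _ _) h4 h2') (ler_pM (a0 _ _) (a0 _ _) (hb _) h4')) _.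
  have -> : 2 * (C * C') * complex.Re z * (p * p') =
    C * complex.Re z * p * (C' * p') + p * (C * (C' * complex.Re z * p')) by ring.
  by rewrite lerD2l ler_peMl// !mulr_ge0.
Qed.

Lemma tame_cst c : tame (fun=> c).
Proof.
exists (fun=> 0), (cabs c), 0; split; rewrite ?cabs_ge0// => z hz.
rewrite mul0r expR0 !mulr1 subrr cabs0; split; rewrite ?cabs_ge0//.
  exact: cder_cst.
by rewrite mulr_ge0 ?cabs_ge0// ltW.
Qed.

Lemma expR_sub1_le_expR (x : R) : `|expR x - 1| <= `|x| * expR `|x|.
Proof.
have [x0|x0] := leP x 0.
  rewrite (le_trans (expR_sub1_le _ x0))// ler_peMr//.
  by rewrite -expR0 ler_expR.
have -> : expR x - 1 = - (expR x * (expR (- x) - 1)).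
  by rewrite mulrBr expRxMexpNx_1; ring.
rewrite normrN normrM [`|expR x|]ger0_norm ?expR_ge0// mulrC.
rewrite [X in _ <= _ * expR X]gtr0_norm// ler_wpM2r ?expR_ge0//.
by rewrite -[X in _ <= X]normrN expR_sub1_le// oppr_le0 ltW.
Qed.

Lemma tame_cexpt t : tame (cexpt t).
Proof.
exists (fun z => - ((t%:C)%C * cexpt t z)), (1 + `|t|), `|t|.
split; rewrite ?addr_ge0//.
  by move=> b; rewrite cabs_cexpt /= mulr0 oppr0 expR0 lerDl.
move=> z hz; have z0 : 0 <= complex.Re z by exact: ltW.
have e1 : cabs (cexpt t z) <= expR (`|t| * complex.Re z).
  by rewrite cabs_cexpt ler_expR -mulNr ler_wpM2r// -normrN ler_norm.
have p0 := expR_ge0 (`|t| * complex.Re z).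
split; first exact: cder_cexpt.
- by rewrite (le_trans e1)// ler_peMl// lerDl.
- by rewrite cabsN cabsM cabs_real ler_pM ?cabs_ge0// lerDr.
- have -> : z = ((complex.Re z)%:C)%C + (0 +i* complex.Im z)%C.
    by case: (z) => a b; simpc.
  have -> : complex.Im ((complex.Re z)%:C%C + (0 +i* complex.Im z)%C) = complex.Im z.
    by case: (z) => a b /=; rewrite add0r.
  have -> : complex.Re ((complex.Re z)%:C%C + (0 +i* complex.Im z)%C) = complex.Re z.
    by case: (z) => a b /=; rewrite addr0.
  rewrite cexpt_add -[X in _ - X]mul1r -mulrBl cabsM [X in _ * X]cabs_cexpt /= mulr0 oppr0 expR0 mulr1.
  have -> : cexpt t ((complex.Re z)%:C)%C = ((expR (- (t * complex.Re z)))%:C)%C.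
    by rewrite /cexpt /cexp /= !mul0r !mulr0 subr0 addr0 oppr0 cos0 sin0 mulr1 mulr0.
  rewrite -[1 in X in X <= _]/((1%:C)%C) -rmorphB cabs_real.
  apply: le_trans (expR_sub1_le_expR _) _.
  rewrite normrN normrM (ger0_norm z0) ler_wpM2r ?expR_ge0// ler_wpM2r//.
  by rewrite lerDr.
Qed.

Lemma cabs_rz1_axis (b : R) : cabs (rz 1 (0 +i* b)%C) <= 1 /\ 1 + (0 +i* b)%C != 0 :> R[i].
Proof.
have h : 1 <= cabs (1 + (0 +i* b)%C : R[i]).
  by apply: le_trans (Re_le_cabs _); rewrite /= addr0 normr1.
split; last by rewrite -cabs_gt0 (lt_le_trans ltr01).
by rewrite /rz cabsV invf_le1// (lt_le_trans ltr01).
Qed.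

Lemma tame_rz1 : tame (rz 1).
Proof.
exists (fun z => - (rz 1 z ^+ 2)), 1, 0; split; rewrite ?ler01//.
  by move=> b; case: (cabs_rz1_axis b).
move=> z hz; rewrite mul0r expR0 !mulr1 mul1r; split.
- exact: cder_rz1.
- exact: cabs_rz1_le1.
- by rewrite cabsN cabsX exprn_ile1 ?cabs_ge0// cabs_rz1_le1.
- have [b1 b0] := cabs_rz1_axis (complex.Im z).
  have -> : rz 1 z - rz 1 (0 +i* complex.Im z)%C =
     - (((complex.Re z)%:C)%C * (rz 1 z * rz 1 (0 +i* complex.Im z)%C)).
    have {1}-> : ((complex.Re z)%:C)%C = (1 + z) - (1 + (0 +i* complex.Im z)%C).
      by case: (z) => a b; apply/eqP; rewrite eq_complex /=; apply/andP; split; apply/eqP; ring.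
    by rewrite /rz; field; rewrite b0 add1_neq0.
  rewrite cabsN !cabsM cabs_real (gtr0_norm hz) -[leRHS]mulr1 ler_wpM2l ?(ltW hz)//.
  by rewrite mulr_ile1 ?cabs_ge0// cabs_rz1_le1.
Qed.

(* Multiplying by [e_L] with [L] large concentrates the derivative near the
   imaginary axis, so the B-norm is controlled by the sup norm on that axis. *)
Lemma tame_normB F (m e : R) : tame F -> 0 <= m -> 0 < e ->
  (forall b, cabs (F (0 +i* b)%C) <= m) ->
  exists L0 : R, forall L, L0 <= L ->
    normB (fun u => cexpt L u * F u) <= 9 * m + e.
Proof.
move=> [dF [C [N [C0 N0 _ H]]]] m0 e0 hm.
(* The summand [21 * C / e] brings the final error [21 * C / M] below [e]; the summand [N] gives
   [N <= M], hence [L = N + M <= 2 * M]. *)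
pose M0 := N + 1 + 21 * C / e.
have q0 : 0 <= 21 * C / e by rewrite divr_ge0 ?(ltW e0)// mulr_ge0.
exists (N + M0) => L hL; pose M := L - N.
have hM : M0 <= M by rewrite /M lerBrDl.
have M1 : 1 <= M by rewrite (le_trans _ hM)// /M0 -addrA addrCA lerDl addr_ge0.
have MN : N <= M by rewrite (le_trans _ hM)// /M0 -addrA lerDl addr_ge0.
have Me : 21 * C / M <= e.
  rewrite ler_pdivrMr ?(lt_le_trans ltr01)// [leRHS]mulrC -ler_pdivrMr//.
  by rewrite (le_trans _ hM)// /M0 lerDr addr_ge0.
have M0' : 0 < M by rewrite (lt_le_trans ltr01).
have L2 : L <= 2 * M by rewrite /M in MN *; lra.
have LL : 0 <= L by rewrite /M in MN; lra.
have LE : L = N + M by rewrite /M addrC subrK.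
pose df z := - ((L%:C)%C * cexpt L z) * F z + cexpt L z * dF z.
(* The first factor cancels the growth of [F]; decay at rate [M] remains. *)
have eL z : Cplus z -> cabs (cexpt L z) = expR (- (N * complex.Re z)) * expR (- (M * complex.Re z)).
  by move=> hz; rewrite cabs_cexpt LE mulrDl opprD expRD.
have xe (x : R) : x <= expR x by rewrite (le_trans _ (expR_ge1Dx x))// lerDr.
have xe1 (x : R) : x * expR (- x) <= 1.
  by apply: le_trans (ler_wpM2r (expR_ge0 _) (xe _)) _; rewrite expRxMexpNx_1.
have fb z : Cplus z -> cabs (cexpt L z * F z) <=
    expR (- (M * complex.Re z)) * (m + C * complex.Re z).
  move=> hz; have [h1 h2 h3 h4] := H z hz; have z0 : 0 <= complex.Re z by exact: ltW.
  rewrite cabsM eL// mulrAC mulrC ler_wpM2l ?expR_ge0//.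
  have hF : cabs (F z) <= m + C * complex.Re z * expR (N * complex.Re z).
    have := cabsD (F (0 +i* complex.Im z)%C) (F z - F (0 +i* complex.Im z)%C).
    by rewrite addrC subrK => /le_trans; apply; rewrite lerD.
  apply: le_trans (ler_wpM2l (expR_ge0 _) hF) _; rewrite mulrDr lerD//.
    by rewrite ler_piMl// expR_le1 oppr_le0 mulr_ge0.
  have -> : expR (- (N * complex.Re z)) * (C * complex.Re z * expR (N * complex.Re z)) =
      C * complex.Re z * (expR (N * complex.Re z) * expR (- (N * complex.Re z))) by ring.
  by rewrite expRxMexpNx_1 mulr1.
have [||||_] := @Balg_intro R (fun u => cexpt L u * F u) df (m + C / M)
    (5 * C + 2 * M * m) (M / 4) (divr_gt0 M0' (ltr0Sn _ _)).
- by rewrite addr_ge0 ?mulr_ge0// ltW.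
- move=> z hz; have [h1 _ _ _] := H z hz; exact: cderM (cder_cexpt _ _) h1.
- move=> z hz; have z0 : 0 <= complex.Re z by exact: ltW.
  apply: le_trans (fb z hz) _; rewrite mulrDr lerD//.
    by rewrite ler_piMl// expR_le1 oppr_le0 mulr_ge0// ltW.
  rewrite mulrCA ler_wpM2l// -[leRHS]mul1r ler_pdivlMr//.
  have -> : expR (- (M * complex.Re z)) * complex.Re z * M =
      M * complex.Re z * expR (- (M * complex.Re z)) by ring.
  exact: xe1.
- move=> z hz; have [h1 h2 h3 h4] := H z hz; have z0 : 0 <= complex.Re z by exact: ltW.
  set a := complex.Re z in z0 *.
  (* One half of the exponential supplies the weight [(1 + M / 4 * a) ^- 2]; the other absorbs the
     factor [M * a], which leaves the constant [5 * C + 2 * M * m]. *)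
  have E2 : expR (- (M * a)) = expR (- (M * a / 2)) * expR (- (M * a / 2)).
    by rewrite -expRD; congr expR; field.
  have s1 : expR (- (M * a / 2)) <= ((1 + M / 4 * a) ^+ 2)^-1.
    have := expRN_le (M * a / 2); rewrite !mulr_ge0 ?(ltW M0')// => /(_ isT)/le_trans; apply.
    by rewrite le_eqVlt; apply/orP; left; apply/eqP; congr ((1 + _) ^- 2); field.
  have s2 : expR (- (M * a / 2)) <= 1 by rewrite expR_le1 oppr_le0 !mulr_ge0// ltW.
  have s3 : M * a * expR (- (M * a / 2)) <= 2.
    by have := xe1 (M * a / 2); lra.
  apply: (@le_trans _ _ ((5 * C + 2 * M * m) * expR (- (M * a / 2)))); last first.
    by rewrite ler_wpM2l// addr_ge0 ?mulr_ge0// ltW.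
  have g1 : cabs (cexpt L z * dF z) <= C * expR (- (M * a)).
    rewrite cabsM eL// -/a; apply: le_trans (ler_wpM2l _ h3) _; first by rewrite mulr_ge0 ?expR_ge0.
    rewrite -/a le_eqVlt; apply/orP; left; apply/eqP.
    by rewrite -[RHS]mul1r -(expRxMexpNx_1 (N * a)); ring.
  have g2 : cabs (- ((L%:C)%C * cexpt L z) * F z) <= 2 * M * (expR (- (M * a)) * (m + C * a)).
    have -> : - ((L%:C)%C * cexpt L z) * F z = - ((L%:C)%C * (cexpt L z * F z)) by ring.
    rewrite cabsN (cabsM (L%:C)%C) cabs_real ger0_norm// ler_pM ?cabs_ge0//.
    exact: fb.
  apply: le_trans (le_trans (cabsD _ _) (lerD g2 g1)) _.
  rewrite E2; have e0' := expR_ge0 (- (M * a / 2)).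
  move: s2 s3 e0'; move: (expR (- (M * a / 2))) => s s2 s3 e0'.
  have -> : 2 * M * (s * s * (m + C * a)) + C * (s * s) =
     (2 * M * m * s + 2 * C * (M * a * s) + C * s) * s by ring.
  rewrite ler_wpM2r//.
  have k1 : 2 * M * m * s <= 2 * M * m by rewrite ler_piMr// !mulr_ge0// ltW.
  have k2 : C * (M * a * s) <= C * 2 by rewrite ler_wpM2l.
  have k3 : C * s <= C by rewrite ler_piMr.
  lra.
move=> h; apply: le_trans h _.
(* The summand [2 * M * m], from differentiating [e_L], integrates to [8 * m]; together with the sup
   norm this makes 9. *)
have -> : m + C / M + (5 * C + 2 * M * m) / (M / 4) = 9 * m + 21 * C / M.
  by field; rewrite gt_eqF.
by rewrite lerD2l.
Qed.

End Tame.

(** * The algebra generated by the group and the resolvent *)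

Section Calc.
Context {R : realType} {X : completeNormedModType R[i]}.
Variables (T : R -> X -> X) (D : set X) (A : X -> X).
Hypothesis HT : C0_group T.
Hypothesis HB : bounded_group T.
Hypothesis HG : generator T D (fun x => - A x).
Hypothesis HD : densely_defined D.
Variable Phi : (R[i] -> R[i]) -> X -> X.
Hypothesis HPhi : bounded_alg_hom (@Balg R) (@normB R) Phi.
Hypothesis Hres : inv_plus D A 1 (Phi (rz 1)).

(** A relation, because the same [F] may be built in several ways; that the resulting operators
    agree follows only later, from [calc_bound] applied to a difference with [m = 0]. *)
Inductive calc : (R[i] -> R[i]) -> (X -> X) -> Prop :=
| calc_exp t : calc (cexpt t) (T t)
| calc_res : calc (rz 1) (Phi (rz 1))
| calc_add F G S S' : calc F S -> calc G S' ->
    calc (fun u => F u + G u) (fun x => S x + S' x)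
| calc_mul F G S S' : calc F S -> calc G S' ->
    calc (fun u => F u * G u) (fun x => S (S' x))
| calc_scale c F S : calc F S -> calc (fun u => c * F u) (fun x => c *: S x).

Lemma calc_blin F S : calc F S -> bounded_linear S.
Proof.
elim=> [t||F' G S1 S2 _ h _ h'|F' G S1 S2 _ h _ h'|c F' S1 _ h].
- by have [h _] := HT.
- by case: Hres.
- exact: blin_add.
- exact: blin_comp.
- exact: blin_scale.
Qed.

Lemma calc_tame F S : calc F S -> tame F.
Proof.
elim=> [t||F' G S1 S2 _ h _ h'|F' G S1 S2 _ h _ h'|c F' S1 _ h].
- exact: tame_cexpt.
- exact: tame_rz1.
- exact: tameD.
- exact: tameM.
- by apply: tameM => //; exact: tame_cst.
Qed.

Lemma calc_comm F S t x : calc F S -> S (T t x) = T t (S x).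
Proof.
have [hb [_ [hadd _]]] := HT.
move=> hc; elim: hc t x => {F S} [s||F G S S' _ h _ h'|F G S S' _ h _ h'|c F S _ h] t x.
- by rewrite -!hadd addrC.
- by rewrite (group_resolvent_comm _ _ _ HT HG _ _ _ _ Hres).
- by rewrite h h' (blinD _ (hb t)).
- by rewrite h' h.
- by rewrite h (blinZ _ (hb t)).
Qed.

(** [F] may grow exponentially in [Re z], so [Phi] reaches it only after damping by [e_L]; the group
    undoes the damping afterwards. *)
Lemma calc_Phi F S : calc F S -> exists2 N : R, 0 <= N & forall L, N <= L ->
  nice (fun u => cexpt L u * F u) /\
  forall x, Phi (fun u => cexpt L u * F u) x = T L (S x).
Proof.
have [hb [_ [hadd _]]] := HT.
have PC t x : 0 <= t -> Phi (cexpt t) x = T t x.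
  exact: (Phi_cexpt _ _ _ HT HB HG HD _ HPhi Hres).
elim=> {F S} [s||F G S S' hS [N N0 h] hS' [N' N0' h']|F G S S' hS [N N0 h] hS' [N' N0' h']|c F S _ [N N0 h]].
- exists `|s| => // L hL.
  have sL : 0 <= L + s by rewrite -lerBlDr sub0r (le_trans _ hL)// -normrN ler_norm.
  have -> : (fun u => cexpt L u * cexpt s u) = cexpt (L + s).
    by apply: funext => u; rewrite cexptD.
  by split; [exact: nice_cexpt|move=> x; rewrite PC// hadd].
- exists 0 => // L L0; have n1 := nice_cexpt _ L0; split.
    exact: niceM n1 nice_rz1.
  by move=> x; rewrite (PhiM _ HPhi _ _ _ n1 nice_rz1) PC.
- exists (N + N'); first exact: addr_ge0.
  move=> L hL.
  have [|n1 e1] := h L; first by rewrite (le_trans _ hL)// lerDl.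
  have [|n2 e2] := h' L; first by rewrite (le_trans _ hL)// lerDr.
  have -> : (fun u => cexpt L u * (F u + G u)) =
    (fun u => cexpt L u * F u + cexpt L u * G u) by apply: funext => u; rewrite mulrDr.
  split; first exact: niceD.
  by move=> x; rewrite (PhiD _ HPhi _ _ _ n1 n2) e1 e2 (blinD _ (hb L)).
- exists (N + N'); first exact: addr_ge0.
  (* The damping is shared: [e_L = e_N e_{L - N}], one factor for [F] and one for [G]. Moving
     [T (L - N)] past [S] is where [calc_comm] enters. *)
  move=> L hL; have [n1 e1] := h N (lexx _).
  have hL' : N' <= L - N by rewrite lerBrDl.
  have [n2 e2] := h' (L - N) hL'.
  have -> : (fun u => cexpt L u * (F u * G u)) =
    (fun u => cexpt N u * F u * (cexpt (L - N) u * G u)).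
    apply: funext => u; have -> : cexpt L u = cexpt N u * cexpt (L - N) u.
      by rewrite -cexptD addrC subrK.
    by rewrite mulrACA.
  split; first exact: niceM.
  move=> x; rewrite (PhiM _ HPhi _ _ _ n1 n2) e1 e2 (calc_comm _ _ _ _ hS) -hadd.
  by rewrite addrC subrK.
- exists N => // L hL; have [n1 e1] := h L hL.
  have -> : (fun u => cexpt L u * (c * F u)) = (fun u => c * (cexpt L u * F u)).
    by apply: funext => u; rewrite mulrCA.
  split; first exact: niceZ.
  by move=> x; rewrite (PhiZ _ HPhi _ _ _ n1) e1 (blinZ _ (hb L)).
Qed.

Lemma calc_bound : exists2 C : R, 0 <= C & forall F S (m : R), calc F S -> 0 <= m ->
  (forall b, cabs (F (0 +i* b)%C) <= m) -> forall x, rn (S x) <= C * m * rn x.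
Proof.
have [C C0 hC] := Phi_bound _ HPhi; have [K K0 hK] := group_bound _ HB.
have [hb [hT0 [hadd _]]] := HT.
exists (9 * (K * C)); first by rewrite !mulr_ge0.
move=> F S m hc m0 hm x; apply/ler_addgt0Pr => e e0.
have q1 : 0 < K * C * rn x + 1 by rewrite ltr_wpDl// !mulr_ge0// rn_ge0.
(* [L] depends on [F], [x] and the tolerance, but the constant [9 * (K * C)] does not. The tolerance
   is scaled so that after multiplication by [K * C * rn x] it is at most [e]. *)
have [L0 hL0] := tame_normB _ _ _ (calc_tame _ _ hc) m0 (divr_gt0 e0 q1) hm.
have [N N0 hN] := calc_Phi _ _ hc.
pose L := Num.max L0 N.
have [|hn hP] := hN L; first by rewrite /L le_max lexx orbT.
have LL0 : L0 <= L by rewrite /L le_max lexx.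
have hB := hL0 L LL0.
have -> : S x = T (- L) (T L (S x)) by rewrite -hadd addNr hT0.
rewrite -hP; apply: le_trans (hK _ _) _.
apply: le_trans (ler_wpM2l K0 (hC _ (nice_Balg _ hn) x)) _.
apply: le_trans (ler_wpM2l K0 (ler_wpM2r (rn_ge0 x) (ler_wpM2l C0 hB))) _.
have -> : K * (C * (9 * m + e / (K * C * rn x + 1)) * rn x) =
  9 * (K * C) * m * rn x + (K * C * rn x) / (K * C * rn x + 1) * e by ring.
by rewrite lerD2l ler_piMl ?(ltW e0)// ler_pdivrMr// mul1r lerDl ler01.
Qed.

End Calc.

(** * Continuous functions on the line *)

Section Cousin.
Context {R : realType}.
Implicit Types (a b x y u v : R).

(** Cousin's lemma, by continuous induction: the supremum of the points reachable from [a] is itself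
    reachable, and could be passed if it were less than [b]. It serves as the compactness argument
    and, later, to chain local increments. *)
Lemma cousin (P : R -> R -> Prop) a b : a <= b ->
  (forall x y, a <= x -> x <= y -> y <= b -> P a x -> P x y -> P a y) ->
  (forall x, a <= x -> x <= b -> exists2 d : R, 0 < d &
     forall u v, a <= u -> u <= x -> x <= v -> v <= b -> x - d < u -> v < x + d -> P u v) ->
  P a b.
Proof.
move=> ab cat loc.
pose S := [set x | [/\ a <= x, x <= b & P a x]].
have Sa : S a.
  split=> //; have [d d0 h] := loc a (lexx _) ab.
  by apply: h => //; rewrite ?ltrBlDr ltrDl.
have hS : has_sup S by split; [exists a|exists b => x []].
have sa : a <= sup S by apply: ub_le_sup => //; exact: hS.2.
have sb : sup S <= b by apply: ge_sup; [exists a|move=> x []].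
have [d d0 h] := loc _ sa sb.
have [x [ax xb Px] hx] := sup_adherent d0 hS.
have xs : x <= sup S by apply: ub_le_sup; [exact: hS.2|].
have Ps v : sup S <= v -> v <= b -> v < sup S + d -> P a v.
  by move=> sv vb vd; apply: (cat x) => //; [exact: le_trans sv|exact: h].
have [sb'|] := ltP (sup S) b; last first.
  by move=> bs; apply: Ps => //; rewrite (le_lt_trans bs)// ltrDl.
pose v := Num.min b (sup S + d / 2).
have sv : sup S < v by rewrite lt_min sb' ltrDl divr_gt0.
have vb : v <= b by rewrite ge_min lexx.
have : S v.
  split=> //; first exact: le_trans (ltW sv).
  apply: Ps => //; first exact: ltW.
  by rewrite gt_min; apply/orP; right; rewrite ltrD2l ltr_pdivrMr// ltr_pMr// ltr1n.
move=> Sv; have : v <= sup S by apply: ub_le_sup => //; exact: hS.2.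
by rewrite leNgt sv.
Qed.

Definition econt (G : R -> R[i]) := forall x (e : R), 0 < e -> exists2 d : R, 0 < d &
  forall y, `|y - x| < d -> cabs (G y - G x) <= e.

Lemma econtP (G : R -> R[i]) : econt G <-> continuous (G : R -> R[i]^o).
Proof.
split=> h x.
  apply/cvgrPdist_le => eps eps0.
  have /complex_realP[e E] : eps \is Num.real by exact: gtr0_real.
  have e0 : 0 < e by move: eps0; rewrite E ltcR.
  have [d d0 hd] := h x e e0.
  apply/nbhs_ballP; exists d => // y; rewrite /ball_ /= distrC => /hd hy.
  by rewrite E [`|_|]cabsE lecR cabsB.
move=> e e0; have /cvgrPdist_le/(_ (e%:C)%C) := h x.
rewrite ltcR => /(_ e0) /nbhs_ballP[d /= d0 hd]; exists d => // y hy.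
have : ball x d y by rewrite -ball_normE /ball_ /= distrC.
by move/hd; rewrite [`|_|]cabsE lecR cabsB.
Qed.

Lemma econt_unif (G : R -> R[i]) a b (e : R) : econt G -> a <= b -> 0 < e ->
  exists2 d : R, 0 < d & forall s t, a <= s <= b -> `|t - s| < d -> cabs (G t - G s) <= e.
Proof.
move=> hG ab e0.
pose P u v := exists2 d : R, 0 < d &
  forall s t, u <= s <= v -> `|t - s| < d -> cabs (G t - G s) <= e.
apply: (@cousin P) => // [x y _ xy _ [d d0 h] [d' d0' h']|x _ _].
  exists (Num.min d d'); first by rewrite lt_min d0.
  move=> s t /andP[sa sy]; rewrite lt_min => /andP[h1 h2].
  have [sx|sx] := leP s x; first by apply: h => //; rewrite sa.
  by apply: h' => //; rewrite (ltW sx).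
have [d d0 hd] := hG x _ (divr_gt0 e0 (ltr0Sn _ 1)).
have d2 : 0 < d / 2 by rewrite divr_gt0.
exists (d / 2) => // u v _ ux xv _ du dv; exists (d / 2) => // s t /andP[us sv] ts.
have sx : `|s - x| < d / 2 by rewrite ltr_norml; apply/andP; split; lra.
have h1 := hd s; have h2 := hd t.
have -> : G t - G s = (G t - G x) + (G x - G s) by ring.
rewrite (le_trans (cabsD _ _))// (splitr e) lerD//.
  apply: h2; rewrite (splitr d) (le_lt_trans _ (ltrD ts sx))//.
  by rewrite (le_trans _ (ler_normD _ _))// addrA subrK.
by rewrite cabsB; apply: h1; rewrite (lt_le_trans sx)// ler_pdivrMr// ler_pMr// ler1n.
Qed.

Lemma econt_bounded (G : R -> R[i]) a b : econt G -> a <= b ->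
  exists2 M : R, 0 <= M & forall s, a <= s <= b -> cabs (G s) <= M.
Proof.
move=> hG ab.
pose P u v := exists2 M : R, 0 <= M & forall s, u <= s <= v -> cabs (G s) <= M.
apply: (@cousin P) => // [x y _ xy _ [M M0 h] [M' M0' h']|x _ _].
  exists (M + M'); first exact: addr_ge0.
  move=> s /andP[sa sy]; have [sx|sx] := leP s x.
    by rewrite (le_trans (h s _))// ?sa// lerDl.
  by rewrite (le_trans (h' s _))// ?(ltW sx)// lerDr.
have [d d0 hd] := hG x 1 ltr01.
exists d => // u v _ ux xv _ du dv; exists (cabs (G x) + 1).
  by rewrite addr_ge0 ?cabs_ge0.
move=> s /andP[us sv].
have sx : `|s - x| < d by rewrite ltr_norml; apply/andP; split; lra.
have := cabsD (G x) (G s - G x); rewrite addrC subrK => /le_trans; apply.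
by rewrite lerD2l hd.
Qed.

Lemma econtM G G' : econt G -> econt G' -> econt (fun x => G x * G' x).
Proof.
move=> h h' x e e0; pose c := cabs (G x) + cabs (G' x) + 1.
have c0 : 0 < c by rewrite ltr_wpDl// addr_ge0 ?cabs_ge0.
pose e1 := Num.min 1 (e / c).
have e10 : 0 < e1 by rewrite lt_min ltr01 divr_gt0.
have [d d0 hd] := h x _ e10; have [d' d0' hd'] := h' x _ e10.
exists (Num.min d d'); first by rewrite lt_min d0.
move=> y; rewrite lt_min => /andP[/hd h1 /hd' h2].
have -> : G y * G' y - G x * G' x = (G y - G x) * (G' y - G' x) +
   ((G y - G x) * G' x + G x * (G' y - G' x)) by ring.
apply: (@le_trans _ _ (e1 * c)); last first.
  by rewrite -ler_pdivlMr// /e1 ge_min lexx orbT.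
apply: le_trans (cabsD _ _) _; apply: le_trans (lerD (lexx _) (cabsD _ _)) _.
rewrite !cabsM /c.
have e11 : e1 <= 1 by rewrite ge_min lexx.
have k1 : cabs (G y - G x) * cabs (G' y - G' x) <= e1 * 1.
  by rewrite ler_pM ?cabs_ge0// (le_trans h2).
have k2 : cabs (G y - G x) * cabs (G' x) <= e1 * cabs (G' x) by rewrite ler_wpM2r ?cabs_ge0.
have k3 : cabs (G x) * cabs (G' y - G' x) <= cabs (G x) * e1 by rewrite ler_wpM2l ?cabs_ge0.
lra.
Qed.

Lemma econt_lip G (L : R) : (forall x y, cabs (G y - G x) <= L * `|y - x|) -> econt G.
Proof.
move=> h x e e0; have L1 : 0 < `|L| + 1 by rewrite ltr_wpDl.
exists (e / (`|L| + 1)); first by rewrite divr_gt0.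
move=> y; rewrite ltr_pdivlMr// => /ltW hy; rewrite (le_trans (h x y))//.
by rewrite (le_trans _ hy)// mulrC ler_wpM2l// (le_trans (ler_norm L))// lerDl ler01.
Qed.

End Cousin.

(** * Density in C0(iR) *)

Section VallePoussin.
Context {R : realType}.
Implicit Types (x y t : R) (N m : nat).

Definition wexp x : R[i] := cexp (0 +i* x)%C.

Lemma wexpD x y : wexp (x + y) = wexp x * wexp y.
Proof. by rewrite /wexp -cexpD; congr cexp; simpc. Qed.

Lemma wexp0 : wexp 0 = 1.
Proof. by rewrite /wexp cexp0. Qed.

Lemma wexpE x : wexp x = (cos x +i* sin x)%C.
Proof. by rewrite /wexp /cexp /= expR0 !mul1r. Qed.

Lemma wexpX x n : wexp x ^+ n = wexp (n%:R * x).
Proof.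
elim: n => [|n IH]; first by rewrite mul0r wexp0.
by rewrite exprS IH -wexpD -natr1 mulrDl mul1r addrC.
Qed.

Lemma wexpN x : wexp (- x) * wexp x = 1.
Proof. by rewrite -wexpD addNr wexp0. Qed.

Lemma cos_wexp x : ((cos x)%:C)%C = 2^-1 * (wexp x + wexp (- x)).
Proof.
rewrite !wexpE cosN sinN; apply: (@mulfI _ 2); first by rewrite pnatr_eq0.
rewrite mulrA divff ?pnatr_eq0// mul1r mulr_natl mulr2n.
by apply/eqP; rewrite eq_complex /= addr0 subrr !eqxx.
Qed.

(** A cosine equal to 1 would force [sin (x / 2) = 0], whereas [x / 2 = k pi / m] lies strictly
    between 0 and [pi]. *)
Lemma wexp_root m k : (0 < k < m)%N -> wexp (k%:R * (pi *+ 2 / m%:R)) != 1.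
Proof.
move=> /andP[k0 km]; apply/eqP; rewrite wexpE => -[+ _].
have m0 : 0 < m%:R :> R by rewrite ltr0n (leq_trans _ km).
set x := _ * _ => hc; have := cos_sub1 x; rewrite hc subrr => /esym/eqP.
rewrite mulrn_eq0 /= sqrf_eq0; apply/negP; apply: lt0r_neq0; apply: sin_gt0_pi.
have -> : x / 2 = k%:R / m%:R * pi by rewrite /x; field; rewrite gt_eqF.
apply/andP; split; first by rewrite mulr_gt0 ?pi_gt0// divr_gt0// ltr0n.
rewrite gtr_pMl ?pi_gt0//.
by rewrite ltr_pdivrMr// mul1r ltr_nat.
Qed.

Lemma geom_root (z : R[i]) m : z ^+ m = 1 -> z != 1 -> \sum_(k < m) z ^+ k = 0.
Proof.
move=> zm z1; have := subrX1 z m; rewrite zm subrr => /esym/eqP.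
by rewrite mulf_eq0 subr_eq0 (negbTE z1) /= => /eqP.
Qed.

(** The unnormalised de la Vallee Poussin kernel [cos (x / 2) ^ (2 N)]: a nonnegative trigonometric
    polynomial of degree [N], equal to 1 at 0 and concentrating there modulo [2 pi]. *)
Definition vpk N x : R := ((1 + cos x) / 2) ^+ N.

Lemma vpk_ge0 N x : 0 <= vpk N x.
Proof. by rewrite exprn_ge0// divr_ge0// -lerBlDl sub0r cos_geN1. Qed.

(** Expand [(1 + cos x) / 2 = e^{-i x} (1 + e^{i x})^2 / 4] by the binomial formula. *)
Lemma vpkE N x : ((vpk N x)%:C)%C =
  \sum_(j < N.*2.+1) (4 ^- N * ('C(N.*2, j))%:R) * (wexp (- x) ^+ N * wexp x ^+ j).
Proof.
have E : (((1 + cos x) / 2)%:C)%C = 4^-1 * wexp (- x) * (1 + wexp x) ^+ 2.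
  rewrite rmorphM rmorphD /= cos_wexp fmorphV rmorph_nat rmorph1.
  have e := wexpN x.
  have -> : 4^-1 * wexp (- x) * (1 + wexp x) ^+ 2 = 4^-1 *
    (wexp (- x) + 2 * (wexp (- x) * wexp x) + (wexp (- x) * wexp x) * wexp x) by ring.
  by rewrite e; field.
rewrite /vpk rmorphXn /= E exprMn -exprM mul2n exprDn exprMn mulr_sumr exprVn.
apply: eq_bigr => j _; rewrite expr1n mul1r -mulr_natr; ring.
Qed.

(** Equispaced quadrature with [m > N] nodes is exact on frequencies from [- N] to [N]: nonzero
    frequencies give vanishing geometric sums of roots of unity, and only the constant coefficient
    [j = N] survives. *)
Lemma vpk_sumE N m t : (N < m)%N ->
  ((\sum_(k < m) vpk N (t + k%:R * (pi *+ 2 / m%:R)))%:C)%C =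
  4 ^- N * ('C(N.*2, N))%:R * m%:R :> R[i].
Proof.
move=> Nm; set al := pi *+ 2 / m%:R.
have m0 : m%:R != 0 :> R by rewrite pnatr_eq0 -lt0n (leq_trans _ Nm).
have zm : wexp al ^+ m = 1.
  rewrite wexpX /al mulrCA divff// mulr1 wexpE.
  by rewrite cos2pi sin2pi.
have Ek (k j : nat) : wexp (- (t + k%:R * al)) ^+ N * wexp (t + k%:R * al) ^+ j =
    wexp (- t) ^+ N * wexp t ^+ j * (wexp al ^+ (m - N + j)) ^+ k.
  rewrite opprD !wexpD !exprMn.
  (* The exponent [- N] becomes [m - N], since [wexp al] is an [m]-th root of unity. *)
  have -> : wexp (- (k%:R * al)) ^+ N = wexp al ^+ (m - N) ^+ k.
    have h : wexp al ^+ (k * N) != 0.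
      apply: expf_neq0; apply/eqP => h; have := wexpN al; rewrite h mulr0 => /esym/eqP.
      by rewrite oner_eq0.
    apply: (mulIf h).
    have -> : wexp al ^+ (k * N) = wexp (k%:R * al) ^+ N by rewrite -wexpX exprM.
    rewrite -exprMn wexpN expr1n -wexpX -!exprM -exprD.
    have -> : ((m - N) * k + k * N = m * k)%N.
      by rewrite [(k * N)%N]mulnC -mulnDl subnK// ltnW.
    by rewrite exprM zm expr1n.
  rewrite -wexpX exprD exprMn.
  have -> : (wexp al ^+ k) ^+ j = (wexp al ^+ j) ^+ k by rewrite -!exprM mulnC.
  by rewrite mulrACA mulrA.
rewrite rmorph_sum /=.
under eq_bigr do rewrite vpkE.
rewrite exchange_big /=.
have NN : (N < N.*2.+1)%N by rewrite ltnS -addnn leq_addr.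
rewrite (bigD1 (Ordinal NN)) //= [X in _ + X]big1 ?addr0; last first.
  move=> j jN; rewrite -mulr_sumr.
  under eq_bigr do rewrite Ek.
  rewrite -mulr_sumr geom_root ?mulr0//.
    by rewrite -exprM mulnC exprM zm expr1n.
  have {}jN : (j : nat) != N by apply: contra jN => /eqP h; apply/eqP/val_inj.
  have jb : (j <= N.*2)%N by rewrite -ltnS.
  (* The exponent [m - N + j] is not a multiple of [m], because [0 < |j - N| <= N < m]. *)
  have [hl|hl] := ltnP j N.
    rewrite wexpX; apply: wexp_root; rewrite addn_gt0 subn_gt0 Nm /=.
    by rewrite -[X in (_ < X)%N](subnK (ltnW Nm)) ltn_add2l.
  have {}hl : (N < j)%N by rewrite ltn_neqAle eq_sym jN.
  have -> : (m - N + j = m + (j - N))%N.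
    by rewrite -{2}(subnK (ltnW Nm)) -addnA subnKC// ltnW.
  rewrite exprD zm mul1r wexpX; apply: wexp_root; rewrite subn_gt0 hl /=.
  by rewrite (leq_ltn_trans _ Nm)// leq_subLR addnn.
under eq_bigr do rewrite Ek.
rewrite -mulr_sumr -mulr_sumr; congr (_ * _).
rewrite -exprMn wexpN expr1n mul1r subnK ?(ltnW Nm)// zm.
under eq_bigr do rewrite expr1n.
by rewrite sumr_const card_ord.
Qed.

Lemma vpk_sum_const N m t t' : (N < m)%N ->
  \sum_(k < m) vpk N (t + k%:R * (pi *+ 2 / m%:R)) =
  \sum_(k < m) vpk N (t' + k%:R * (pi *+ 2 / m%:R)).
Proof. by move=> Nm; apply: (@complexI R); rewrite !vpk_sumE. Qed.

(** The sum is independent of [t], and at [t = 0] the node [k = 0] already contributes 1. *)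
Lemma vpk_sum_ge1 N m t : (N < m)%N ->
  1 <= \sum_(k < m) vpk N (t + k%:R * (pi *+ 2 / m%:R)).
Proof.
move=> Nm; rewrite (@vpk_sum_const _ _ _ 0)//.
have m0 : (0 < m)%N by exact: leq_trans Nm.
rewrite (bigD1 (Ordinal m0))//= mul0r addr0 /vpk cos0.
rewrite -[1 + 1]/(2 : R) divff ?pnatr_eq0// expr1n lerDl.
by apply: sumr_ge0 => k _; exact: vpk_ge0.
Qed.

(** The cosine decreases on [[0, pi]]; larger arguments are reflected to [2 pi - |x|]. *)
Lemma vpk_far N x d : 0 < d -> d <= pi -> d <= `|x| -> `|x| <= pi *+ 2 - d ->
  vpk N x <= vpk N d.
Proof.
move=> d0 dp dx xd; rewrite /vpk; apply: lerXn2r; rewrite ?nnegrE.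
- by rewrite divr_ge0// -lerBlDl sub0r cos_geN1.
- by rewrite divr_ge0// -lerBlDl sub0r cos_geN1.
rewrite ler_pM2r ?invr_gt0// lerD2l -(cos_norm x).
have cosle (y : R) : d <= y <= pi -> cos y <= cos d.
  move=> /andP[dy yp]; rewrite leNgt ltr_cos ?in_itv /= ?(ltW d0)//.
    by rewrite -leNgt.
  by rewrite yp (le_trans (ltW d0)).
have [xp|xp] := leP `|x| pi; first by rewrite cosle// dx.
have -> : cos `|x| = cos (pi *+ 2 - `|x|).
  by rewrite -(cosN (pi *+ 2 - _)) opprB -(cosD2pi (`|x| - _)) subrK.
by rewrite cosle//; apply/andP; split; move: xd xp; rewrite mulr2n; lra.
Qed.

(** The factor [N.+1] counts the nodes of the kernel sum. With [s = 1 - r], a Bernoulli-type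
    induction gives [r^k k s <= 1]; taking [N = 2 k] squares this, and [1 / k^2] beats
    [2 k + 1 <= 3 k]. *)
Lemma expn_small (r : R) (e : R) : 0 <= r < 1 -> 0 < e ->
  exists N : nat, N.+1%:R * r ^+ N <= e.
Proof.
move=> /andP[r0 r1] e0; pose s := 1 - r.
have s0 : 0 < s by rewrite subr_gt0.
have B (n : nat) : r ^+ n * (1 + n%:R * s) <= 1.
  elim: n => [|n IH]; first by rewrite expr0 mul0r addr0 mulr1.
  apply: le_trans IH; rewrite exprSr -mulrA ler_wpM2l ?exprn_ge0//.
  rewrite -natr1 -subr_ge0.
  have -> : 1 + n%:R * s - r * (1 + (n%:R + 1) * s) = (n%:R + 1) * s ^+ 2 by rewrite /s; ring.
  by rewrite mulr_ge0 ?sqr_ge0// addr_ge0.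
pose k := (Num.truncn (3 / (s ^+ 2 * e))).+1.
have hk : 3 / (s ^+ 2 * e) < k%:R by rewrite /k truncnS_gt.
have p0 : 0 < s ^+ 2 * e by rewrite mulr_gt0// exprn_gt0.
have k1 : 1 <= k%:R :> R by rewrite ler1n.
clearbody k.
move: hk; rewrite ltr_pdivrMr// => hk.
exists k.*2; rewrite -addnn exprD.
have := B k; have rk : 0 <= r ^+ k by rewrite exprn_ge0.
have -> : (k + k).+1%:R = k%:R + k%:R + 1 :> R by rewrite -natr1 natrD.
move: rk hk k1; move: (r ^+ k) (k%:R) => q n q0 hk n1 hB.
have hq : q * (n * s) <= 1.
  by apply: le_trans hB; rewrite ler_wpM2l// lerDr ler01.
have n0 : 0 < n by rewrite (lt_le_trans ltr01).
have q1 : (q * (n * s)) ^+ 2 <= 1.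
  by rewrite exprn_ile1//; apply: mulr_ge0 => //; apply: mulr_ge0; exact: ltW.
have -> : (n + n + 1) * (q * q) = (n + n + 1) * (q * (n * s)) ^+ 2 / (n * s) ^+ 2.
  by field; rewrite !gt_eqF.
rewrite ler_pdivrMr ?exprn_gt0 ?mulr_gt0//.
apply: (@le_trans _ _ (n * 3)).
  have : (n + n + 1) * (q * (n * s)) ^+ 2 <= (n + n + 1) * 1.
    by rewrite ler_wpM2l//; lra.
  move=> h; apply: le_trans h _; lra.
have -> : e * (n * s) ^+ 2 = n * (n * (s ^+ 2 * e)) by ring.
by rewrite ler_wpM2l//; exact: ltW.
Qed.

End VallePoussin.

Lemma clamp_lip {R : realType} (p r : R) :
  `|Num.max 0 (Num.min 1 p) - Num.max 0 (Num.min 1 r)| <= `|p - r|.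
Proof.
have clampE (x : R) : [\/ 1 <= x /\ Num.max 0 (Num.min 1 x) = 1,
    0 <= x <= 1 /\ Num.max 0 (Num.min 1 x) = x | x <= 0 /\ Num.max 0 (Num.min 1 x) = 0].
  have [x1|x1] := leP 1 x; first by constructor 1; rewrite max_r.
  have [x0|x0] := leP 0 x; first by constructor 2; rewrite (ltW x1).
  by constructor 3; split=> //; exact: ltW.
have : - `|p - r| <= p - r <= `|p - r| by rewrite -ler_norml.
rewrite ler_norml; have := normr_ge0 (p - r); move: `|p - r| => n n0 /andP[h1 h2].
by have [[? ->]|[/andP[? ?] ->]|[? ->]] := clampE p;
   have [[? ->]|[/andP[? ?] ->]|[? ->]] := clampE r; apply/andP; split; lra.
Qed.

Section Density.
Context {R : realType}.
Variable Q : (R -> R[i]) -> Prop.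
Hypothesis QD : forall f g, Q f -> Q g -> Q (fun b => f b + g b).
Hypothesis QM : forall f g, Q f -> Q g -> Q (fun b => f b * g b).
Hypothesis QZ : forall c f, Q f -> Q (fun b => c * f b).
Hypothesis Qe : forall t, Q (fun b => cexpt t (0 +i* b)%C).
Hypothesis Qr : Q (fun b => rz 1 (0 +i* b)%C).

Lemma Q_cst c : Q (fun=> c).
Proof.
have -> : (fun=> c) = (fun b => c * cexpt 0 (0 +i* b)%C) :> (R -> R[i]).
  by apply: funext => b; rewrite cexpt0 mulr1.
exact: QZ.
Qed.

Lemma Q_sum n (F : nat -> R -> R[i]) : (forall k, Q (F k)) ->
  Q (fun b => \sum_(k < n) F k b).
Proof.
move=> h; elim: n => [|n IH].
  have -> : (fun b => \sum_(k < 0) F k b) = (fun=> 0).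
    by apply: funext => b; rewrite big_ord0.
  exact: Q_cst.
have -> : (fun b => \sum_(k < n.+1) F k b) = (fun b => \sum_(k < n) F k b + F n b).
  by apply: funext => b; rewrite big_ord_recr.
exact: QD.
Qed.

Lemma Q_pow n (f : R -> R[i]) : Q f -> Q (fun b => f b ^+ n).
Proof.
move=> h; elim: n => [|n IH]; first exact: Q_cst.
have -> : (fun b => f b ^+ n.+1) = (fun b => f b * f b ^+ n).
  by apply: funext => b; rewrite exprS.
exact: QM.
Qed.

Lemma Q_vpk N (om t : R) : Q (fun b => ((vpk N (t - om * b))%:C)%C).
Proof.
have -> : (fun b => ((vpk N (t - om * b))%:C)%C) = (fun b => (2^-1 +
    (4^-1 * wexp t * cexpt om (0 +i* b)%C +
     4^-1 * wexp (- t) * cexpt (- om) (0 +i* b)%C)) ^+ N) :> (R -> R[i]).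
  apply: funext => b; rewrite /vpk rmorphXn /=; congr (_ ^+ N).
  have e1 s : cexpt s (0 +i* b)%C = wexp (- (s * b)).
    rewrite /cexpt /wexp; congr cexp; apply/eqP; rewrite eq_complex /=.
    by rewrite !mulr0 !mul0r subrr oppr0 addr0 !eqxx.
  rewrite !e1 mulNr opprK rmorphM rmorphD /= cos_wexp fmorphV rmorph_nat rmorph1.
  by rewrite opprB !wexpD; field.
apply: Q_pow; apply: QD; first exact: Q_cst.
by apply: QD; apply: QZ; exact: Qe.
Qed.

(** [q] is a convex combination of values of [G] at equispaced nodes, with kernel weights of period
    [2 l]. Hence the bound [M] persists on the whole line, even where [q] no longer approximates
    [G]. *)
Lemma trig_approx (G : R -> R[i]) (a l M e : R) : econt G ->
  (forall b, a <= `|b| -> G b = 0) -> (forall b, cabs (G b) <= M) ->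
  0 < l -> a *+ 2 <= l -> 0 < e ->
  exists2 q, Q q & (forall b, cabs (q b) <= M) /\
    forall b, `|b| <= l -> cabs (q b - G b) <= e.
Proof.
move=> cG Ga GM l0 al e0.
have M0 : 0 <= M by exact: le_trans (cabs_ge0 _) (GM 0).
have [del del0 hdel] : exists2 d : R, 0 < d &
    forall s t, - l <= s <= l -> `|t - s| < d -> cabs (G t - G s) <= e / 2.
  by apply: econt_unif => //; [rewrite -subr_ge0 opprK addr_ge0// ltW|rewrite divr_gt0].
pose d := Num.min del (l / 2).
have d0 : 0 < d by rewrite lt_min del0 divr_gt0.
have dl : d <= l / 2 by rewrite ge_min lexx orbT.
have dd : d <= del by rewrite ge_min lexx.
have [om om0 oml] : exists2 om : R, 0 < om & om * l = pi.
  by exists (pi / l); [rewrite divr_gt0// pi_gt0|rewrite divfK// gt_eqF].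
pose rho := (1 + cos (om * d)) / 2.
have od0 : 0 < om * d by rewrite mulr_gt0.
have odp : om * d <= pi.
  by rewrite -oml ler_wpM2l ?(ltW om0)// (le_trans dl)// ler_pdivrMr// ler_pMr// ler1n.
have rho01 : 0 <= rho < 1.
  apply/andP; split; first by rewrite divr_ge0// -lerBlDl sub0r cos_geN1.
  rewrite /rho ltr_pdivrMr// mul1r -[ltRHS]/(1 + 1) ltrD2l -cos0.
  by rewrite ltr_cos// in_itv /= ?lexx ?pi_ge0 ?(ltW od0).
have [N hN] := expn_small rho (e / 2 / (M *+ 2 + 1)) rho01
  (divr_gt0 (divr_gt0 e0 (ltr0Sn _ _)) (ltr_wpDl (mulrn_wge0 2 M0) ltr01)).
pose m := N.+1; pose alp : R := pi *+ 2 / m%:R.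
have m0 : 0 < m%:R :> R by rewrite ltr0n.
(* Chosen so that [th b + k alp] is the signed distance from [b] to the node [x k], scaled to period
   [2 pi]. *)
pose th b := - (om * l) - om * b.
pose x (k : nat) := - l + k%:R * (l *+ 2 / m%:R).
have thx b k : th b + k%:R * alp = om * (x k - b).
  by rewrite /th /x /alp -oml -[_ *+ 2]mulr_natl -[l *+ 2]mulr_natl; ring.
pose c := \sum_(k < m) vpk N (0 + k%:R * alp).
have c1 : 1 <= c by exact: vpk_sum_ge1.
have c0 : 0 < c by exact: lt_le_trans ltr01 c1.
have cE b : \sum_(k < m) vpk N (th b + k%:R * alp) = c by exact: vpk_sum_const.
have cV0 : 0 <= c^-1 by rewrite invr_ge0 ltW.
pose q b := \sum_(k < m) (G (x k) * ((c^-1)%:C)%C) * ((vpk N (th b + k%:R * alp))%:C)%C.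
have cs (k : nat) b : cabs (((c^-1)%:C)%C * ((vpk N (th b + k%:R * alp))%:C)%C) =
   c^-1 * vpk N (th b + k%:R * alp).
  by rewrite -rmorphM cabs_real ger0_norm// mulr_ge0// vpk_ge0.
have cabs_sum (F : nat -> R[i]) n : cabs (\sum_(k < n) F k) <= \sum_(k < n) cabs (F k).
  elim: n => [|n IH]; first by rewrite !big_ord0 cabs0.
  by rewrite !big_ord_recr /= (le_trans (cabsD _ _))// lerD2r.
exists q; first (apply: (Q_sum m (fun k b => G (x k) * ((c^-1)%:C)%C * ((vpk N (th b + k%:R * alp))%:C)%C)) => k).
  apply: QZ; have -> : (fun b => ((vpk N (th b + k%:R * alp))%:C)%C) =
     (fun b => ((vpk N ((- (om * l) + k%:R * alp) - om * b))%:C)%C).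
    by apply: funext => b; congr ((vpk N _)%:C)%C; rewrite /th addrAC.
  exact: Q_vpk.
split=> b.
  apply: le_trans (cabs_sum (fun k => (G (x k) * ((c^-1)%:C)%C) * ((vpk N (th b + k%:R * alp))%:C)%C) m) _.
  apply: (@le_trans _ _ (\sum_(k < m) M * (c^-1 * vpk N (th b + k%:R * alp)))).
    apply: ler_sum => k _; rewrite -mulrA cabsM cs ler_wpM2r//.
    by rewrite mulr_ge0// vpk_ge0.
  by rewrite -mulr_sumr -mulr_sumr cE mulVf ?mulr1// gt_eqF.
move=> bl.
have -> : q b - G b = \sum_(k < m) (G (x k) - G b) *
    (((c^-1)%:C)%C * ((vpk N (th b + k%:R * alp))%:C)%C).
  under [RHS]eq_bigr do rewrite mulrBl.
  rewrite sumrB; congr (_ - _); first by apply: eq_bigr => k _; exact/esym/mulrA.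
  rewrite -mulr_sumr -mulr_sumr -rmorph_sum /= cE -rmorphM /= mulVf ?gt_eqF//.
  by rewrite mulr1.
apply: le_trans (cabs_sum (fun k => (G (x k) - G b) *
    (((c^-1)%:C)%C * ((vpk N (th b + k%:R * alp))%:C)%C)) m) _.
(* Nodes close to [b] are charged to the modulus of continuity, with weights of total mass 1; each
   of the others costs at most [M *+ 2 * rho ^+ N], and [N] was chosen so that [m = N + 1] of these
   stay below [e / 2]. *)
apply: (@le_trans _ _ (\sum_(k < m) (e / 2 * (c^-1 * vpk N (th b + k%:R * alp)) +
    M *+ 2 * rho ^+ N))); last first.
  rewrite big_split /= -!mulr_sumr cE mulVf ?gt_eqF// mulr1 sumr_const card_ord.
  rewrite [leRHS]splitr lerD2l -(mulr_natl (rho ^+ N) m).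
  have p0 : 0 < M *+ 2 + 1 by rewrite ltr_wpDl// mulrn_wge0.
  move: hN; rewrite (ler_pdivlMr _ _ p0) -/m => hN'; apply: le_trans hN'.
  rewrite [leLHS]mulrC ler_wpM2l ?lerDl//.
  by rewrite mulr_ge0// exprn_ge0//; case/andP: rho01.
apply: ler_sum => k _; rewrite cabsM cs.
have v0 := vpk_ge0 N (th b + k%:R * alp).
have r0 : 0 <= M *+ 2 * rho ^+ N.
  by rewrite mulr_ge0 ?mulrn_wge0// exprn_ge0//; case/andP: rho01.
have bl' : - l <= b <= l by rewrite -ler_norml.
have xl : - l <= x k <= l.
  have k0 : 0 <= k%:R * (l *+ 2 / m%:R) by rewrite mulr_ge0// divr_ge0// mulrn_wge0// ltW.
  have k1 : k%:R * (l *+ 2 / m%:R) <= l *+ 2.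
    rewrite mulrCA ler_piMr ?mulrn_wge0 ?(ltW l0)// ler_pdivrMr// mul1r ler_nat ltnW//.
  by rewrite /x; apply/andP; split; move: k0 k1; rewrite mulr2n; lra.
have [y1|y1] := ltP `|x k - b| d.
  apply: (@le_trans _ _ (e / 2 * (c^-1 * vpk N (th b + k%:R * alp)))); last by rewrite lerDl.
  rewrite ler_wpM2r ?mulr_ge0//; apply: hdel => //; exact: lt_le_trans dd.
(* Wrap-around: beyond [2 l - d], the points [x k] and [b] sit near opposite ends of the period. As
   [d <= l / 2] and [a <= l / 2], [G] vanishes at both. *)
have [y2|y2] := leP `|x k - b| (l *+ 2 - d); last first.
  have [hx hb] : a <= `|x k| /\ a <= `|b|.
    move: y2 al xl bl' dl; rewrite ltr_normr => /orP y2 al /andP[x1 x2] /andP[b1 b2] dl.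
    by split; rewrite ler_normr; apply/orP; case: y2 => y2; [left|right|right|left]; move: y2 al; rewrite !mulr2n; lra.
  by rewrite !Ga// subrr cabs0 mul0r addr_ge0// !mulr_ge0 ?divr_ge0// ltW.
have vle : vpk N (th b + k%:R * alp) <= rho ^+ N.
  rewrite thx; apply: (vpk_far N _ (om * d)) => //.
    by rewrite normrM (gtr0_norm om0) ler_pM2l.
  rewrite normrM (gtr0_norm om0) -oml -mulrnAr -mulrBr ler_pM2l//.
rewrite (@le_trans _ _ (M *+ 2 * rho ^+ N))//; last by rewrite lerDr !mulr_ge0// ?divr_ge0// ltW.
rewrite ler_pM ?cabs_ge0 ?mulr_ge0//.
  by rewrite (le_trans (cabsD _ _))// cabsN mulr2n lerD.
apply: le_trans vle; rewrite ler_piMl// invf_le1//.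
Qed.

Lemma cabs_rz1_axis_inv (b : R) : b != 0 -> cabs (rz 1 (0 +i* b)%C) <= `|b|^-1.
Proof.
move=> b0; have h : `|b| <= cabs (1 + (0 +i* b)%C : R[i]).
  by apply: le_trans (Im_le_cabs _); rewrite /= add0r.
rewrite /rz cabsV lef_pV2 ?posrE ?normr_gt0// (lt_le_trans _ h)// normr_gt0//.
Qed.

Lemma C0iR_tail (g : R -> R[i]) (e : R) : C0iR g -> 0 < e ->
  exists2 a : R, 0 < a & forall b, a <= `|b| -> cabs (g b) <= e.
Proof.
move=> [_ [h1 h2]] e0.
have eC : (0 < (e%:C)%C :> R[i]) by rewrite ltcR.
have /cvgrPdist_le/(_ _ eC)[a1 [_ k1]] := h1.
have /cvgrPdist_le/(_ _ eC)[a2 [_ k2]] := h2.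
exists (`|a1| + `|a2| + 1); first by rewrite ltr_wpDl// addr_ge0.
move=> b hb; have [b0|b0] := leP 0 b.
  have : a1 < b.
    rewrite (ger0_norm b0) in hb; have := ler_norm a1; have := normr_ge0 a2; lra.
  by move/k1; rewrite sub0r normrN [`|_|]cabsE lecR.
have : b < a2.
  rewrite (ltr0_norm b0) in hb; have := ler_norm (- a2); rewrite normrN; have := normr_ge0 a1; lra.
by move/k2; rewrite sub0r normrN [`|_|]cabsE lecR.
Qed.

(** Cut [g] off by [chi], divide by [r_1], approximate by a trigonometric polynomial [q], and
    multiply by [r_1] again. Beyond the period, boundedness of [q] and decay of [r_1] make the
    product small. *)
Lemma C0iR_density (g : R -> R[i]) (e : R) : C0iR g -> 0 < e ->
  exists2 q, Q q & forall b, cabs (q b - g b) <= e.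
Proof.
move=> hg e0; have e2 : 0 < e / 2 by rewrite divr_gt0.
have [a a0 ha] := C0iR_tail g _ hg e2.
have cg : econt g by apply/econtP; case: hg.
pose chi (b : R) : R := Num.max 0 (Num.min 1 (2 - `|b| / a)).
have chi01 b : 0 <= chi b <= 1.
  by rewrite /chi le_max lexx ge_max ler01 ge_min lexx.
have chi_in b : `|b| <= a -> chi b = 1.
  move=> h; have : `|b| / a <= 1 by rewrite ler_pdivrMr// mul1r.
  move=> h'; rewrite /chi min_l; last by lra.
  by rewrite max_r.
have chi_out b : a *+ 2 <= `|b| -> chi b = 0.
  move=> h; have : 2 <= `|b| / a by rewrite ler_pdivlMr// mulr_natl.
  move=> h'; rewrite /chi max_l// ge_min; apply/orP; right; lra.
have cchi : econt (fun b => ((chi b)%:C)%C).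
  apply: (@econt_lip _ _ a^-1) => x y; rewrite -rmorphB cabs_real /chi.
  have h : `|(2 - `|y| / a) - (2 - `|x| / a)| <= a^-1 * `|y - x|.
    have -> : (2 - `|y| / a) - (2 - `|x| / a) = a^-1 * (`|x| - `|y|) by ring.
    by rewrite normrM gtr0_norm ?invr_gt0// ler_wpM2l ?invr_ge0 ?(ltW a0)// distrC ler_dist_dist.
  by apply: le_trans h; exact: clamp_lip.
have caff : econt (fun b : R => 1 + (0 +i* b)%C : R[i]).
  apply: (@econt_lip R (fun b : R => 1 + (0 +i* b)%C : R[i]) 1) => x y; rewrite mul1r.
  have -> : 1 + (0 +i* y)%C - (1 + (0 +i* x)%C) = (0 +i* (y - x))%C :> R[i].
    by apply/eqP; rewrite eq_complex /=; apply/andP; split; apply/eqP; ring.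
  by rewrite cabs_i.
pose G b := ((chi b)%:C)%C * g b * (1 + (0 +i* b)%C).
have cG : econt G by apply: econtM => //; exact: econtM.
have Gsupp b : a *+ 2 <= `|b| -> G b = 0 by move=> h; rewrite /G chi_out// !mul0r.
have Gr b : G b * rz 1 (0 +i* b)%C = ((chi b)%:C)%C * g b.
  by rewrite /G /rz mulfK//; case: (cabs_rz1_axis b).
have [M M0 hM] := econt_bounded _ (- (a *+ 2)) (a *+ 2) cG
  (ge0_cp (mulrn_wge0 2 (ltW a0))).2.
have GM b : cabs (G b) <= M.
  have [h|h] := leP `|b| (a *+ 2); first by apply: hM; rewrite -ler_norml.
  by rewrite Gsupp ?cabs0// ltW.
(* [M] bounds [G], hence [q], whatever [l] is; so [l] can be chosen after [M], with
   [M / l <= e / 2]. The term [a *+ 4] is twice the radius [a *+ 2] beyond which [G] vanishes. *)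
pose l := a *+ 4 + M / (e / 2).
have l0 : 0 < l by rewrite ltr_wpDr//; [rewrite divr_ge0// ltW|rewrite pmulrn_lgt0].
have al : a *+ 2 *+ 2 <= l by rewrite /l -mulrnA lerDl divr_ge0// ltW.
have [q Qq [qM hq]] := trig_approx G (a *+ 2) l M (e / 2) cG Gsupp GM l0 al e2.
exists (fun b => q b * rz 1 (0 +i* b)%C); first exact: QM.
move=> b; have [r1 _] := cabs_rz1_axis b.
have tail : cabs ((((chi b)%:C)%C - 1) * g b) <= e / 2.
  have [h|h] := leP `|b| a; first by rewrite chi_in// subrr mul0r cabs0 ltW.
  rewrite cabsM -[((_)%:C)%C - 1]/(_ - (1%:C)%C) -rmorphB cabs_real.
  rewrite (le_trans _ (ha b (ltW h)))// ler_piMl ?cabs_ge0//.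
  by have /andP[h1 h2] := chi01 b; rewrite ler_norml; apply/andP; split; lra.
have [bl|bl] := leP `|b| l.
  have -> : q b * rz 1 (0 +i* b)%C - g b = (q b - G b) * rz 1 (0 +i* b)%C +
     (((chi b)%:C)%C - 1) * g b by rewrite mulrBl Gr; ring.
  rewrite (le_trans (cabsD _ _))// [leRHS]splitr lerD// cabsM.
  by rewrite (le_trans _ (hq b bl))// ler_piMr ?cabs_ge0.
have b0 : 0 < `|b| by exact: lt_trans bl.
rewrite (le_trans (cabsD _ _))// cabsN [leRHS]splitr lerD//; last first.
  apply: ha; rewrite (le_trans _ (ltW bl))// (le_trans _ al)// !mulr2n; lra.
rewrite cabsM; apply: le_trans (ler_pM (cabs_ge0 _) (cabs_ge0 _) (qM b) (cabs_rz1_axis_inv _ _)) _.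
  by rewrite -normr_gt0.
rewrite ler_pdivrMr// mulrC -ler_pdivrMr// (le_trans _ (ltW bl))// /l lerDr.
by rewrite mulrn_wge0// ltW.
Qed.

End Density.

(** * From B to C0(iR) *)

Section C0iRFacts.
Context {R : realType}.
Implicit Types (g : R -> R[i]) (z : R[i]).

Lemma C0iR_intro g : econt g ->
  (forall e : R, 0 < e -> exists a : R, forall b, a <= `|b| -> cabs (g b) <= e) ->
  C0iR g.
Proof.
move=> cg h; split; first exact/econtP.
have key (eps : R[i]) : 0 < eps -> exists a : R, forall b, a <= `|b| -> `|0 - (g b : R[i]^o)| <= eps.
  move=> eps0; have /complex_realP[e E] : eps \is Num.real by exact: gtr0_real.
  have e0 : 0 < e by move: eps0; rewrite E ltcR.
  have [a ha] := h e e0; exists a => b /ha.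
  by rewrite sub0r normrN [`|_|]cabsE E lecR.
split; apply/cvgrPdist_le => eps /key[a ha].
  exists a; split; first exact: num_real.
  by move=> b ab; apply: ha; rewrite (le_trans (ltW ab))// ler_norm.
exists (- a); split; first exact: num_real.
by move=> b ab; apply: ha; rewrite -normrN (le_trans _ (ler_norm _))// lerNr ltW.
Qed.

Lemma C0iR_bound g b : C0iR g -> cabs (g b) <= normsup g.
Proof.
move=> hg; apply: ub_le_sup; last by exists b.
have [a a0 ha] := C0iR_tail g _ hg ltr01.
have cg : econt g by apply/econtP; case: hg.
have [M M0 hM] := econt_bounded _ (- a) a cg (ge0_cp (ltW a0)).2.
exists (M + 1) => _ [c _ <-]; have [h|h] := leP `|c| a.
  by rewrite (le_trans (hM c _)) ?lerDl// -ler_norml.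
by rewrite (le_trans (ha c (ltW h)))// lerDr.
Qed.

Lemma normsup_le g (M : R) : (forall b, cabs (g b) <= M) -> normsup g <= M.
Proof.
by move=> h; apply: ge_sup; [exists (cabs (g 0)), 0|move=> _ [b _ <-]].
Qed.

Lemma addz_cabs z (b : R) : `|complex.Re z| <= cabs (z + (0 +i* b)%C).
Proof. by apply: le_trans (Re_le_cabs _); rewrite raddfD /= addr0. Qed.

Lemma addz_neq0 z (b : R) : complex.Re z != 0 -> z + (0 +i* b)%C != 0.
Proof.
by move=> h; rewrite -cabs_gt0 (lt_le_trans _ (addz_cabs _ _))// normr_gt0.
Qed.

Lemma cabs_rz_iR z b : complex.Re z != 0 -> cabs (rz_iR z b) <= `|complex.Re z|^-1.
Proof.
move=> h; rewrite /rz_iR cabsV lef_pV2 ?posrE ?normr_gt0 ?addz_cabs//.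
by rewrite cabs_gt0 addz_neq0.
Qed.

Lemma C0iR_rz z : complex.Re z != 0 -> C0iR (rz_iR z).
Proof.
move=> z0; have p0 : 0 < `|complex.Re z| by rewrite normr_gt0.
apply: C0iR_intro.
  apply: (@econt_lip _ _ (`|complex.Re z|^-1 * `|complex.Re z|^-1)) => x y.
  have -> : rz_iR z y - rz_iR z x = (0 +i* (x - y))%C * (rz_iR z y * rz_iR z x).
    have -> : (0 +i* (x - y))%C = (z + (0 +i* x)%C) - (z + (0 +i* y)%C) :> R[i].
      apply/eqP; rewrite eq_complex; case: (z) => p q /=.
      by apply/andP; split; apply/eqP; ring.
    by rewrite /rz_iR; field; rewrite !addz_neq0.
  rewrite !cabsM cabs_i distrC mulrC ler_wpM2r// ler_pM ?cabs_ge0// cabs_rz_iR//.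
move=> e e0; exists (cabs z + e^-1) => b hb.
have h : e^-1 <= cabs (z + (0 +i* b)%C).
  have := cabs_sub_ge (0 +i* b)%C (- z); rewrite cabsN cabs_i opprK addrC => h.
  rewrite [z + _]addrC; apply: le_trans h; rewrite addrC lerBrDl//.
rewrite /rz_iR cabsV -[leRHS]invrK lef_pV2 ?posrE ?invr_gt0//.
by rewrite cabs_gt0 addz_neq0.
Qed.

End C0iRFacts.

(* [r_z - r_w = (w - z) r_z r_w] propagates [H(r_w) = (w + A)^-1] to all [z]. *)
Lemma resolvent_transfer {R : realType} {X : completeNormedModType R[i]}
    (D : set X) (A : X -> X) (w z : R[i]) (S S' : X -> X) :
  inv_plus D A w S -> bounded_linear S' ->
  (forall x, S' x = S x + (w - z) *: S (S' x)) ->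
  (forall x, S' x = S x + (w - z) *: S' (S x)) -> inv_plus D A z S'.
Proof.
move=> [hS [h1 h2]] hS' e1 e2; split=> //; split=> [x|y Dy].
  have E : S' x = S (x + (w - z) *: S' x) by rewrite (blinD _ hS) (blinZ _ hS).
  have [Dx Ex] := h1 (x + (w - z) *: S' x); rewrite -E in Dx Ex; split=> //.
  have : z *: S' x + A (S' x) = w *: S' x + A (S' x) - (w - z) *: S' x.
    by rewrite addrAC -scalerBl opprB [w + _]addrC subrK.
  by rewrite Ex addrK.
have := e2 (w *: y + A y); rewrite (h2 _ Dy) => E.
have -> : z *: y + A y = w *: y + A y - (w - z) *: y.
  by rewrite addrAC -scalerBl opprB [w + _]addrC subrK.
by rewrite (blinB _ hS') E (blinZ _ hS') addrK.
Qed.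

(** * Extension of the calculus by continuity *)

Section Extension.
Context {R : realType} {X : completeNormedModType R[i]}.
Variables (T : R -> X -> X) (D : set X) (A : X -> X).
Hypothesis HT : C0_group T.
Hypothesis HB : bounded_group T.
Hypothesis HG : generator T D (fun x => - A x).
Hypothesis HD : densely_defined D.
Variable Phi : (R[i] -> R[i]) -> X -> X.
Hypothesis HPhi : bounded_alg_hom (@Balg R) (@normB R) Phi.
Hypothesis Hres : inv_plus D A 1 (Phi (rz 1)).
Implicit Types (f g : R -> R[i]) (S : X -> X) (e : R).

Local Notation calc := (calc T Phi).

Definition appr g S e : Prop := exists2 F, calc F S &
  forall b, cabs (F (0 +i* b)%C - g b) <= e.

Definition approximable g : Prop := forall e, 0 < e -> exists S, appr g S e.

Lemma appr_ge0 g S e : appr g S e -> 0 <= e.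
Proof. by move=> [F _ /(_ 0)]; exact: le_trans (cabs_ge0 _). Qed.

Lemma C0iR_approximable g : C0iR g -> approximable g.
Proof.
move=> hg e e0.
pose Q q := exists F S, calc F S /\ forall b, F (0 +i* b)%C = q b.
have [|||||q [F [S [hc E]]] hq] := @C0iR_density R Q _ _ _ _ _ g e hg e0.
- move=> p q [F [S [hc E]]] [F' [S' [hc' E']]].
  by do 2 eexists; split; [exact: calc_add hc hc'|move=> b; rewrite /= E E'].
- move=> p q [F [S [hc E]]] [F' [S' [hc' E']]].
  by do 2 eexists; split; [exact: calc_mul hc hc'|move=> b; rewrite /= E E'].
- move=> c p [F [S [hc E]]].
  by do 2 eexists; split; [exact: calc_scale c _ _ hc|move=> b; rewrite /= E].
- by move=> t; do 2 eexists; split; [exact: calc_exp|].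
- by do 2 eexists; split; [exact: calc_res|].
by exists S, F => // b; rewrite E.
Qed.

(** [H g x] is pinned down by an inequality against all approximants at once instead of one chosen
    sequence, so each algebraic law can be checked on whichever approximants are convenient. *)
Lemma extension_exists : exists2 C : R, 0 <= C & exists H : (R -> R[i]) -> X -> X,
  (forall F S (m : R), calc F S -> 0 <= m ->
    (forall b, cabs (F (0 +i* b)%C) <= m) -> forall x, rn (S x) <= C * m * rn x) /\
  forall g, approximable g -> forall S e x, appr g S e ->
    rn (S x - H g x) <= C * e * rn x.
Proof.
have [C C0 hC] := calc_bound _ _ _ HT HB HG HD _ HPhi Hres; exists C => //.
have diff g S S' e e' x : appr g S e -> appr g S' e' ->
    rn (S x - S' x) <= C * (e + e') * rn x.
  move=> h h'; have e0 := appr_ge0 _ _ _ h; have e0' := appr_ge0 _ _ _ h'.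
  move: h h' => [F hF k] [F' hF' k'].
  have hh := hC _ _ (e + e') (calc_add _ _ _ _ _ _ hF (calc_scale _ _ (-1) _ _ hF')) (addr_ge0 e0 e0').
  rewrite -scaleN1r; apply: hh => b; have -> : F (0 +i* b)%C + -1 * F' (0 +i* b)%C =
    (F (0 +i* b)%C - g b) - (F' (0 +i* b)%C - g b) by ring.
  by rewrite (le_trans (cabsD _ _))// cabsN lerD.
have ex g x : approximable g -> exists l, forall S e, appr g S e -> rn (S x - l) <= C * e * rn x.
  move=> hg; have inv0 n : 0 < n.+1%:R^-1 :> R by rewrite invr_gt0.
  have /choice[u hu] : forall n : nat, exists S, appr g S n.+1%:R^-1 by move=> n; exact: hg.
  have small d : 0 < d -> exists N : nat, forall n, (N <= n)%N -> C * n.+1%:R^-1 * rn x <= d.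
    move=> d0; exists (Num.truncn (C * rn x / d)) => n hn.
    rewrite mulrAC ler_pdivrMr// [leRHS]mulrC -ler_pdivrMr//.
    by rewrite ltW// (lt_le_trans (truncnS_gt _))// ler_nat.
  have [e e0|l hl] := @tends_cauchy R X (fun n => u n x).
    have [N hN] := small (e / 2) (divr_gt0 e0 (ltr0Sn _ _)); exists N => m n hm hn.
    apply: le_trans (diff _ _ _ _ _ x (hu m) (hu n)) _.
    by rewrite mulrDr mulrDl [leRHS]splitr lerD// hN.
  exists l => S e hS; apply/ler_addgt0Pr => d d0.
  have d2 : 0 < d / 2 by rewrite divr_gt0.
  have [N hN] := small _ d2; have [N' hN'] := hl _ d2.
  pose n := maxn N N'.
  apply: le_trans (rn_sub_trans (u n x) _ _) _.
  have -> : C * e * rn x + d = C * e * rn x + d / 2 + d / 2 by rewrite -addrA -splitr.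
  rewrite lerD//; last by rewrite hN'// leq_maxr.
  apply: le_trans (diff _ _ _ _ _ x hS (hu n)) _.
  by rewrite mulrDr mulrDl lerD2l hN// leq_maxl.
(* For approximable [g] the set is nonempty by [ex]; the default branch of [xget] concerns other [g]
   only. *)
exists (fun g x => xget 0 [set l | forall S e, appr g S e -> rn (S x - l) <= C * e * rn x]).
split=> // g hg S e x hS; have [l hl] := ex g x hg.
by case: xgetP => [y _|/(_ l)//]; exact.
Qed.

Lemma B_to_C0iR : exists H : (R -> R[i]) -> X -> X,
  bounded_alg_hom (@C0iR R) (@normsup R) H /\
  forall z, complex.Re z != 0 -> inv_plus D A z (H (rz_iR z)).
Proof.
have [C C0 [H [hC hH]]] := extension_exists; exists H.
(* The criterion behind the identities for [H]: approximants of [g] at scale [k * e] whose values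
   lie within [K * e] of [y] force [H g x = y]. *)
have uniq g x y (K k : R) : approximable g -> 0 <= k ->
    (forall e, 0 < e <= 1 -> exists2 S, appr g S (k * e) & rn (S x - y) <= K * e) ->
    H g x = y.
  move=> hg k0 h; apply/eqP; rewrite -subr_eq0; apply/eqP; apply: rn_le0 => d d0.
  pose K1 := C * k * rn x + `|K|.
  have K10 : 0 <= K1 by rewrite addr_ge0// !mulr_ge0// rn_ge0.
  have K11 : 0 < K1 + 1 by rewrite ltr_wpDl.
  pose e := Num.min 1 (d / (K1 + 1)).
  have e0 : 0 < e by rewrite lt_min ltr01 divr_gt0.
  have [|S hS hy] := h e; first by rewrite e0 ge_min lexx.
  apply: le_trans (rn_sub_trans (S x) _ _) _.
  have h1 := hH g hg S _ x hS; rewrite rnB in h1.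
  apply: (@le_trans _ _ ((K1 + 1) * e)); last first.
    by rewrite mulrC -ler_pdivlMr// /e ge_min lexx orbT.
  have KK : K * e <= `|K| * e by rewrite ler_wpM2r ?(ltW e0)// ler_norm.
  by move: h1 hy KK (ltW e0); rewrite /K1; lra.
have apD f g S S' e e' : appr f S e -> appr g S' e' ->
    appr (fun b => f b + g b) (fun x => S x + S' x) (e + e').
  move=> [F hF k] [G hG k']; exists (fun u => F u + G u); first exact: calc_add.
  by move=> b; rewrite opprD addrACA (le_trans (cabsD _ _))// lerD.
have apZ c f S e : appr f S e -> appr (fun b => c * f b) (fun x => c *: S x) (cabs c * e).
  move=> [F hF k]; exists (fun u => c * F u); first exact: calc_scale.
  by move=> b; rewrite -mulrBr cabsM ler_wpM2l ?cabs_ge0.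
(* As [e <= 1], the three terms of the product difference are at most [e], [M e] and [M e]. *)
have apM f g S S' e (M : R) : (forall b, cabs (f b) <= M) -> (forall b, cabs (g b) <= M) ->
    e <= 1 -> appr f S e -> appr g S' e ->
    appr (fun b => f b * g b) (fun x => S (S' x)) ((M + M + 1) * e).
  move=> hf hg e1 hS; have e0 := appr_ge0 _ _ _ hS.
  move: hS => [F hF k] [G hG k']; exists (fun u => F u * G u); first exact: calc_mul.
  move=> b; set z := (0 +i* b)%C.
  have M0 : 0 <= M := le_trans (cabs_ge0 _) (hf b).
  have -> : F z * G z - f b * g b = (F z - f b) * (G z - g b) + ((F z - f b) * g b + f b * (G z - g b)) by ring.
  apply: le_trans (cabsD _ _) _; apply: le_trans (lerD (lexx _) (cabsD _ _)) _.
  rewrite !cabsM.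
  have k1 : cabs (F z - f b) * cabs (G z - g b) <= e * 1.
    by rewrite ler_pM ?cabs_ge0 ?k// (le_trans (k' b)).
  have k2 : cabs (F z - f b) * cabs (g b) <= e * M by rewrite ler_pM ?cabs_ge0 ?k.
  have k3 : cabs (f b) * cabs (G z - g b) <= M * e by rewrite ler_pM ?cabs_ge0 ?k'.
  lra.
have blS g S e : appr g S e -> bounded_linear S.
  by move=> [F hF _]; exact: (calc_blin _ _ _ HT _ Hres _ _ hF).
have apx g : C0iR g -> approximable g := @C0iR_approximable g.
have HBd g x : C0iR g -> rn (H g x) <= C * normsup g * rn x.
  move=> hg; have ag := apx g hg; apply/ler_addgt0Pr => d d0.
  have s0 : 0 <= normsup g := le_trans (cabs_ge0 _) (C0iR_bound g 0 hg).
  have q0 : 0 <= C *+ 2 * rn x by rewrite mulr_ge0 ?rn_ge0// mulrn_wge0.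
  have q1 : 0 < C *+ 2 * rn x + 1 by rewrite ltr_wpDl.
  have e0 := divr_gt0 d0 q1; set e := d / _ in e0.
  have [S hS] := ag e e0; have h1 := hH g ag S e x hS; rewrite rnB in h1.
  have h2 : rn (S x) <= C * (normsup g + e) * rn x.
    case: hS => F hF k; apply: (hC F) => //; first by rewrite addr_ge0// ltW.
    move=> b; have := cabsD (g b) (F (0 +i* b)%C - g b); rewrite addrC subrK.
    by move=> /le_trans; apply; rewrite lerD// C0iR_bound.
  have := rnD (H g x - S x) (S x); rewrite subrK => /le_trans; apply.
  have : (C *+ 2 * rn x) * e <= d.
    by rewrite /e mulrCA ler_piMr ?(ltW d0)// ler_pdivrMr// mul1r lerDl.
  by move: h1 h2; rewrite mulr2n; lra.
have HL g : C0iR g -> bounded_linear (H g).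
  move=> hg; have ag := apx g hg; apply: (@blin_intro _ _ _ (C * normsup g)).
  - move=> x y; apply: (uniq g _ _ (C * rn x + C * rn y) 1) => // e /andP[e0 e1].
    have [S hS] := ag e e0; exists S; first by rewrite mul1r.
    rewrite (blinD _ (blS _ _ _ hS)) opprD addrACA (le_trans (rnD _ _))//.
    by have := hH g ag S e x hS; have := hH g ag S e y hS; lra.
  - move=> c x; apply: (uniq g _ _ (cabs c * (C * rn x)) 1) => // e /andP[e0 e1].
    have [S hS] := ag e e0; exists S; first by rewrite mul1r.
    rewrite (blinZ _ (blS _ _ _ hS)) -scalerBr rnZ -mulrA ler_wpM2l ?cabs_ge0//.
    by rewrite mulrAC; exact: hH.
  - by move=> x; exact: HBd.
have HMul f g x : C0iR f -> C0iR g -> H (fun b => f b * g b) x = H f (H g x).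
  move=> hf hg; have af := apx f hf; have ag := apx g hg.
  pose M := normsup f + normsup g.
  have nf0 : 0 <= normsup f := le_trans (cabs_ge0 _) (C0iR_bound f 0 hf).
  have ng0 : 0 <= normsup g := le_trans (cabs_ge0 _) (C0iR_bound g 0 hg).
  have Mf b : cabs (f b) <= M by rewrite (le_trans (C0iR_bound f b hf))// lerDl.
  have Mg b : cabs (g b) <= M by rewrite (le_trans (C0iR_bound g b hg))// lerDr.
  have M0 : 0 <= M by exact: addr_ge0.
  have M1 : 0 < M + M + 1 by rewrite ltr_wpDl// addr_ge0.
  have key e : 0 < e <= 1 -> exists S S', [/\ appr f S e, appr g S' e &
      appr (fun b => f b * g b) (fun x => S (S' x)) ((M + M + 1) * e)].
    move=> /andP[e0 e1]; have [S hS] := af e e0; have [S' hS'] := ag e e0.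
    by exists S, S'; split=> //; exact: apM.
  apply: (uniq _ _ _ (C * (M + 1) * (C * rn x) + C * rn (H g x)) (M + M + 1)).
  - move=> e e0; have [|S [S' [_ _ h]]] := key (Num.min 1 (e / (M + M + 1))).
      by rewrite lt_min ltr01 divr_gt0//= ge_min lexx.
    exists (fun x => S (S' x)); case: h => F hF k; exists F => // b.
    rewrite (le_trans (k b))// mulrC -ler_pdivlMr// ge_min lexx orbT//.
  - exact: ltW.
  move=> e e01; have /andP[e0 e1] := e01; have [S [S' [hS hS' h]]] := key e e01.
  exists (fun x => S (S' x)) => //.
  (* The intermediate point needs [S] bounded uniformly in [e]; this holds because [|F| <= M + 1] on
     the axis. *)
  apply: le_trans (rn_sub_trans (S (H g x)) _ _) _.
  rewrite -(blinB _ (blS _ _ _ hS)) mulrDl lerD//; last first.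
    by have := hH f af S e (H g x) hS; lra.
  apply: (@le_trans _ _ (C * (M + 1) * rn (S' x - H g x))).
    case: (hS) => F hF k; apply: (hC F) => //; first by rewrite addr_ge0.
    move=> b; have := cabsD (f b) (F (0 +i* b)%C - f b); rewrite addrC subrK.
    by move=> /le_trans; apply; rewrite lerD// (le_trans (k b)).
  rewrite -[leRHS]mulrA ler_wpM2l ?mulr_ge0 ?addr_ge0//.
  by have := hH g ag S' e x hS'; lra.
have HZ c f x : C0iR f -> H (fun b => c * f b) x = c *: H f x.
  move=> hf; have af := apx f hf; have c1 : 0 < cabs c + 1 by rewrite ltr_wpDl// cabs_ge0.
  apply: (uniq _ _ _ (cabs c * (C * rn x)) (cabs c)); last 2 first.
  - exact: cabs_ge0.
  - move=> e /andP[e0 _]; have [S hS] := af e e0; exists (fun x => c *: S x); first exact: apZ.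
    by rewrite -scalerBr rnZ -mulrA ler_wpM2l ?cabs_ge0// mulrAC; exact: hH.
  move=> e e0; have [S hS] := af (e / (cabs c + 1)) (divr_gt0 e0 c1).
  exists (fun x => c *: S x); case: (apZ c _ _ _ hS) => F hF k; exists F => // b.
  rewrite (le_trans (k b))// mulrCA ler_piMr ?(ltW e0)// ler_pdivrMr// mul1r lerDl//.
have HAdd f g x : C0iR f -> C0iR g -> H (fun b => f b + g b) x = H f x + H g x.
  move=> hf hg; have af := apx f hf; have ag := apx g hg.
  apply: (uniq _ _ _ (C * rn x + C * rn x) 2); last 2 first.
  - by [].
  - move=> e /andP[e0 _]; have [S hS] := af e e0; have [S' hS'] := ag e e0.
    exists (fun x => S x + S' x); first by rewrite mulr_natl mulr2n; exact: apD.
    rewrite opprD addrACA (le_trans (rnD _ _))//.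
    by have := hH f af S e x hS; have := hH g ag S' e x hS'; lra.
  move=> e e0; have e2 : 0 < e / 2 by rewrite divr_gt0.
  have [S hS] := af _ e2; have [S' hS'] := ag _ e2.
  by exists (fun x => S x + S' x); rewrite (splitr e); exact: apD.
(* [r_1] approximates itself with error 0. *)
have H1 x : H (rz_iR 1) x = Phi (rz 1) x.
  have h1 : C0iR (rz_iR (1 : R[i])) by apply: C0iR_rz; rewrite /= oner_neq0.
  apply: (uniq _ _ _ 0 0) => //; first exact: apx.
  move=> e _; exists (Phi (rz 1)); last by rewrite subrr rn0 mul0r.
  exists (rz 1); first exact: calc_res.
  by move=> b; rewrite subrr cabs0 mul0r.
split.
  split; first exact: HL.
  split; first by move=> f g hf hg x; exact: HAdd.
  split; first by move=> c f hf x; exact: HZ.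
  split; first by move=> f g hf hg x; exact: HMul.
  by exists C => f hf x; rewrite rn_lin; exact: HBd.
move=> z z0; have h1 : C0iR (rz_iR (1 : R[i])) by apply: C0iR_rz; rewrite /= oner_neq0.
have hz := C0iR_rz z z0.
(* The resolvent identity, from which [resolvent_transfer] with [w = 1] reaches every [z] off the
   axis, on either side. *)
have Id b : rz_iR 1 b = rz_iR z b + (z - 1) * (rz_iR 1 b * rz_iR z b) :> R[i].
  by rewrite /rz_iR; field; rewrite !addz_neq0// /= oner_neq0.
have hr1 : inv_plus D A 1 (H (rz_iR 1)).
  by have -> : H (rz_iR 1) = Phi (rz 1) by apply: funext.
have hp : C0iR (fun b => rz_iR 1 b * rz_iR z b : R[i]).
  have cn1 : econt (rz_iR (1 : R[i])) by apply/econtP; case: h1.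
  have cnz : econt (rz_iR z) by apply/econtP; case: hz.
  apply: C0iR_intro; first exact: econtM.
  move=> e e0; have [a _ ha] := C0iR_tail _ _ hz e0; exists a => b /ha hb.
  rewrite cabsM (le_trans _ hb)// ler_piMl ?cabs_ge0//.
  by case: (cabs_rz1_axis b).
have hq : C0iR (fun b => (1 - z) * (rz_iR 1 b * rz_iR z b) : R[i]).
  have [h2 _] := hp; have ch : econt (fun b => rz_iR 1 b * rz_iR z b : R[i]) by apply/econtP.
  have c1 : 0 < cabs (1 - z) + 1 by rewrite ltr_wpDl// cabs_ge0.
  apply: C0iR_intro.
    apply: (@econtM _ (fun=> 1 - z)) => //.
    by apply: (@econt_lip _ _ 0) => x y; rewrite subrr cabs0 mul0r.
  move=> e e0; have [a _ ha] := C0iR_tail _ _ hp (divr_gt0 e0 c1).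
  exists a => b /ha hb; rewrite cabsM (le_trans (ler_wpM2l (cabs_ge0 _) hb))//.
  by rewrite mulrCA ler_piMr ?(ltW e0)// ler_pdivrMr// mul1r lerDl.
have E x : H (rz_iR z) x = H (rz_iR 1) x + (1 - z) *: H (fun b => rz_iR 1 b * rz_iR z b) x.
  rewrite -HZ// -HAdd//; congr (H _ x); apply: funext => b.
  by rewrite [X in X + _]Id; ring.
apply: (resolvent_transfer _ _ 1 _ _ _ hr1 (HL _ hz)) => x; rewrite {1}E.
  by rewrite HMul.
congr (_ + _ *: _); rewrite -HMul//; congr (H _ x).
by apply: funext => b; rewrite mulrC.
Qed.

End Extension.

(** * From C0(iR) to B *)

Section Variation.
Context {R : realType}.
Local Notation mu := (@lebesgue_measure R).
Local Open Scope ereal_scope.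

(* Vitali-Caratheodory argument, as the derivative need not be continuous: the
   level sets of [p] are covered by slightly larger open sets, on which a local
   estimate chains up. *)
Lemma increment_le_integral_eps (F : R -> R[i]) (p : R -> R) (a b e : R) :
  (a <= b)%R -> (0 < e)%R -> measurable_fun `[a, b] p ->
  (forall x, (a <= x <= b)%R -> (0 <= p x)%R) ->
  (forall x d, (a <= x <= b)%R -> (0 < d)%R -> exists2 h : R, (0 < h)%R &
     forall y, (a <= y <= b)%R -> (`|y - x| < h)%R ->
       (cabs (F y - F x) <= (p x + d) * `|y - x|)%R) ->
  (cabs (F b - F a))%:E <=
    \int[mu]_(x in `[a, b]) (p x)%:E + (e * (b - a) + e)%:E.
Proof.
move=> ab e0 mp p0 hF.
pose A (n : nat) := `[a, b]%classic `&` p @^-1` `[(n%:R * e)%R, (n.+1%:R * e)%R[.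
have mA n : measurable (A n) by apply: mp => //; exact: measurable_itv.
have muab : mu `[a, b] < +oo.
  by rewrite lebesgue_measure_itv /=; case: ifP => _; rewrite ?ltry// -EFinB ltry.
have muA n : mu (A n) < +oo.
  by apply: le_lt_trans muab; apply: le_measure; rewrite ?inE;
    [exact: mA|exact: measurable_itv|exact: subIsetl].
(* Chosen so that [(n + 1) e] times [eta n] is [e / 2^(n + 1)]; the excess of all open covers then
   costs at most [e]. *)
pose eta (n : nat) : R := (e / (2 ^ n.+1)%:R / (n.+1%:R * e))%R.
have ne0 (n : nat) : (0 < n.+1%:R * e)%R by rewrite mulr_gt0.
have eta0 n : (0 < eta n)%R by rewrite /eta !divr_gt0// ltr0n expn_gt0.
have /choice[U hU] : forall n, exists U : set R,
    [/\ open U, A n `<=` U & mu (U `\` A n) < (eta n)%:E].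
  by move=> n; exact: (lebesgue_regularity_outer (mA n) (muA n) (eta0 n)).
have mU n : measurable (U n) by apply: open_measurable; case: (hU n).
(* Each level is charged its upper value [(n + 1) e] on its open cover. Half-open intervals make
   [nu] exactly additive. *)
pose nu (u v : R) := \sum_(0 <= n <oo) ((n.+1%:R * e)%:E * mu (U n `&` `]u, v])).
have t0 n (B : set R) : 0 <= (n.+1%:R * e)%:E * mu B by rewrite mule_ge0// lee_fin ltW.
have mUI n u v : measurable (U n `&` `]u, v]) by apply: measurableI => //; exact: measurable_itv.
have nuD u v w : (u <= v)%R -> (v <= w)%R -> nu u w = nu u v + nu v w.
  move=> uv vw; rewrite /nu -nneseriesD//; apply: eq_eseriesr => n _.
  rewrite -ge0_muleDr//; congr (_ * _).
  have dis : (U n `&` `]u, v]) `&` (U n `&` `]v, w]) = set0.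
    apply/seteqP; split=> // x /= [[_]]; rewrite !in_itv /= => /andP[_ xv] [_ /andP[vx _]].
    by move: (lt_le_trans vx xv); rewrite ltxx.
  rewrite -(measureU mu (mUI n u v) (mUI n v w) dis).
  congr (mu _); rewrite -setIUr; congr (_ `&` _); apply/seteqP; split=> x /=; rewrite !in_itv /=.
    by move=> /andP[ux xw]; have [xv|xv] := leP x v; [left|right]; rewrite ?ux ?xv ?xw.
  by move=> [/andP[-> /le_trans->]//|/andP[/(le_lt_trans uv)-> ->]].
(* Short intervals around a point [x] of level [n] lie in [U n], so [nu] is there at least
   [(n + 1) e] times the length; the strict inequality [p x < (n + 1) e] leaves room for the
   tolerance in [hF]. *)
have main : (cabs (F b - F a))%:E <= nu a b.
  apply: (@cousin R (fun u v => (cabs (F v - F u))%:E <= nu u v) a b ab).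
    move=> x y ax xy yb h1 h2; rewrite (nuD _ x)//.
    apply: le_trans (leeD h1 h2); rewrite -EFinD lee_fin.
    have -> : (F y - F a = (F x - F a) + (F y - F x))%R by ring.
    exact: cabsD.
  move=> x ax xb; pose n := Num.truncn (p x / e).
  have px0 : (0 <= p x)%R by apply: p0; rewrite ax.
  have q0 : (0 <= p x / e)%R by rewrite divr_ge0// ltW.
  have pn : (p x < n.+1%:R * e)%R by rewrite -ltr_pdivrMr// truncnS_gt.
  have An : A n x.
    split; first by rewrite /= in_itv /= ax.
    by rewrite /= in_itv /= pn andbT -ler_pdivlMr// truncn_le.
  have [oU AU _] := hU n.
  have [d1 /= d10 hd1] : \forall y \near x, U n y by exact: (open_nbhs_nbhs (conj oU (AU _ An))).
  have dn : (0 < n.+1%:R * e - p x)%R by rewrite subr_gt0.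
  have axb : (a <= x <= b)%R by rewrite ax.
  have [d2 d20 hd2] := hF x _ axb dn.
  exists (Num.min d1 d2); first by rewrite lt_min d10.
  move=> u v au ux xv vb; rewrite ltrBlDr -ltrBlDl lt_min => /andP[u1 u2].
  rewrite -ltrBlDl lt_min => /andP[v1 v2].
  have E : (p x + (n.+1%:R * e - p x) = n.+1%:R * e)%R by rewrite addrC subrK.
  rewrite E in hd2.
  have hv : (cabs (F v - F x) <= n.+1%:R * e * (v - x))%R.
    have nv : (`|v - x| = v - x)%R by rewrite ger0_norm// subr_ge0.
    by have := hd2 v; rewrite nv; apply=> //; rewrite vb (le_trans ax).
  have hu : (cabs (F u - F x) <= n.+1%:R * e * (x - u))%R.
    have nv : (`|u - x| = x - u)%R by rewrite distrC ger0_norm// subr_ge0.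
    by have := hd2 u; rewrite nv; apply=> //; rewrite au (le_trans ux).
  have UI : U n `&` `]u, v] = `]u, v]%classic.
    apply: setIidr => y /=; rewrite in_itv /= => /andP[uy yv]; apply: hd1 => /=.
    by rewrite /ball_ /= ltr_norml; apply/andP; split; lra.
  apply: (@le_trans _ _ ((n.+1%:R * e)%:E * mu (U n `&` `]u, v]))); last first.
    rewrite /nu (@nneseriesD1 _ _ n)//=.
    by rewrite leeDl// nneseries_ge0.
  rewrite UI lebesgue_measure_itv /= lte_fin; have uv := le_trans ux xv.
  move: uv; rewrite le_eqVlt => /predU1P[<-|uv].
    by rewrite ltxx mule0 subrr cabs0.
  rewrite uv -EFinB -EFinM lee_fin.
  have -> : (F v - F u = (F v - F x) - (F u - F x))%R by rewrite opprB addrA subrK.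
  rewrite (le_trans (cabsD _ _))// cabsN (le_trans (lerD hv hu))//.
  by rewrite -mulrDr addrA subrK.
apply: (le_trans main).
apply: (@le_trans _ _ (\sum_(0 <= n <oo)
    ((n.+1%:R * e)%:E * mu (A n) + (e / (2 ^ n.+1)%:R)%:E))).
  apply: lee_nneseries => // n _.
  have [_ AU hm] := hU n.
  have -> : (e / (2 ^ n.+1)%:R)%:E = (n.+1%:R * e)%:E * (eta n)%:E.
    by rewrite -EFinM; congr (_%:E); rewrite /eta [RHS]mulrCA divff ?mulr1// gt_eqF.
  rewrite -ge0_muleDr// ?lee_fin ?(ltW (eta0 n))// lee_wpmul2l ?lee_fin ?(ltW (ne0 n))//.
  apply: (@le_trans _ _ (mu (U n))).
    by apply: le_measure; rewrite ?inE; [exact: mUI|exact: mU|exact: subIsetl].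
  have -> : U n = A n `|` (U n `\` A n) by rewrite setDUK.
  have dis : A n `&` (U n `\` A n) = set0 by rewrite setDE setICA setICr setI0.
  by rewrite (measureU mu (mA n) (measurableD (mU n) (mA n)) dis) leeD2l// ltW//.
apply: le_trans (epsilon_trick _ _ (ltW e0)) _ => //.
(* On level [n] the value [(n + 1) e] is at most [p + e], whence the term [e * (b - a)]. *)
have -> : \int[mu]_(x in `[a, b]) (p x)%:E + (e * (b - a) + e)%:E =
   \int[mu]_(x in `[a, b]) (p x + e)%:E + e%:E.
  rewrite (_ : (fun x => (p x + e)%:E) = (fun x => (p x)%:E + e%:E))//.
  rewrite ge0_integralD//=; first last.
  - by move=> x _; rewrite lee_fin ltW.
  - exact/measurable_EFinP.
  rewrite integral_cst//= lebesgue_measure_itv /= lte_fin.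
  move: (\int[mu]_(x in `[a, b]) (p x)%:E) => I; rewrite -addeA; congr (I + _).
  move: ab; rewrite le_eqVlt => /predU1P[->|->].
    by rewrite ltxx mule0 add0e subrr mulr0 add0r.
  by rewrite -EFinB -EFinM.
rewrite leeD2r//.
have UA : \bigcup_n A n = `[a, b]%classic.
  apply/seteqP; split=> [x [n _ []]//|x xab].
  have h : (a <= x <= b)%R by move: xab; rewrite /= in_itv.
  exists (Num.truncn (p x / e)) => //; split=> //=.
  have q0 : (0 <= p x / e)%R by rewrite divr_ge0 ?p0// ltW.
  rewrite in_itv /=; apply/andP; split; first by rewrite -ler_pdivlMr// truncn_le.
  by rewrite -ltr_pdivrMr// truncnS_gt.
have mpe : measurable_fun `[a, b] (fun x => (p x + e)%:E).
  by apply/measurable_EFinP; apply: measurable_funD.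
rewrite -UA ge0_integral_bigcup//=; first last.
- apply/trivIsetP => i j _ _ ij; apply/seteqP; split=> // x [[_ +] [_ +]].
  rewrite /= !in_itv /= => /andP[i1 i2] /andP[j1 j2].
  have := le_lt_trans i1 j2; have := le_lt_trans j1 i2.
  rewrite !ltr_pM2r// !ltr_nat !ltnS => ji ij'.
  by move/negP: ij; apply; rewrite eqn_leq ij' ji.
- rewrite UA => x; rewrite /= in_itv /= => xab; rewrite lee_fin addr_ge0 ?p0// ltW//.
- by rewrite UA.
apply: lee_nneseries => // n _.
have -> : (n.+1%:R * e)%:E * mu (A n) = \int[mu]_(x in A n) (cst (n.+1%:R * e)%:E x).
  by rewrite (integral_cst mu (mA n)).
apply: ge0_le_integral_gen.
- by move=> x _; rewrite lee_fin ltW.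
- move=> x [_]; rewrite /= in_itv /= => /andP[h _]; rewrite lee_fin.
  by rewrite -natr1 mulrDl mul1r lerD2r.
Qed.

Lemma increment_le_integral (F : R -> R[i]) (p : R -> R) (a b : R) :
  (a <= b)%R -> measurable_fun `[a, b] p ->
  (forall x, (a <= x <= b)%R -> (0 <= p x)%R) ->
  (forall x d, (a <= x <= b)%R -> (0 < d)%R -> exists2 h : R, (0 < h)%R &
     forall y, (a <= y <= b)%R -> (`|y - x| < h)%R ->
       (cabs (F y - F x) <= (p x + d) * `|y - x|)%R) ->
  (cabs (F b - F a))%:E <= \int[mu]_(x in `[a, b]) (p x)%:E.
Proof.
move=> ab mp p0 hF; apply/lee_addgt0Pr => d d0.
have q0 : (0 < b - a + 1)%R by rewrite ltr_wpDl// subr_ge0.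
have := increment_le_integral_eps F p a b (d / (b - a + 1)) ab (divr_gt0 d0 q0) mp p0 hF.
move/le_trans; apply; rewrite leeD2l// lee_fin -[X in (_ + X)%R]mulr1 -mulrDr.
by rewrite divfK// gt_eqF.
Qed.

End Variation.

(** * Functions of B along horizontal lines near the axis *)

Section Boundary.
Context {R : realType}.
Variable f : R[i] -> R[i].
Hypothesis fB : Balg f.
Local Notation mu := (@lebesgue_measure R).

Local Notation f' := (derive1 (f : R[i]^o -> R[i]^o)).

Lemma Balg_incr z : Cplus z -> forall e : R, 0 < e -> exists2 d : R, 0 < d &
  forall h : R[i], cabs h < d -> cabs (f (h + z) - f z - h * f' z) <= e * cabs h.
Proof.
move=> hz e e0; have [hol _] := fB.
have [d d0 hd] := (cderP _ _ _).1 (derivable_cder _ _ (hol z hz)) e e0.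
exists d => // h hh; have [->|h0] := eqVneq h 0; last exact: hd.
by rewrite add0r subrr mul0r subrr cabs0 mulr0.
Qed.

Lemma Balg_incr_lip z : Cplus z -> exists2 d : R, 0 < d &
  forall h : R[i], cabs h < d -> cabs (f (h + z) - f z) <= (cabs (f' z) + 1) * cabs h.
Proof.
move=> hz; have [d d0 hd] := Balg_incr z hz 1 ltr01; exists d => // h /hd hh.
have := cabsD (f (h + z) - f z - h * f' z) (h * f' z); rewrite subrK => /le_trans; apply.
by rewrite cabsM; move: hh; lra.
Qed.

Lemma Balg_cont z : Cplus z -> forall e : R, 0 < e -> exists2 d : R, 0 < d &
  forall h : R[i], cabs h < d -> cabs (f (h + z) - f z) <= e.
Proof.
move=> hz e e0; have [d d0 hd] := Balg_incr_lip z hz.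
have c0 : 0 < cabs (f' z) + 1 by rewrite ltr_wpDl// cabs_ge0.
exists (Num.min d (e / (cabs (f' z) + 1))); first by rewrite lt_min d0 divr_gt0.
move=> h; rewrite lt_min => /andP[/hd hh]; rewrite ltr_pdivlMr// => /ltW he.
by rewrite (le_trans hh)// mulrC.
Qed.

Variable b : R.

Let shiftE (x y : R) : (y +i* b)%C = ((y - x)%:C)%C + (x +i* b)%C :> R[i].
Proof. by apply/eqP; rewrite eq_complex /= subrK add0r !eqxx. Qed.

Lemma quot_measurable (s : R) : 0 < s ->
  measurable_fun (`]0%R, +oo[%classic : set R) (fun t : R => cabs (f ((t + s) +i* b)%C - f (t +i* b)%C) / s).
Proof.
move=> s0; apply: open_continuous_measurable_fun => // x.
rewrite inE /= in_itv /= andbT => x0.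
apply: cvgMr_tmp; apply/cvgrPdist_le => e e0.
have e2 : 0 < e / 2 by rewrite divr_gt0.
have hx : Cplus (x +i* b)%C by [].
have hxs : Cplus ((x + s) +i* b)%C by rewrite /Cplus /= addr_gt0.
have [d d0 hd] := Balg_cont _ hx _ e2; have [d' d0' hd'] := Balg_cont _ hxs _ e2.
apply/nbhs_ballP; exists (Num.min d d'); first by rewrite /= lt_min d0.
move=> y; rewrite /ball_ /= distrC lt_min => /andP[y1 y2].
have h1 := hd ((y - x)%:C)%C; rewrite cabs_real -shiftE in h1.
have h2 := hd' ((y - x)%:C)%C; rewrite cabs_real in h2.
have E2 : ((y - x)%:C)%C + ((x + s) +i* b)%C = ((y + s) +i* b)%C :> R[i].
  by apply/eqP; rewrite eq_complex /= addrA subrK add0r !eqxx.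
rewrite E2 in h2; have {}h1 := h1 y1; have {}h2 := h2 y2.
have tri (u v : R[i]) : `|cabs u - cabs v| <= cabs (u - v).
  by rewrite ler_norml cabs_sub_ge andbT lerNl opprB (le_trans (cabs_sub_ge _ _))// cabsB.
apply: le_trans (tri _ _) _.
set A := f _; set B := f _; set C := f _; set D := f _.
have -> : A - B - (C - D) = (D - B) - (C - A) by ring.
by rewrite (le_trans (cabsD _ _))// cabsN [leRHS]splitr lerD.
Qed.

(** A pointwise limit of moduli of difference quotients with real steps [1 / (n + 1)], each
    continuous in [t]. *)
Lemma deriv_measurable :
  measurable_fun (`]0%R, +oo[%classic : set R) (fun t : R => cabs (f' (t +i* b)%C)).
Proof.
pose h (n : nat) (t : R) := cabs (f ((t + n.+1%:R^-1) +i* b)%C - f (t +i* b)%C) / n.+1%:R^-1.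
have n0 (n : nat) : 0 < n.+1%:R^-1 :> R by rewrite invr_gt0.
apply: (@measurable_fun_cvg _ _ _ _ h) => [n|x]; first exact: quot_measurable.
rewrite /= in_itv /= andbT => x0; apply/cvgrPdist_le => e e0.
have hx : Cplus (x +i* b)%C by [].
have [d d0 hd] := Balg_incr _ hx _ e0.
exists (Num.truncn d^-1) => // n /= hn.
have sd : n.+1%:R^-1 < d :> R.
  rewrite -[ltRHS]invrK ltf_pV2 ?posrE ?invr_gt0//.
  by rewrite (lt_le_trans (truncnS_gt _))// ler_nat.
have h1 := hd (n.+1%:R^-1%:C)%C; rewrite cabs_real (gtr0_norm (n0 n)) in h1.
have E2 : (n.+1%:R^-1%:C)%C + (x +i* b)%C = ((x + n.+1%:R^-1) +i* b)%C :> R[i].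
  by apply/eqP; rewrite eq_complex /= add0r addrC !eqxx.
rewrite E2 in h1; have {}h1 := h1 sd; rewrite /h.
move: h1 (n0 n); move: (n.+1%:R^-1) => s h1 s0.
set A := f _ - f _ in h1 *; set g := f' _ in h1 *.
have tri (u v : R[i]) : `|cabs u - cabs v| <= cabs (v - u).
  rewrite ler_norml -(cabsB u) cabs_sub_ge andbT lerNl opprB.
  by rewrite (le_trans (cabs_sub_ge _ _))// cabsB.
have -> : cabs g - cabs A / s = (cabs ((s%:C)%C * g) - cabs A) / s.
  by rewrite cabsM cabs_real (gtr0_norm s0) mulrBl [s * _]mulrC mulfK// gt_eqF.
rewrite normrM [`|s^-1|]gtr0_norm ?invr_gt0// ler_pdivrMr//.
exact: le_trans (tri _ _) h1.
Qed.

Lemma Balg_variation (x y : R) : 0 < x -> x <= y ->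
  ((cabs (f (y +i* b)%C - f (x +i* b)%C))%:E <=
   \int[mu]_(t in `[x, y]) (cabs (f' (t +i* b)%C))%:E)%E.
Proof.
move=> x0 xy.
apply: (@increment_le_integral R (fun t => f (t +i* b)%C) (fun t => cabs (f' (t +i* b)%C)) x y) => //.
- apply: measurable_funS deriv_measurable => //.
  by move=> t /=; rewrite !in_itv /= andbT => /andP[/(lt_le_trans x0)].
- by move=> t _; exact: cabs_ge0.
- move=> t d /andP[xt ty] d0; have t0 : Cplus (t +i* b)%C by exact: lt_le_trans xt.
  have [h h0 hh] := Balg_incr _ t0 _ d0; exists h => // w _ wt.
  have := hh ((w - t)%:C)%C; rewrite cabs_real -shiftE => /(_ wt) k.
  have := cabsD (f (w +i* b)%C - f (t +i* b)%C - ((w - t)%:C)%C * f' (t +i* b)%C) (((w - t)%:C)%C * f' (t +i* b)%C).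
  rewrite subrK => /le_trans; apply; rewrite cabsM cabs_real.
  by move: k; lra.
Qed.

End Boundary.

(* Were the increments near the axis not uniformly small, infinitely many
   disjoint intervals would contribute a fixed amount to the B0-integral. *)
Lemma Balg_unif_cauchy {R : realType} (f : R[i] -> R[i]) (e : R) : Balg f -> 0 < e ->
  exists2 d : R, 0 < d & forall a c b : R, 0 < a -> a <= c -> c < d ->
    cabs (f (c +i* b)%C - f (a +i* b)%C) <= e.
Proof.
move=> fB e0; apply: contrapT => nex.
have bad d : 0 < d -> exists a c b : R, [/\ 0 < a, a <= c, c < d &
    e < cabs (f (c +i* b)%C - f (a +i* b)%C)].
  move=> d0; apply: contrapT => h; apply: nex; exists d => // a c b a0 ac cd.
  by rewrite leNgt; apply/negP => lt; apply: h; exists a, c, b.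
pose f' := derive1 (f : R[i]^o -> R[i]^o).
(* Measurable minorants of [sup_deriv] are used because their integrals add up; that [u] vanishes on
   []0, d[] leaves room for the next interval, closer to the axis. *)
have claim (N : nat) : exists2 d : R, 0 < d & exists u : R -> \bar R,
    [/\ measurable_fun (`]0%R, +oo[%classic : set R) u, (forall x, 0 < x -> (0 <= u x)%E),
      (forall x, 0 < x -> (u x <= sup_deriv f x)%E),
      (forall x, 0 < x -> x < d -> u x = 0%E) &
      ((N%:R * e)%:E <= \int[@lebesgue_measure R]_(x in `]0%R, +oo[) u x)%E].
  elim: N => [|N [d d0 [u [mu0 u0 us ud uI]]]].
    exists 1 => //; exists (cst 0%E); split=> //.
    - move=> x x0; apply: le_trans (ereal_sup_ubound _); last by exists 0.
      by rewrite lee_fin cabs_ge0.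
    - by rewrite mul0r integral0.
  (* Since [u] is zero on [[a, c]], adding [|f'|] along this segment keeps it below [sup_deriv] and
     raises its integral by at least [e]. *)
  have [a [c [b [a0 ac cd he]]]] := bad d d0.
  pose v (x : R) : \bar R := (cabs (f' (x +i* b)%C))%:E.
  pose v' := v \_ `[a, c].
  have sub : `[a, c]%classic `<=` (`]0%R, +oo[%classic : set R).
    by move=> t /=; rewrite !in_itv /= andbT => /andP[/(lt_le_trans a0)].
  have mv : measurable_fun (`]0%R, +oo[%classic : set R) v.
    by apply/measurable_EFinP; exact: deriv_measurable.
  have v0 x : (0 <= v' x)%E.
    by rewrite /v' /patch; case: ifP => // _; rewrite lee_fin cabs_ge0.
  have mv' : measurable_fun (`]0%R, +oo[%classic : set R) v'.
    apply/measurable_restrict; [exact: measurable_itv|exact: measurable_itv|].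
    by apply: measurable_funS mv; [exact: measurable_itv|exact: subIsetl].
  exists a => //; exists (fun x => u x + v' x)%E; split.
  - exact: emeasurable_funD.
  - by move=> x x0; rewrite adde_ge0// u0.
  - move=> x x0; rewrite /v' /patch; case: ifPn => [|_]; last by rewrite adde0 us.
    rewrite inE /= in_itv /= => /andP[ax xc].
    rewrite ud//; last exact: le_lt_trans cd.
    by rewrite add0e; apply: ereal_sup_ubound; exists b.
  - move=> x x0 xa; rewrite ud//; last exact: lt_trans (lt_le_trans xa ac) cd.
    rewrite add0e /v' /patch ifF//; apply/negP; rewrite inE /= in_itv /= => /andP[ax _].
    by move: (le_lt_trans ax xa); rewrite ltxx.
  - rewrite ge0_integralD//; last by move=> x; rewrite /= in_itv /= andbT; exact: u0.
    rewrite -natr1 mulrDl mul1r EFinD; apply: leeD => //.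
    rewrite -integral_mkcondr setIidr//.
    apply: le_trans (Balg_variation f fB b _ _ a0 ac).
    by rewrite lee_fin ltW.
have [_ [_ hI]] := fB.
have I0 : (0 <= B0_integral f)%E.
  apply: integral_ge0 => x _; apply: le_trans (ereal_sup_ubound _); last by exists 0.
  by rewrite lee_fin cabs_ge0.
have fI : B0_integral f \is a fin_num by rewrite ge0_fin_numE.
pose N := (Num.truncn (fine (B0_integral f) / e)).+1.
have [d d0 [u [mu0 u0 us ud uI]]] := claim N.
have : ((N%:R * e)%:E <= B0_integral f)%E.
  apply: le_trans uI _; apply: ge0_le_integral_gen => x; rewrite /= in_itv /= andbT => x0.
    exact: u0.
  exact: us.
rewrite -(fineK fI) lee_fin; apply/negP; rewrite -ltNge -ltr_pdivrMr//.
exact: truncnS_gt.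
Qed.

Section C0iRAlgebra.
Context {R : realType}.
Implicit Types (f g : R -> R[i]).

Lemma C0iR_mulb f g (M : R) : econt f -> (forall b, cabs (f b) <= M) -> C0iR g ->
  C0iR (fun b => f b * g b).
Proof.
move=> cf hM hg; have cg : econt g by apply/econtP; case: hg.
have M0 : 0 <= M := le_trans (cabs_ge0 _) (hM 0).
have M1 : 0 < M + 1 by rewrite ltr_wpDl.
apply: C0iR_intro; first exact: econtM.
move=> e e0; have [a _ ha] := C0iR_tail _ _ hg (divr_gt0 e0 M1); exists a => b /ha hb.
rewrite cabsM (le_trans (ler_pM (cabs_ge0 _) (cabs_ge0 _) (hM b) hb))//.
by rewrite mulrCA ler_piMr ?(ltW e0)// ler_pdivrMr// mul1r lerDl.
Qed.

Lemma C0iR_mul f g : C0iR f -> C0iR g -> C0iR (fun b => f b * g b).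
Proof.
move=> hf; apply: (@C0iR_mulb _ _ (normsup f)); first by apply/econtP; case: hf.
by move=> b; exact: C0iR_bound.
Qed.

Lemma C0iR_scale c f : C0iR f -> C0iR (fun b => c * f b).
Proof.
apply: (@C0iR_mulb (fun=> c) _ (cabs c)) => //.
by apply: (@econt_lip _ _ 0) => x y; rewrite subrr cabs0 mul0r.
Qed.

End C0iRAlgebra.

(** * Strong limits of uniformly bounded operators *)

Section StrongLimits.
Context {R : realType} {X : completeNormedModType R[i]}.
Variables (D : set X) (V : nat -> X -> X) (K : R).
Hypothesis HD : densely_defined D.
Hypothesis Vlin : forall n x y, V n (x - y) = V n x - V n y.
Hypothesis Vbd : forall n x, rn (V n x) <= K * rn x.

Lemma strong_cauchy :
  (forall y (e : R), D y -> 0 < e -> exists N, forall m n, (N <= m)%N -> (N <= n)%N ->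
     rn (V m y - V n y) <= e) -> forall x, exists l, tends (fun n => V n x) l.
Proof.
move=> h x; apply: tends_cauchy => e e0.
have K1 : 0 < `|K| + 1 by rewrite ltr_wpDl.
have e3 : 0 < e / 3 by rewrite divr_gt0.
have [y Dy hy] := (denseP D).1 HD x _ (divr_gt0 e3 K1).
have [N hN] := h y _ Dy e3; exists N => m n hm hn.
have k p : rn (V p (x - y)) <= e / 3.
  move: hy; rewrite ler_pdivlMr// => hy; apply: le_trans (Vbd _ _) _; apply: le_trans hy.
  by rewrite mulrC ler_wpM2l ?rn_ge0// (le_trans (ler_norm K))// lerDl.
have -> : V m x - V n x = V m (x - y) + (V m y - V n y) - V n (x - y).
  by rewrite !Vlin addrA subrK opprB addrA subrK.
have := rnD (V m (x - y) + (V m y - V n y)) (- V n (x - y)).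
have := rnD (V m (x - y)) (V m y - V n y); rewrite rnN.
by have := k m; have := k n; have := hN m n hm hn; lra.
Qed.

Lemma strong_tends0 :
  (forall y, D y -> tends (fun n => V n y) 0) -> forall x, tends (fun n => V n x) 0.
Proof.
move=> h x e e0; have K1 : 0 < `|K| + 1 by rewrite ltr_wpDl.
have e2 : 0 < e / 2 by rewrite divr_gt0.
have [y Dy hy] := (denseP D).1 HD x _ (divr_gt0 e2 K1).
have [N hN] := h y Dy _ e2; exists N => n hn.
have k : rn (V n (x - y)) <= e / 2.
  move: hy; rewrite ler_pdivlMr// => hy; apply: le_trans (Vbd _ _) _; apply: le_trans hy.
  by rewrite mulrC ler_wpM2l ?rn_ge0// (le_trans (ler_norm K))// lerDl.
have -> : V n x - 0 = V n (x - y) + (V n y - 0) by rewrite Vlin !subr0 subrK.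
by rewrite (le_trans (rnD _ _))// [leRHS]splitr lerD// hN.
Qed.

End StrongLimits.

Lemma tends_rate {R : realType} {X : completeNormedModType R[i]} (u : nat -> X) l (C : R) :
  (forall n, rn (u n - l) <= C * n.+1%:R^-1) -> tends u l.
Proof.
move=> h e e0; exists (Num.truncn (`|C| / e)) => n hn; apply: le_trans (h n) _.
apply: (@le_trans _ _ (`|C| / n.+1%:R)).
  by rewrite ler_wpM2r ?invr_ge0// ler_norm.
rewrite ler_pdivrMr// [leRHS]mulrC -ler_pdivrMr//.
by rewrite ltW// (lt_le_trans (truncnS_gt _))// ler_nat.
Qed.

Section C0iRtoB.
Context {R : realType} {X : completeNormedModType R[i]}.
Variables (D : set X) (A : X -> X).
Hypothesis HD : densely_defined D.
Variable H : (R -> R[i]) -> X -> X.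
Hypothesis HH : bounded_alg_hom (@C0iR R) (@normsup R) H.
Hypothesis Hres : forall z, complex.Re z != 0 -> inv_plus D A z (H (rz_iR z)).
Implicit Types (f g : R[i] -> R[i]) (n : nat).

Let N1 n : R := n.+1%:R.
Let en n : R -> R[i] := fun b => ((N1 n)%:C)%C * rz_iR ((N1 n)%:C)%C b.

(* Restriction of [f] to a line approaching the imaginary axis, damped by an
   approximate identity of [C0(iR)]. *)
Definition approach f n : R -> R[i] := fun b => f ((n.+1%:R^-1) +i* b)%C * en n b.

Lemma N1_gt0 n : 0 < N1 n. Proof. by rewrite ltr0n. Qed.

Lemma N1C_neq0 n : complex.Re ((N1 n)%:C)%C != 0.
Proof. by rewrite /= gt_eqF// N1_gt0. Qed.

Lemma en_bound n b : cabs (en n b) <= 1.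
Proof.
have n0 := N1_gt0 n; rewrite /en cabsM cabs_real (gtr0_norm n0).
have := cabs_rz_iR ((N1 n)%:C)%C b (N1C_neq0 n); rewrite /= (gtr0_norm n0) => h.
by apply: le_trans (ler_wpM2l (ltW n0) h) _; rewrite divff// gt_eqF.
Qed.

Lemma en_C0iR n : C0iR (en n).
Proof. by apply: C0iR_scale; apply: C0iR_rz; exact: N1C_neq0. Qed.

(** [1 - en n b] is [i b] times the resolvent function at [n + 1], hence at most [|b| / (n + 1)] in
    modulus, and [|b| |r_z (i b)|] is bounded. So [en n] tends to 1 uniformly only in the presence
    of a resolvent factor. *)
Lemma en_sub1 n b z : complex.Re z != 0 ->
  cabs (1 - en n b) * cabs (rz_iR z b) <= (1 + cabs z / `|complex.Re z|) * n.+1%:R^-1.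
Proof.
move=> z0; have n0 := N1_gt0 n.
have hn := addz_neq0 ((N1 n)%:C)%C b (N1C_neq0 n); have hz := addz_neq0 z b z0.
have E : 1 - en n b = (0 +i* b)%C * rz_iR ((N1 n)%:C)%C b.
  by rewrite /en /rz_iR -{1}(divff hn) -mulrBl addrAC subrr add0r.
rewrite E cabsM cabs_i mulrAC [leRHS]mulrC [leLHS]mulrC.
have h1 := cabs_rz_iR ((N1 n)%:C)%C b (N1C_neq0 n); rewrite /= (gtr0_norm n0) in h1.
have h2 := cabs_rz_iR z b z0.
have h3 : `|b| <= cabs (z + (0 +i* b)%C) + cabs z.
  have := cabsD (z + (0 +i* b)%C) (- z); rewrite cabsN.
  have -> : z + (0 +i* b)%C - z = (0 +i* b)%C by rewrite addrAC subrr add0r.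
  by rewrite cabs_i.
have h4 : `|b| * cabs (rz_iR z b) <= 1 + cabs z / `|complex.Re z|.
  apply: le_trans (ler_wpM2r (cabs_ge0 _) h3) _; rewrite mulrDl lerD//.
    by rewrite /rz_iR cabsV divff// cabs_eq0.
  by rewrite ler_wpM2l ?cabs_ge0.
by apply: ler_pM => //; [exact: cabs_ge0|rewrite mulr_ge0// cabs_ge0].
Qed.

Lemma line_econt f n : Balg f -> econt (fun b => f ((n.+1%:R^-1) +i* b)%C).
Proof.
move=> hf x e e0; have hx : Cplus ((n.+1%:R^-1) +i* x)%C by rewrite /Cplus /= invr_gt0.
have [d d0 hd] := Balg_cont f hf _ hx e e0; exists d => // y hy.
have := hd (0 +i* (y - x))%C; rewrite cabs_i => /(_ hy).
have -> // : (0 +i* (y - x))%C + ((n.+1%:R^-1) +i* x)%C = ((n.+1%:R^-1) +i* y)%C :> R[i].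
by apply/eqP; rewrite eq_complex /= add0r subrK !eqxx.
Qed.

Lemma line_bound f n b : Balg f -> cabs (f ((n.+1%:R^-1) +i* b)%C) <= normB f.
Proof. by move=> hf; apply: normB_ge => //; rewrite /Cplus /= invr_gt0. Qed.

Lemma approach_C0iR f n : Balg f -> C0iR (approach f n).
Proof.
move=> hf; apply: (@C0iR_mulb _ _ _ (normB f)); first exact: line_econt.
  by move=> b; exact: line_bound.
exact: en_C0iR.
Qed.

Lemma approach_bound f n b : Balg f -> cabs (approach f n b) <= normB f.
Proof.
move=> hf; rewrite /approach cabsM (le_trans _ (line_bound f n b hf))//.
by rewrite ler_piMr ?cabs_ge0// en_bound.
Qed.

(** Convergence of [H (approach f n)] is checked on [D], the range of [H (r_1)], where the extra
    factor [r_1] makes the functions uniformly Cauchy. The uniform bound by [normB f] extends it to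
    [X] and passes to the limit. *)
Lemma C0iR_to_B : exists Phi : (R[i] -> R[i]) -> X -> X,
  bounded_alg_hom (@Balg R) (@normB R) Phi /\
  forall z, Cplus z -> inv_plus D A z (Phi (rz z)).
Proof.
have [Hl [Ha [Hs [Hm [C0 hC0]]]]] := HH.
have [C C_ge0 C0C] : exists2 C : R, 0 <= C & C0 <= C.
  by exists `|C0|; [exact: normr_ge0|exact: ler_norm].
have hC (g : R -> R[i]) (m : R) x : C0iR g -> (forall b, cabs (g b) <= m) -> rn (H g x) <= C * m * rn x.
  move=> hg hm; have := hC0 g hg x; rewrite rn_lin => /le_trans; apply.
  rewrite ler_wpM2r ?rn_ge0//.
  have s0 : 0 <= normsup g := le_trans (cabs_ge0 _) (C0iR_bound g 0 hg).
  apply: (@le_trans _ _ (C * normsup g)); first by rewrite ler_wpM2r.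
  by rewrite ler_wpM2l// normsup_le.
have hCd (g h : R -> R[i]) (m : R) x : C0iR g -> C0iR h -> (forall b, cabs (g b - h b) <= m) ->
    rn (H g x - H h x) <= C * m * rn x.
  move=> hg hh hm; have hN := C0iR_scale (-1) _ hh.
  have E : H g x - H h x = H (fun b => g b + -1 * h b) x.
    by rewrite (Ha _ _ hg hN) (Hs _ _ hh) scaleN1r.
  rewrite E; apply: hC; last by move=> b; rewrite mulN1r.
  have cg : econt g by apply/econtP; case: hg.
  have cN : econt (fun b => -1 * h b) by apply/econtP; case: hN.
  apply: C0iR_intro.
    apply/econtP => b; apply: cvgD; [exact: ((econtP _).1 cg b)|exact: ((econtP _).1 cN b)].
  move=> e e0; have e2 : 0 < e / 2 by rewrite divr_gt0.
  have [a _ ha] := C0iR_tail _ _ hg e2; have [a' _ ha'] := C0iR_tail _ _ hN e2.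
  exists (Num.max a a') => b; rewrite ge_max => /andP[/ha h1 /ha' h2].
  by rewrite (le_trans (cabsD _ _))// [leRHS]splitr lerD.
have one : complex.Re (1 : R[i]) != 0 by rewrite /= oner_neq0.
have c1 : C0iR (rz_iR (1 : R[i])) := C0iR_rz 1 one.
have r1b b : cabs (rz_iR 1 b) <= 1 :> R by case: (cabs_rz1_axis b).
have Drep y : D y -> exists w, y = H (rz_iR 1) w.
  by move=> Dy; exists (1 *: y + A y); have [_ [_ ->]] := Hres 1 one.
have lin f n : Balg f -> bounded_linear (H (approach f n)).
  by move=> hf; apply: Hl; exact: approach_C0iR.
have bd f n x : Balg f -> rn (H (approach f n) x) <= C * normB f * rn x.
  by move=> hf; apply: hC; [exact: approach_C0iR|move=> b; exact: approach_bound].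
pose k1 : R := 1 + cabs (1 : R[i]) / `|complex.Re (1 : R[i])|.
have k10 : 0 <= k1 by rewrite addr_ge0// divr_ge0 ?cabs_ge0.
have en1 n b : cabs (1 - en n b) * cabs (rz_iR 1 b) <= k1 * n.+1%:R^-1 := en_sub1 n b 1 one.
have nB0 f : Balg f -> 0 <= normB f.
  by move=> hf; apply: le_trans (line_bound f 0 0 hf); exact: cabs_ge0.
pose Phi f x := xget 0 [set l | tends (fun n => H (approach f n) x) l].
have PhiE f x l : tends (fun n => H (approach f n) x) l -> Phi f x = l.
  move=> hl; rewrite /Phi; case: xgetP => [y _ hy|/(_ l)//].
  exact: tends_unique hy hl.
have ex f x : Balg f -> tends (fun n => H (approach f n) x) (Phi f x).
  move=> hf; suff [l hl] : exists l, tends (fun n => H (approach f n) x) l.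
    by rewrite (PhiE _ _ _ hl).
  apply: (strong_cauchy D (fun n => H (approach f n)) (C * normB f) HD); first 2 last.
  - move=> y e /Drep[w ->] e0.
    have q0 : 0 < C * rn w + 1 by rewrite ltr_wpDl// mulr_ge0// rn_ge0.
    have e1 := divr_gt0 e0 q0; set e' := e / _ in e1.
    (* Three errors: the change of line between the two indices, and the defect [1 - en] at each of
       them. *)
    have e3 : 0 < e' / 3 by rewrite divr_gt0.
    have [d d0 hd] := Balg_unif_cauchy f _ hf e3.
    have p0 : 0 <= normB f * k1 by rewrite mulr_ge0// nB0.
    pose K := d^-1 + normB f * k1 / (e' / 3).
    have K0 : 0 <= K by rewrite addr_ge0 ?invr_ge0 ?(ltW d0)// divr_ge0// ltW.
    have small n : (Num.truncn K <= n)%N -> n.+1%:R^-1 < d /\ normB f * k1 * n.+1%:R^-1 <= e' / 3.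
      move=> hn; have hK : K < n.+1%:R.
        by rewrite (lt_le_trans (truncnS_gt _))// ler_nat.
      split.
        rewrite -[ltRHS]invrK ltf_pV2 ?posrE ?invr_gt0//.
        by apply: le_lt_trans hK; rewrite lerDl divr_ge0// ltW.
      rewrite ler_pdivrMr// [leRHS]mulrC -ler_pdivrMr//.
      by rewrite (le_trans _ (ltW hK))// lerDr invr_ge0 ltW.
    exists (Num.truncn K) => m n hm hn.
    have [sm tm] := small m hm; have [sn tn] := small n hn.
    rewrite -!Hm//; try exact: approach_C0iR.
    apply: le_trans (hCd _ _ e' w _ _ _) _.
    + by apply: C0iR_mul => //; exact: approach_C0iR.
    + by apply: C0iR_mul => //; exact: approach_C0iR.
    + move=> b; rewrite /approach.
      set fm := f _; set fn := f _; set rb := rz_iR 1 b.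
      have fmn : cabs (fm - fn) <= e' / 3.
        have [mn|nm] := leP m.+1%:R^-1 (n.+1%:R^-1 : R).
          by rewrite cabsB; apply: hd => //; rewrite invr_gt0.
        by apply: hd => //; exact: ltW.
      have -> : fm * en m b * rb - fn * en n b * rb = (fm - fn) * en m b * rb +
        (fn * ((1 - en n b) * rb) - fn * ((1 - en m b) * rb)) by ring.
      apply: le_trans (cabsD _ _) _; apply: le_trans (lerD (lexx _) (cabsD _ _)) _.
      rewrite cabsN !(cabsM fn) !(cabsM _ rb) (cabsM (fm - fn)).
      have b1 : cabs (fm - fn) * cabs (en m b) * cabs rb <= e' / 3.
        rewrite -mulrA (le_trans _ fmn)// ler_piMr ?cabs_ge0//.
        by apply: mulr_ile1; [exact: cabs_ge0|exact: cabs_ge0|exact: en_bound|exact: r1b].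
      have fb : cabs fn <= normB f by exact: line_bound.
      have b2 : cabs fn * (cabs (1 - en n b) * cabs rb) <= e' / 3.
        apply: le_trans tn; rewrite -[leRHS]mulrA; apply: ler_pM;
          [exact: cabs_ge0|by rewrite mulr_ge0 ?cabs_ge0|exact: fb|exact: en1].
      have b3 : cabs fn * (cabs (1 - en m b) * cabs rb) <= e' / 3.
        apply: le_trans tm; rewrite -[leRHS]mulrA; apply: ler_pM;
          [exact: cabs_ge0|by rewrite mulr_ge0 ?cabs_ge0|exact: fb|exact: en1].
      by move: b1 b2 b3; lra.
    rewrite /e' mulrAC mulrCA ler_piMr ?(ltW e0)// ler_pdivrMr// mul1r lerDl//.
  - by move=> n u v; rewrite (blinB _ (lin f n hf)).
  - by move=> n u; exact: bd.
have Pbd f x : Balg f -> rn (Phi f x) <= C * normB f * rn x.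
  by move=> hf; apply: tends_rn_le (ex f x hf) _ => n; exact: bd.
have Plin f : Balg f -> bounded_linear (Phi f).
  move=> hf; apply: (@blin_intro _ _ _ (C * normB f)) => [x y|c x|x].
  - apply: PhiE; have := tendsD _ _ _ _ (ex f x hf) (ex f y hf).
    by congr (tends _ _); apply: funext => n; rewrite (blinD _ (lin f n hf)).
  - apply: PhiE; have := tendsZ _ _ c (ex f x hf).
    by congr (tends _ _); apply: funext => n; rewrite (blinZ _ (lin f n hf)).
  - exact: Pbd.
have regroup (c p q k r s : R) : c * (p * q * (k * s)) * r <= c * (p * q * k) * r * s.
  by rewrite le_eqVlt; apply/orP; left; apply/eqP; ring.
have Pmul f g x : Balg f -> Balg g -> Phi (fun u => f u * g u) x = Phi f (Phi g x).
  move=> hf hg; apply: PhiE.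
  (* Membership of [f g] in B is not established, so its approaching function is handled as the
     bounded continuous restriction of [f] times [approach g n]. *)
  have cfg n : C0iR (approach (fun u => f u * g u) n).
    have -> : approach (fun u => f u * g u) n =
        (fun b => f ((n.+1%:R^-1) +i* b)%C * approach g n b).
      by apply: funext => b; rewrite /approach mulrA.
    apply: (@C0iR_mulb _ _ _ (normB f)); [exact: line_econt|by move=> b; exact: line_bound|].
    exact: approach_C0iR.
  have bfg n b : cabs (approach (fun u => f u * g u) n b) <= normB f * normB g.
    rewrite /approach -mulrA cabsM ler_pM ?cabs_ge0//; first exact: line_bound.
    exact: approach_bound.
  have lfg n : bounded_linear (H (approach (fun u => f u * g u) n)) by exact: Hl.
  have NB0 := nB0 f hf; have NB0' := nB0 g hg.
  (* The product of the two approaching functions carries [en n] twice, that of [f g] only once;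
     after a factor [r_1] the discrepancy [1 - en n] is of order [1 / (n + 1)]. *)
  pose V n y := H (approach (fun u => f u * g u) n) y - H (approach f n) (H (approach g n) y).
  have hV : tends (fun n => V n x) 0.
    apply: (strong_tends0 D V (C * (normB f * normB g) + C * normB f * (C * normB g)) HD).
    - move=> n u v; rewrite /V (blinB _ (lfg n)) (blinB _ (lin g n hg)) (blinB _ (lin f n hf)).
      by rewrite !opprB [LHS]addrACA [RHS]addrACA; congr (_ + _); exact: addrC.
    - move=> n u; rewrite /V (le_trans (rnD _ _))// rnN mulrDl lerD//.
        exact: hC.
      have p0 : 0 <= C * normB f := mulr_ge0 C_ge0 NB0.
      apply: le_trans (bd f n _ hf) _; rewrite -(mulrA (C * normB f)).
      exact: (ler_wpM2l p0 (bd g n u hg)).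
    move=> y /Drep[w ->]; apply: (@tends_rate _ _ _ _ (C * (normB f * normB g * k1) * rn w)) => n.
    rewrite subr0 /V -(Hm _ _ (approach_C0iR g n hg) c1).
    have cgr := C0iR_mul _ _ (approach_C0iR g n hg) c1.
    rewrite -(Hm _ _ (approach_C0iR f n hf) cgr) -(Hm _ _ (cfg n) c1).
    apply: le_trans (hCd _ _ (normB f * normB g * (k1 * n.+1%:R^-1)) w _ _ _) _.
    - exact: C0iR_mul.
    - by apply: C0iR_mul => //; exact: approach_C0iR.
    - move=> b; rewrite /approach; set fn := f _; set gn := g _; set rb := rz_iR 1 b.
      have -> : fn * gn * en n b * rb - fn * en n b * (gn * en n b * rb) =
         fn * (gn * en n b) * ((1 - en n b) * rb) by ring.
      rewrite cabsM (cabsM fn) (cabsM _ rb).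
      apply: ler_pM; [by rewrite mulr_ge0 ?cabs_ge0|by rewrite mulr_ge0 ?cabs_ge0| |exact: en1].
      by apply: ler_pM; [exact: cabs_ge0|exact: cabs_ge0|exact: line_bound|exact: approach_bound].
    - exact: regroup.
  (* Uniform boundedness of [H (approach f n)] lets the strong limits compose. *)
  have hW : tends (fun n => H (approach f n) (H (approach g n) x - Phi g x)) 0.
    move=> e e0; have K1 : 0 < C * normB f + 1 by exact: ltr_wpDl (mulr_ge0 C_ge0 NB0) ltr01.
    have [N hN] := ex g x hg _ (divr_gt0 e0 K1); exists N => n /hN.
    rewrite ler_pdivlMr// subr0 => h; apply: le_trans (bd _ _ _ hf) _; apply: le_trans h.
    by rewrite mulrC ler_wpM2l ?rn_ge0// lerDl.
  have := tendsD _ _ _ _ (tendsD _ _ _ _ hV hW) (ex f (Phi g x) hf).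
  rewrite !add0r; congr (tends _ _); apply: funext => n.
  by rewrite /V (blinB _ (lin f n hf)) addrA subrK subrK.
exists Phi; split.
  split; first exact: Plin.
  split.
    move=> f g hf hg x; apply: PhiE; have := tendsD _ _ _ _ (ex f x hf) (ex g x hg).
    congr (tends _ _); apply: funext => n.
    rewrite -Ha; [|exact: approach_C0iR|exact: approach_C0iR].
    by congr (H _ x); apply: funext => b; rewrite /approach mulrDl.
  split.
    move=> c f hf x; apply: PhiE; have := tendsZ _ _ c (ex f x hf).
    congr (tends _ _); apply: funext => n.
    rewrite -Hs; [|exact: approach_C0iR].
    by congr (H _ x); apply: funext => b; rewrite /approach mulrA.
  split; first by move=> f g hf hg x; exact: Pmul.
  by exists C => f hf x; rewrite rn_lin; exact: Pbd.
move=> z hz; have z0 : complex.Re z != 0 by rewrite gt_eqF.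
have -> : Phi (rz z) = H (rz_iR z); last exact: Hres.
apply: funext => x; apply: PhiE.
have cz : C0iR (rz_iR z) := C0iR_rz z z0.
pose s n : R[i] := (n.+1%:R^-1%:C)%C.
have zs n : complex.Re (z + s n) != 0.
  by rewrite raddfD /= gt_eqF// addr_gt0// invr_gt0.
(* Moving to the line [Re = 1 / (n + 1)] only shifts the parameter of the resolvent function, so
   here the convergence is in sup norm, with a rate. *)
have shiftE n b : rz z ((n.+1%:R^-1) +i* b)%C = rz_iR (z + s n) b.
  rewrite /rz /rz_iR; congr (_^-1); rewrite -addrA; congr (_ + _).
  by apply/eqP; rewrite eq_complex /= addr0 add0r !eqxx.
have ca n : C0iR (approach (rz z) n).
  have -> : approach (rz z) n = (fun b => rz_iR (z + s n) b * en n b).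
    by apply: funext => b; rewrite /approach shiftE.
  by apply: C0iR_mul; [exact: C0iR_rz|exact: en_C0iR].
pose r := `|complex.Re z|^-1.
have r0 : 0 <= r by rewrite invr_ge0.
have rs n b : cabs (rz_iR (z + s n) b) <= r.
  apply: le_trans (cabs_rz_iR _ _ (zs n)) _; rewrite lef_pV2 ?posrE ?normr_gt0//.
  have n0 : 0 < n.+1%:R^-1 :> R by rewrite invr_gt0.
  by rewrite raddfD /= !gtr0_norm ?addr_gt0// lerDl ltW.
(* [r * r] comes from the resolvent identity between [z + s n] and [z], the other summand from
   [en_sub1]. *)
apply: (@tends_rate _ _ _ _ (C * (r * r + (1 + cabs z / `|complex.Re z|)) * rn x)) => n.
rewrite mulrAC -(mulrA C); apply: hCd => // b.
rewrite /approach shiftE.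
have E : rz_iR (z + s n) b * en n b - rz_iR z b =
    - (s n * (rz_iR (z + s n) b * rz_iR z b)) * en n b - (1 - en n b) * rz_iR z b.
  have h1 := addz_neq0 z b z0; have h2 := addz_neq0 (z + s n) b (zs n).
  have -> : s n * (rz_iR (z + s n) b * rz_iR z b) = rz_iR z b - rz_iR (z + s n) b.
    have inv2 (u v : R[i]) : u != 0 -> v != 0 -> (u - v) * (u^-1 * v^-1) = v^-1 - u^-1.
      by move=> u0 v0; rewrite mulrBl mulVKf// mulrCA divff// mulr1.
    rewrite /rz_iR -(inv2 _ _ h2 h1); congr (_ * _).
    by rewrite opprD addrACA subrr addr0 addrAC subrr add0r.
  by ring.
rewrite E (le_trans (cabsD _ _))// cabsN [leRHS]mulrDl lerD//.
  rewrite cabsM cabsN (cabsM (s n)) (cabsM (rz_iR _ b)).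
  have n0 : 0 < n.+1%:R^-1 :> R by rewrite invr_gt0.
  rewrite /s cabs_real (gtr0_norm n0) -[leLHS]mulrA [leRHS]mulrC ler_wpM2l ?(ltW n0)//.
  apply: (@le_trans _ _ (cabs (rz_iR (z + s n) b) * cabs (rz_iR z b))).
    by apply: ler_piMr; [rewrite mulr_ge0 ?cabs_ge0|exact: en_bound].
  by apply: ler_pM; [exact: cabs_ge0|exact: cabs_ge0|exact: rs|exact: cabs_rz_iR].
by rewrite cabsM; exact: en_sub1.
Qed.

End C0iRtoB.

Theorem mainTheorem14 (R : realType) (X : completeNormedModType R[i])
    (T : R -> X -> X) (D : set X) (A : X -> X) :
  C0_group T -> bounded_group T ->
  generator T D (fun x => - A x) ->
  (B_calculus D A <-> C0iR_calculus D A).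
Proof.
move=> HT HB HG; split.
  move=> [lA [dD [_ [Phi [hPhi hres]]]]].
  have h1 : inv_plus D A 1 (Phi (rz 1)) by apply: hres; rewrite /Cplus /= ltr01.
  have [H [hH hHz]] := B_to_C0iR _ _ _ HT HB HG dD _ hPhi h1.
  split=> //; split; first exact: inv_plus_closed h1.
  split=> //; split; last by exists H.
  (* For [l] off the axis, [H (rz_iR (- l))] inverts [- l + A], so [l] is not in the spectrum. *)
  move=> l hl; apply: contrapT => /eqP h; apply: hl; exists (H (rz_iR (- l))).
  by apply: hHz; rewrite raddfN /= oppr_eq0.
move=> [lA [_ [dD [sp [H [hH hres]]]]]].
split=> //; split=> //; split; first by move=> l /sp ->.
exact: C0iR_to_B dD _ hH hres.
Qed.
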